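(* Let $(Y,\omega,J)$ be a Kähler manifold of complex dimension $n+1$ with a nowhere vanishing holomorphic $(n+1)$-form $\Omega$, and let $v:Y\to\mathbb{C}$ be a holomorphic function making $(Y,\omega,v)$ a symplectic Landau-Ginzburg model, with set of regular values $C$ and $Y_C=v^{-1}(C)$. Consider two fibered Lagrangians $L_0,L_1\subset Y_C$ and a point $p\in L_0\cap L_1$ at which $L_0$ and $L_1$ intersect transversely (so that, with $c=v(p)$, $L_{0,c}=L_0\cap Y_c$ and $L_{1,c}=L_1\cap Y_c$ intersect transversely in $Y_c$ at $p$). Assume the fiber Lagrangians $L_{j,c}$ admit gradings $\widetilde{L}_{j,c}$ for $j=0,1$, and let $\widetilde{v(L_j)}$ be gradings of $v(L_j)\subset\mathbb{C}$, $j=0,1$. Then $L_0,L_1$ admit gradings $\widetilde{L}_0,\widetilde{L}_1$ such that $$\deg(\widetilde{L}_0,\widetilde{L}_1;p)=\deg_{Y_c}(\widetilde{L}_{0,c},\widetilde{L}_{1,c};p)+\deg_{\mathbb{C}}(\widetilde{v(L_0)},\widetilde{v(L_1)};c).$$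
   Context: **Setting.** $(Y,\omega,J)$ is Kähler of complex dimension $n+1$, $v:Y\to\mathbb{C}$ is holomorphic with finite set of critical values $\mathrm{critv}(v)$, $C=\mathbb{C}\setminus\mathrm{critv}(v)$, $Y_C=v^{-1}(C)$, and $v:Y_C\to C$ is a symplectic fibration (locally trivial, with symplectic fiber and structure group in the symplectomorphism group of the fiber). For $c\in C$, $Y_c=v^{-1}(c)$ is a Kähler manifold with $\omega_c=\omega|_{Y_c}$. $\Omega$ is a nowhere vanishing holomorphic $(n+1)$-form on $Y$. For $c\in C$, $\Omega_c$ is the nowhere vanishing holomorphic $n$-form on $Y_c$ given by the Poincaré residue of $\Omega/(v-c)$: in local holomorphic coordinates $(z_1,\dots,z_{n+1})$ with $z_{n+1}=v$ and $\Omega=a(z_1,\dots,z_{n+1})\,dz_1\wedge\cdots\wedge dz_{n+1}$, one has $\Omega_c=a(z_1,\dots,z_n,c)\,dz_1\wedge\cdots\wedge dz_n$. The base $\mathbb{C}$ carries $\omega_{\mathbb{C}}=dx\wedge dy$ and the holomorphic volume form $dz$. **Fibered Lagrangian.** A Lagrangian $L\subset Y$ for which there is a smooth embedded curve $\gamma:\mathbb{R}\to C$ with $v(L)=\gamma(\mathbb{R})$, $v|_L:L\to\gamma(\mathbb{R})$ a locally trivial fibration, and $L_c=L\cap Y_c$ Lagrangian in $(Y_c,\omega_c)$ for all $c\in\gamma(\mathbb{R})$. **Gradings.** Let $(M,\omega_M,\Omega_M)$ be one of $(Y,\omega,\Omega)$, $(Y_c,\omega_c,\Omega_c)$ with $c\in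 C$, $(\mathbb{C},\omega_{\mathbb{C}},dz)$, of complex dimension $m$. For a linear Lagrangian subspace $V\subset T_pM$ with $\mathbb{R}$-basis $e_1,\dots,e_m$, its squared phase is $\alpha_M(p,V)=\Omega_M(e_1,\dots,e_m)^2/|\Omega_M(e_1,\dots,e_m)|^2\in U(1)$ (independent of the basis). For a Lagrangian submanifold $L\subset M$, $\alpha_L(p)=\alpha_M(p,T_pL)$; a grading of $L$ is a smooth $\widetilde{\alpha}_L:L\to\mathbb{R}$ with $e^{2\pi i\widetilde{\alpha}_L}=\alpha_L$, and $\widetilde{L}=(L,\widetilde{\alpha}_L)$ is a graded Lagrangian. **Degree.** Let $\widetilde{L}_0,\widetilde{L}_1$ be graded Lagrangians in $M$ meeting transversely at $p$. Choose a linear symplectomorphism $A:T_pM\to\mathbb{C}^m$ with $A(T_pL_0)=\mathbb{R}^m$ and $A(T_pL_1)=i\mathbb{R}^m$. The canonical short path is $\lambda(t)=A^{-1}(e^{-i\pi t/2}\mathbb{R}^m)$, $t\in[0,1]$, a path of linear Lagrangian subspaces from $T_pL_0$ to $T_pL_1$. Let $\alpha_\lambda(t)=\alpha_M(p,\lambda(t))$ and let $\widetilde{\alpha}_\lambda:[0,1]\to\mathbb{R}$ be the continuous lift ($e^{2\pi i\widetilde{\alpha}_\lambda}=\alpha_\lambda$) with $\widetilde{\alpha}_\lambda(0)=\widetilde{\alpha}_{L_0}(p)$. Then $$\deg_M(\widetilde{L}_0,\widetilde{L}_1;p)=(\widetilde{\alpha}_{L_1}(p)-\widetilde{\alpha}_{L_0}(p))-(\widetilde{\alpha}_\lambda(1)-\widetilde{\alpha}_\lambda(0)).$$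 For $M=Y$ one writes $\deg$ instead of $\deg_Y$. For a fibered Lagrangian, $T_pL=(T_pL\cap\ker dv_p)\oplus(T_pL\cap(\ker dv_p)^{\perp_\omega})$. *)

(* Defs.v *)
From HB Require Import structures.
From mathcomp Require Import all_boot all_order all_algebra.
From mathcomp Require Import complex.
From mathcomp Require Import all_classical all_reals all_analysis.

Set Implicit Arguments.
Unset Strict Implicit.
Unset Printing Implicit Defensive.

Import Order.TTheory GRing.Theory Num.Theory.
Import numFieldNormedType.Exports.

Local Open Scope classical_set_scope.
Local Open Scope ring_scope.

Section Calculus.
Variable R : realType.

Fixpoint Ck (N k l : nat) (U : set 'rV[R]_k) (f : 'rV[R]_k -> 'rV[R]_l) : Prop :=
  match N with
  | 0 => forall x, U x -> {for x, continuous f}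
  | N'.+1 => (forall x, U x -> differentiable f x) /\
             (forall u : 'rV[R]_k, Ck N' U (fun x => 'D_u f x))
  end.

Definition smooth (k l : nat) (U : set 'rV[R]_k) (f : 'rV[R]_k -> 'rV[R]_l) : Prop :=
  forall N, Ck N U f.

(* C^m is R^(m + m), the row (x, y) standing for x + i y.  With vectors as rows
   and matrices acting on the right, [Jmx m] is multiplication by i,
   (x, y) |-> (- y, x).  The same matrix is the Gram matrix of the standard
   symplectic form sum_j dx_j /\ dy_j, i.e. ((x,y), (x',y')) |-> x.y' - y.x'. *)
Definition Jmx (m : nat) : 'M[R]_(m + m) := block_mx 0 1%:M (- 1%:M) 0.
Definition omega_std (m : nat) : 'M[R]_(m + m) := block_mx 0 1%:M (- 1%:M) 0.

Definition cmx (d m : nat) (A : 'M[R]_(d, m + m)) : 'M[R[i]]_(d, m) :=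
  \matrix_(i, j) Complex (A i (lshift m j)) (A i (rshift m j)).

Definition form (k : nat) (M : 'M[R]_k) (u w : 'rV[R]_k) : R :=
  (u *m M *m w^T) ord0 ord0.

(* Smooth with complex linear differential; the Jacobian ['J f x] acts on rows
   from the right. *)
Definition holomorphic (m l : nat) (U : set 'rV[R]_(m + m))
    (f : 'rV[R]_(m + m) -> 'rV[R]_(l + l)) : Prop :=
  smooth U f /\ forall x, U x -> Jmx m *m 'J f x = 'J f x *m Jmx l.

Definition cis (t : R) : R[i] := Complex (cos t) (sin t).

Definition rowspace (d k : nat) (A : 'M[R]_(d, k)) : set 'rV[R]_k :=
  [set u | (u <= A)%MS].

End Calculus.

(* Chart data: [cmap p], with inverse [cinv p], is a chosen chart around [p],
   defined on [cdom p].  The tangent space at [p] is R^k, a tangent vector being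
   represented by its components in the chosen chart at [p].
   The axioms of a manifold are stated separately. *)
Record charted (R : realType) (k : nat) := Charted {
  pt :> topologicalType;
  cdom : pt -> set pt;
  cmap : pt -> pt -> 'rV[R]_k;
  cinv : pt -> 'rV[R]_k -> pt }.

Section Manifolds.
Variable R : realType.

Definition cimg k (X : charted R k) (p : X) : set 'rV[R]_k := cmap p @` cdom p.

Definition model (k : nat) : charted R k :=
  @Charted R k 'rV[R]_k (fun=> setT) (fun _ x => x) (fun _ x => x).

Definition line : charted R 1 :=
  @Charted R 1 R (fun=> setT) (fun _ x => const_mx x) (fun _ w => w ord0 ord0).

Definition plane : charted R (1 + 1) := model (1 + 1).

Definition prodC k l (X : charted R k) (Z : charted R l) : charted R (k + l) :=
  @Charted R (k + l) (X * Z)%type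
    (fun p => cdom p.1 `*` cdom p.2)
    (fun p q => row_mx (cmap p.1 q.1) (cmap p.2 q.2))
    (fun p w => (cinv p.1 (lsubmx w), cinv p.2 (rsubmx w))).

Definition complex_manifold (m : nat) (X : charted R (m + m)) : Prop :=
  [/\ hausdorff_space X,
      @second_countable X,
      (forall p : X, [/\ cdom p p, open (cdom p) & open (cimg p)]),
      (forall p : X,
         [/\ (forall q, cdom p q -> cinv p (cmap p q) = q),
             (forall q, cdom p q -> {for q, continuous (cmap p)})
           & (forall x, cimg p x -> {for x, continuous (cinv p)})])
    & (forall p q : X, holomorphic (cmap p @` (cdom p `&` cdom q))
                                   (cmap q \o cinv p))].

(* Smooth maps on an arbitrary subset: locally the restriction of a smooth map
   defined on an open set. *)
Definition smooth_on k l (X : charted R k) (Z : charted R l) (A : set X)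
    (f : X -> Z) : Prop :=
  forall p, A p -> exists (W : set X) (g : X -> Z),
    [/\ open W /\ W p, W `<=` cdom p, W `<=` g @^-1` cdom (f p),
        (forall q, A q -> W q -> g q = f q)
      & smooth (cmap p @` W) (cmap (f p) \o g \o cinv p)].

(* Differential at [p], in the charts chosen at [p] and at [f p]. *)
Definition Dmx k l (X : charted R k) (Z : charted R l) (f : X -> Z) (p : X) :
    'M[R]_(k, l) :=
  'J (cmap (f p) \o f \o cinv p) (cmap p p).

Definition coords k (X : charted R k) (W : set X) (z : X -> 'rV[R]_k) : Prop :=
  exists zi : 'rV[R]_k -> X,
    [/\ open W, open (z @` W),
        @smooth_on k k X (model k) W z,
        @smooth_on k k (model k) X (z @` W) zi
      & forall q, W q -> zi (z q) = q].

Definition holo_coords m (X : charted R (m + m)) (W : set X)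
    (z : X -> 'rV[R]_(m + m)) : Prop :=
  coords W z /\
  forall q, W q -> Jmx R m *m @Dmx _ _ X (model (m + m)) z q
                   = @Dmx _ _ X (model (m + m)) z q *m Jmx R m.

Definition submanifold (d : nat) k (X : charted R k) (S : set X) : Prop :=
  forall p, S p -> exists (W : set X) (z : X -> 'rV[R]_k),
    [/\ W p, coords W z
      & forall q, W q -> (S q <-> forall i : 'I_k, (d <= i)%N -> z q ord0 i = 0)].

(* Velocities at [p] of smooth curves lying in [S]. *)
Definition tangent k (X : charted R k) (S : set X) (p : X) : set 'rV[R]_k :=
  [set u | exists (I : set R) (c : R -> X),
     [/\ open I /\ I 0, @smooth_on 1 k line X I c,
         (forall t, I t -> S (c t)), c 0 = p & u = @Dmx 1 k line X c 0]].

Definition transverse k (X : charted R k) (S S' : set X) (p : X) : Prop :=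
  forall u : 'rV[R]_k, exists u1 u2,
    [/\ tangent S p u1, tangent S' p u2 & u = u1 + u2].

(* Over [U `&` B], with [U] a neighbourhood of [b], the map [f : A -> B] is
   identified with the projection (U `&` B) * F -> U `&` B, where F is the
   fibre over [b], by the diffeomorphism q |-> (f q, psi q) with inverse [chi]. *)
Definition trivialization k l (X : charted R k) (Z : charted R l)
    (A : set X) (B : set Z) (f : X -> Z) (b : Z) (U : set Z)
    (psi : X -> X) (chi : Z * X -> X) : Prop :=
  [/\ open U /\ U b,
      smooth_on (A `&` f @^-1` U) psi,
      @smooth_on _ _ (prodC Z X) X ((U `&` B) `*` (A `&` f @^-1` [set b])) chi,
      (forall q, A q -> U (f q) ->
         [/\ A (psi q), f (psi q) = b & chi (f q, psi q) = q])
    & (forall y q, U y -> B y -> A q -> f q = b ->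
         [/\ A (chi (y, q)), f (chi (y, q)) = y & psi (chi (y, q)) = q])].

Definition locally_trivial k l (X : charted R k) (Z : charted R l)
    (A : set X) (B : set Z) (f : X -> Z) : Prop :=
  [/\ smooth_on A f, (forall q, A q -> B (f q))
    & forall b, B b -> exists U psi chi, trivialization A B f b U psi chi].

End Manifolds.

Arguments plane : clear implicits.

Section Kahler.
Variables (R : realType) (m : nat) (Y : charted R (m + m)).

(* A 2-form gives at each [q] its Gram matrix in the chart chosen at [q];
   [om_loc p] is its expression in the chart chosen at [p]. *)
Definition om_loc (om : Y -> 'M[R]_(m + m)) (p : Y) (x : 'rV[R]_(m + m)) :
    'M[R]_(m + m) :=
  let q := cinv p x in
  let D := 'J (cmap q \o cinv p) x in D *m om q *m D^T.

Definition closed_form (om : Y -> 'M[R]_(m + m)) : Prop :=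
  forall p x, cimg p x -> forall i j l : 'I_(m + m),
    'D_(delta_mx ord0 i) (fun y => om_loc om p y j l) x
    + 'D_(delta_mx ord0 j) (fun y => om_loc om p y l i) x
    + 'D_(delta_mx ord0 l) (fun y => om_loc om p y i j) x = 0.

Definition kahler (om : Y -> 'M[R]_(m + m)) : Prop :=
  [/\ complex_manifold Y,
      (forall p, smooth (cimg p) (fun x => mxvec (om_loc om p x))),
      closed_form om
    & forall p, [/\ (om p)^T = - om p,
                    Jmx R m *m om p *m (Jmx R m)^T = om p
                  & forall u, u != 0 -> 0 < form (om p) u (u *m Jmx R m)]].

(* A holomorphic m-form a dz_1 /\ ... /\ dz_m is given at each [q] by its
   coefficient in the chart chosen at [q]; [volf a e] is its value on the
   rows of [e]. *)
Definition volf (a : R[i]) (e : 'M[R]_(m, m + m)) : R[i] := a * \det (cmx e).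

Definition vol_loc (Om : Y -> R[i]) (p : Y) (x : 'rV[R]_(m + m)) : R[i] :=
  let q := cinv p x in
  volf (Om q) (\matrix_(i < m) (delta_mx ord0 (lshift m i) *m 'J (cmap q \o cinv p) x)).

Definition holo_volume_form (Om : Y -> R[i]) : Prop :=
  (forall p, Om p != 0) /\
  forall p, holomorphic (cimg p)
    (fun x => row_mx (const_mx (complex.Re (vol_loc Om p x)))
                     (const_mx (complex.Im (vol_loc Om p x))) : 'rV[R]_(1 + 1)).

Definition holo_function (v : Y -> plane R) : Prop :=
  forall p, holomorphic (cimg p) (v \o cinv p).

Definition critv (v : Y -> plane R) : set (plane R) :=
  v @` [set q | Dmx v q = 0].

Definition regv (v : Y -> plane R) : set (plane R) := ~` critv v.

Definition fiber (v : Y -> plane R) (c : plane R) : set Y := v @^-1` [set c].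

(* ker dv_q, which is T_q Y_c for q in Y_c and c a regular value. *)
Definition vert (v : Y -> plane R) (q : Y) : set 'rV[R]_(m + m) :=
  [set u | u *m Dmx v q = 0].

(* The fibre model near [c] is Y_c with omega_c; [psi] restricts to
   symplectomorphisms from the nearby fibres to Y_c. *)
Definition symplectic_fibration (om : Y -> 'M[R]_(m + m)) (v : Y -> plane R) : Prop :=
  locally_trivial (v @^-1` regv v) (regv v) v /\
  forall c, regv v c -> exists U psi chi,
    [/\ U `<=` regv v,
        trivialization (v @^-1` regv v) (regv v) v c U psi chi
      & forall q, U (v q) -> forall u w, vert v q u -> vert v q w ->
          form (om (psi q)) (u *m Dmx psi q) (w *m Dmx psi q) = form (om q) u w].

Definition symplectic_LG (om : Y -> 'M[R]_(m + m)) (v : Y -> plane R) : Prop :=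
  [/\ holo_function v, finite_set (critv v) & symplectic_fibration om v].

End Kahler.

(* Value at [q] on the rows of [e] of the Poincare residue of Omega / (v - v q):
   in holomorphic coordinates with z_{n+1} = v and Omega = a dz_1 /\ ... /\ dz_{n+1},
   it is a dz_1 /\ ... /\ dz_n. *)
Definition residue (R : realType) (n : nat) (Y : charted R (n.+1 + n.+1))
    (Om : Y -> R[i]) (v : Y -> plane R) (q : Y)
    (e : 'M[R]_(n, n.+1 + n.+1)) : R[i] :=
  xget 0 [set w | exists (W : set Y) (z : Y -> 'rV[R]_(n.+1 + n.+1)) (a : R[i]),
    let D := @Dmx R _ _ Y (model R (n.+1 + n.+1)) z q in
    [/\ W q, holo_coords W z,
        (forall q', W q' -> cmx (z q') ord0 ord_max
                            = cmx (v q' : 'rV[R]_(1 + 1)) ord0 ord0),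
        (forall E : 'M[R]_(n.+1, n.+1 + n.+1), volf (Om q) E = a * \det (cmx (E *m D)))
      & w = a * \det (\matrix_(i < n, j < n)
                        cmx (e *m D) i (widen_ord (leqnSn n) j))]].

Section Gradings.
Variable R : realType.

(* [d] is half the real dimension of the ambient symplectic manifold, which is
   the manifold carrying [om] or a symplectic submanifold of it. *)
Definition lagrangian (d : nat) k (X : charted R k) (om : X -> 'M[R]_k)
    (L : set X) : Prop :=
  submanifold d L /\
  forall p, L p -> forall u w, tangent L p u -> tangent L p w -> form (om p) u w = 0.

(* Here [Om e] is the value of the volume form on the rows of [e]; the result does
   not depend on the basis [e] of [V]. *)
Definition squared_phase (m k : nat) (Om : 'M[R]_(m, k) -> R[i])
    (V : set 'rV[R]_k) : R[i] :=
  xget 0 [set w | exists e : 'M[R]_(m, k),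
    [/\ row_free e, V = rowspace e & w = Om e ^+ 2 / `|Om e| ^+ 2]].

Definition grading (m k : nat) (X : charted R k) (Om : X -> 'M[R]_(m, k) -> R[i])
    (L : set X) (alpha : X -> R) : Prop :=
  @smooth_on R k 1 X (line R) L alpha /\
  forall p, L p -> cis (2 * pi * alpha p) = squared_phase (Om p) (tangent L p).

(* e^{- i pi t / 2} x for x in R^m. *)
Definition short_rot (m : nat) (t : R) (x : 'rV[R]_m) : 'rV[R]_(m + m) :=
  row_mx (cos (pi * t / 2) *: x) (- sin (pi * t / 2) *: x).

(* Degree for a symplectic vector space ([T], [om]) of complex dimension [m]
   contained in R^k, with volume form [Om], Lagrangian subspaces [V0], [V1] and
   lifts [a0], [a1] of their squared phases.  The rows of [B] are the images of the
   standard basis under the inverse of the symplectomorphism A : T -> C^m, and [l]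
   is the lift of the squared phase along the canonical short path. *)
Definition degree (m k : nat) (T : set 'rV[R]_k) (om : 'M[R]_k)
    (Om : 'M[R]_(m, k) -> R[i]) (V0 V1 : set 'rV[R]_k) (a0 a1 : R) : R :=
  xget 0 [set d | exists (B : 'M[R]_(m + m, k)) (l : R -> R),
    [/\ T = rowspace B /\ B *m om *m B^T = omega_std R m,
        V0 = [set row_mx x 0 *m B | x in [set: 'rV[R]_m]] /\
        V1 = [set row_mx 0 x *m B | x in [set: 'rV[R]_m]],
        {within `[0, 1], continuous l} /\ l 0 = a0,
        (forall t, 0 <= t <= 1 -> cis (2 * pi * l t)
           = squared_phase Om [set short_rot t x *m B | x in [set: 'rV[R]_m]])
      & d = (a1 - a0) - (l 1 - l 0)]].

End Gradings.

Section LandauGinzburg.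
Variables (R : realType) (n : nat) (Y : charted R (n.+1 + n.+1)).
Variables (om : Y -> 'M[R]_(n.+1 + n.+1)) (Om : Y -> R[i]) (v : Y -> plane R).

Definition embedded_curve (g : R -> plane R) : Prop :=
  [/\ @smooth_on R _ _ (line R) (plane R) setT g, injective g,
      (forall t, @Dmx R _ _ (line R) (plane R) g t != 0)
    & (forall t (I : set R), open I -> I t ->
         exists U : set (plane R), [/\ open U, U (g t) & forall s, U (g s) -> I s])].

Definition fibered_lagrangian (L : set Y) : Prop :=
  lagrangian n.+1 om L /\
  exists g : R -> plane R,
    [/\ embedded_curve g, range g `<=` regv v, v @` L = range g,
        locally_trivial L (range g) v
      & forall c, range g c -> lagrangian n om (L `&` fiber v c)].

Definition OmY (p : Y) : 'M[R]_(n.+1, n.+1 + n.+1) -> R[i] := volf (Om p).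
Definition OmF (p : Y) : 'M[R]_(n, n.+1 + n.+1) -> R[i] := residue Om v p.
Definition OmC (c : plane R) : 'M[R]_(1, 1 + 1) -> R[i] := @volf R 1 1.

Definition deg_total (L0 L1 : set Y) (a0 a1 : Y -> R) (p : Y) : R :=
  degree setT (om p) (OmY p) (tangent L0 p) (tangent L1 p) (a0 p) (a1 p).

Definition deg_fiber (L0 L1 : set Y) (a0 a1 : Y -> R) (p : Y) : R :=
  degree (vert v p) (om p) (OmF p) (tangent L0 p) (tangent L1 p) (a0 p) (a1 p).

Definition deg_base (S0 S1 : set (plane R)) (a0 a1 : plane R -> R) (c : plane R) : R :=
  degree setT (omega_std R 1) (OmC c) (tangent S0 c) (tangent S1 c) (a0 c) (a1 c).

End LandauGinzburg.

(* Main.v *)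
(* The tangent space of a fibered Lagrangian L splits as T L_c + <h> with dv(h) tangent to v(L), and
   the Poincare residue satisfies Omega(h, e_1, ..., e_n) = +- dv(h) Omega_c(e_1, ..., e_n).  Hence
   squared phases multiply: alpha_L = alpha_{L_c} * alpha_{v(L)} over c.  The sum of the given
   gradings is therefore a lift of alpha_L on the fibre L_c; it extends to L because L -> v(L) is a
   locally trivial bundle over an embedded line, so that homotopy lifting in trivializations and
   uniqueness of lifts propagate it along the line.  At an intersection point, symplectic bases
   adapted to the fibre Lagrangians and to the base curves combine (after making h symplectically
   orthogonal to the fibre and rescaling by the conformal factor of dv) into an adapted basis
   of the total space whose canonical short path is the sum of the two short paths, and degrees add.
   The degree does not depend on the adapted basis: two bases differ by diag(P, P^-T), which
   replaces the short path cos B1 - sin B2 by cos B1 - sin S B2 with S positive definite, and S is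
   joined to 1 through positive definite matrices; Lagrangian frames of a Kaehler space are totally
   real, so the phase stays defined along the homotopy. *)
Require Import Defs.
From HB Require Import structures.
From mathcomp Require Import all_boot all_order all_algebra.
From mathcomp Require Import complex.
From mathcomp Require Import all_classical all_reals all_analysis.
From mathcomp Require Import ring lra.

Set Implicit Arguments.
Unset Strict Implicit.
Unset Printing Implicit Defensive.

Import Order.TTheory GRing.Theory Num.Theory.
Import numFieldNormedType.Exports.

Local Open Scope classical_set_scope.
Local Open Scope ring_scope.

(** * Lifts of circle-valued maps *)

(** [squared_phase], [residue] and [degree] select a value by [xget] with default 0, so nothing is
    known about them until the selecting set is shown to be inhabited. The residue asks for
    holomorphic coordinates whose last coordinate is v. These are not constructed: a grading equates
    the phase with [cis] of a real number, which is never 0, and a nonzero phase excludes the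
    default, hence provides the coordinates. In the same way the gradings on the fibre and on the
    base curve provide bases of the tangent spaces of L_c and v(L). As for degrees, whatever values
    are selected for the fibre and the base come with adapted bases, and these combine into a
    witness for the total degree with the sum as value; uniqueness is invoked for the total degree,
    where the volume form is explicit. The fibres of L -> v(L) may be noncompact, so one subdivision
    of the time interval need not serve a whole fibre; homotopy lifting is therefore done locally in
    the fibre variable. It yields a continuous function, and smoothness of the grading is recovered
    afterwards from an arctangent formula. *)

Section Lifting.
Variable R : realType.
Implicit Types (z w : R[i]) (a b t : R).

Lemma cisD a b : cis (a + b) = cis a * cis b.
Proof.
rewrite /cis cosD sinD; apply/eqP; rewrite eq_complex /=.
by apply/andP; split; apply/eqP; ring.
Qed.

Lemma cis_inj_cos a b : cis a = cis b -> cos (a - b) = 1.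
Proof.
by case=> ca sa; rewrite cosB ca sa -!expr2 cos2Dsin2.
Qed.

Lemma cis_neq0 a : cis a != 0.
Proof.
apply/eqP => -[c0 s0]; have := cos2Dsin2 a.
by rewrite c0 s0 expr0n /= addr0 => /esym/eqP; rewrite oner_eq0.
Qed.

(** An argument on the open right half plane, where it is a smooth function of z. *)
Definition carg z : R := atan (complex.Im z / complex.Re z).

Lemma cis_carg z : 0 < complex.Re z -> cis (carg z) = z / `|z|.
Proof.
case: z => a b /= a0; rewrite normc_def /carg /=.
set r := Num.sqrt (a ^+ 2 + b ^+ 2).
have r0 : 0 < r by rewrite sqrtr_gt0 ltr_wpDr ?sqr_ge0 ?exprn_gt0.
have cE : cos (atan (b / a)) = a / r.
  rewrite cos_atan -[RHS]invrK invf_div; congr _^-1.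
  rewrite -[RHS]ger0_norm ?divr_ge0 ?ltW // -sqrtr_sqr; congr Num.sqrt.
  rewrite !exprMn !exprVn /r sqr_sqrtr ?addr_ge0 ?sqr_ge0 //.
  by field; rewrite ?gt_eqF.
have sE : sin (atan (b / a)) = b / r.
  have -> : sin (atan (b / a)) = tan (atan (b / a)) * cos (atan (b / a)).
    by rewrite /tan mulfVK // cE mulf_neq0 ?invr_eq0 ?gt_eqF.
  by rewrite atanK cE; field; rewrite !gt_eqF.
rewrite /cis cE sE.
apply/eqP; rewrite -(inj_eq (mulIf (_ : Complex r 0 != 0))); last first.
  by rewrite eq_complex /= negb_and gt_eqF.
rewrite mulfVK; last by rewrite eq_complex /= negb_and gt_eqF.
by rewrite eq_complex /= !mulr0 subr0 add0r !mulfVK ?eqxx ?gt_eqF.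
Qed.

(** On [a, b] the cosine of |f - g| is 1. Were |f - g| nonzero at t, then, being 0 at c, it would by
    the intermediate value theorem take a value in (0, pi], where the cosine is not 1. *)
Lemma path_lift_unique (f g : R -> R) (a b c : R) :
  {within `[a, b], continuous f} -> {within `[a, b], continuous g} ->
  (forall t, a <= t <= b -> cis (f t) = cis (g t)) ->
  a <= c <= b -> f c = g c -> forall t, a <= t <= b -> f t = g t.
Proof.
move=> cf cg fg cab fgc t tab; apply/eqP; rewrite -subr_eq0 -normr_eq0.
apply/negP => /negP d0.
pose d := fun t => `|f t - g t|.
have cd : {within `[a, b], continuous d}.
  move=> x; apply: (@continuous_comp _ _ _ (fun t : subspace `[a, b] => f t - g t)
    (fun u => `|u|)); last exact: norm_continuous.
  by apply: continuousB; [exact: cf | exact: cg].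
have dpos : 0 < d t by rewrite lt_neqAle eq_sym d0 normr_ge0.
have dc : d c = 0 by rewrite /d fgc subrr normr0.
have cosd u : a <= u <= b -> cos (d u) = 1.
  by move=> uab; rewrite /d cos_norm; apply: cis_inj_cos; exact: fg.
(* Capping at [pi] puts the intermediate value where the cosine is injective. *)
pose m := Num.min (d t) pi.
have m0 : 0 < m by rewrite lt_min dpos pi_gt0.
have [e e_ct de] : exists2 e, a <= e <= b & d e = m.
  have mono (x y : R) : a <= x -> x <= y -> y <= b ->
      Num.min (d x) (d y) <= m <= Num.max (d x) (d y) -> exists2 e, a <= e <= b & d e = m.
    move=> ax xy yb mB.
    have [|e] := IVT xy _ mB.
      apply: continuous_subspaceW cd => z /=; rewrite !in_itv /= => /andP[xz zy].
      by rewrite (le_trans ax xz) (le_trans zy yb).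
    rewrite in_itv /= => /andP[xe ey] <-; exists e => //.
    by rewrite (le_trans ax xe) (le_trans ey yb).
  have mt : m <= d t by rewrite ge_min lexx.
  have [ac cb] := andP cab; have [at_ tb] := andP tab.
  case: (leP c t) => ct; [apply: (mono c t) | apply: (mono t c)] => //.
  - by rewrite dc ge_min le_max (ltW m0) mt orbT.
  - exact: ltW.
  - by rewrite dc ge_min le_max (ltW m0) mt orbT.
have /(@cos_inj _ m 0) : cos m = cos 0 by rewrite cos0 -de cosd.
rewrite !in_itv /= lexx pi_ge0 (ltW m0) ge_min lexx orbT => /(_ isT isT) m00.
by rewrite m00 ltxx in m0.
Qed.

(* This is z / w only when w has modulus 1. *)
Definition cquo z w := z * w^*%C.

Lemma Re_cquo z w :
  complex.Re (cquo z w) = complex.Re z * complex.Re w + complex.Im z * complex.Im w.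
Proof. by case: z w => a b [c d] /=; ring. Qed.

Lemma Im_cquo z w :
  complex.Im (cquo z w) = complex.Im z * complex.Re w - complex.Re z * complex.Im w.
Proof. by case: z w => a b [c d] /=; ring. Qed.

Lemma norm1E z : `|z| = 1 -> complex.Re z ^+ 2 + complex.Im z ^+ 2 = 1.
Proof. by move=> z1; have := add_Re2_Im2 z; rewrite z1 expr1n => -[]. Qed.

Lemma norm_cquo z w : `|z| = 1 -> `|w| = 1 -> `|cquo z w| = 1.
Proof. by move=> z1 w1; rewrite /cquo normrM z1 normcJ w1 mulr1. Qed.

Lemma mulc_cquo z w : `|w| = 1 -> w * cquo z w = z.
Proof.
move=> /norm1E w1; rewrite /cquo mulrCA.
have -> : w * w^*%C = 1; last by rewrite mulr1.
case: w w1 => c d /= w1; apply/eqP; rewrite eq_complex /=.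
by apply/andP; split; apply/eqP; [rewrite -w1|]; ring.
Qed.

Lemma cis_carg_unit z : `|z| = 1 -> 0 < complex.Re z -> cis (carg z) = z.
Proof. by move=> z1 z0; rewrite cis_carg // z1 divr1. Qed.

End Lifting.
Lemma continuous_sum_ord (R : realType) (T : topologicalType) (M : nat) (f : 'I_M -> T -> R) u :
  (forall i, {for u, continuous (f i)}) -> {for u, continuous (fun t => \sum_(i < M) f i t)}.
Proof.
elim: M f => [|M IH] f cf.
  have -> : (fun t => \sum_(i < 0) f i t) = cst 0 by apply/funext => t; rewrite big_ord0.
  exact: cvg_cst.
have -> : (fun t => \sum_(i < M.+1) f i t) =
    (fun t => \sum_(i < M) f (widen_ord (leqnSn M) i) t + f ord_max t).
  by apply/funext => t; rewrite big_ord_recr.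
by apply: continuousD; [exact: IH | exact: cf].
Qed.

(** * Homotopy lifting for maps of R x X into the circle *)

Section HomotopyLifting.
Variables (R : realType) (X : topologicalType) (f : R * X -> R[i]) (th0 : X -> R).
Hypothesis cRe : continuous (fun u => complex.Re (f u)).
Hypothesis cIm : continuous (fun u => complex.Im (f u)).
Hypothesis f1 : forall u, `|f u| = 1.
Hypothesis cth0 : continuous th0.
Hypothesis cis_th0 : forall x, cis (th0 x) = f (0, x).

(** Positivity says that the unit numbers at the two points are less than a quarter turn apart, so
    that [carg] of their quotient is the angle between them. *)
Let inner (u u' : R * X) := complex.Re (cquo (f u) (f u')).

Let inner_near (u0 : R * X) :
  exists2 C : set (R * X), nbhs u0 C & forall u u', C u -> C u' -> 0 < inner u u'.
Proof.
have : \forall w \near (u0, u0), 0 < inner w.1 w.2.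
  have i0 : 0 < inner u0 u0.
    by rewrite /inner Re_cquo -!expr2 norm1E.
  suff c : {for (u0, u0), continuous (fun w : (R * X) * (R * X) => inner w.1 w.2)}.
    exact: (cvgr_gt (inner u0 u0) c 0 i0).
  have -> : (fun w => inner w.1 w.2) = (fun w =>
      complex.Re (f w.1) * complex.Re (f w.2) + complex.Im (f w.1) * complex.Im (f w.2)).
    by apply/funext => w; rewrite /inner Re_cquo.
  have c1 (g : R * X -> R) : continuous g ->
      {for (u0, u0), continuous (fun w : (R * X) * (R * X) => g w.1)}.
    by move=> cg; apply: (@continuous_comp _ _ _ fst g); [exact: cvg_fst | exact: cg].
  have c2 (g : R * X -> R) : continuous g ->
      {for (u0, u0), continuous (fun w : (R * X) * (R * X) => g w.2)}.
    by move=> cg; apply: (@continuous_comp _ _ _ snd g); [exact: cvg_snd | exact: cg].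
  by apply: continuousD; apply: continuousM;
      (exact: (c1 _ cRe) || exact: (c1 _ cIm) || exact: (c2 _ cRe) || exact: (c2 _ cIm)).
move=> [[A B] [/= nA nB] AB]; exists (A `&` B); first exact: filterI.
by move=> u u' [Au _] [_ Bu']; apply: (AB (u, u')).
Qed.

(** Compactness of [-N, N] makes the step d uniform in t, and in x near x0. *)
Let tube (x0 : X) (N : R) : exists2 d : R, 0 < d & \forall x \near x0,
  forall t t', `|t| <= N -> `|t' - t| <= d -> 0 < inner (t', x) (t, x).
Proof.
have cpt : compact `[- N, N] by exact: segment_compact.
have /compact_near_coveringP nc := cpt.
pose P (i : R * X) (t : R) := forall t', `|t' - t| <= i.1 -> 0 < inner (t', i.2) (t, i.2).
have /(_ _)[] := nc (R * X)%type (filter_prod (0 : R)^'+ (nbhs x0)) P _.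
  move=> t _; have [C [[A B] [/= nA nB] AB] Cp] := inner_near (t, x0).
  have [e /= e0 eA] := (nbhs_ballP _ _).1 nA.
  exists (ball t (e / 2), ([set d : R | d < e / 2] `*` B)) => /=.
    split; first by apply: nbhsx_ballx; rewrite divr_gt0.
    exists ([set d : R | d < e / 2], B) => //=; split => //.
    by apply: nbhs_right_lt; rewrite divr_gt0.
  move=> [s [d x]] /= [ts [de Bx]] s' s's.
  apply: Cp; apply: AB; split => //=; apply: eA; rewrite -ball_normE /=.
    move: ts; rewrite -ball_normE /= => ts.
    rewrite (_ : t - s' = (t - s) - (s' - s)); last by ring.
    by rewrite (le_lt_trans (ler_normB _ _)) // [e]splitr ltrD // (le_lt_trans s's).
  move: ts; rewrite -ball_normE /= => ts; apply: lt_trans ts _.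
  by rewrite ltr_pdivrMr // ltr_pMr // ltr1n.
move=> [A B] [/= nA nB] AB.
have [d [d0 Ad]] : exists d : R, 0 < d /\ A d.
  have : \forall d \near (0:R)^'+, 0 < d /\ A d.
    by apply: filterI => //; exact: nbhs_right_gt.
  by move/filter_ex.
exists d => //; apply: filterS nB => x Bx t t' tN t't.
have := AB (d, x) (conj Ad Bx) t; apply => //=.
by rewrite in_itv /= -ler_norml.
Qed.

(** Angle swept on the i-th of M equal steps of the segment from 0 to t over a fixed x; [th] adds
    these angles to the initial one. *)
Let q M i (u : R * X) := carg (cquo (f (u.1 * i.+1%:R / M%:R, u.2)) (f (u.1 * i%:R / M%:R, u.2))).
Let th M (u : R * X) := th0 u.2 + \sum_(i < M) q M i u.

Let cscale (a : R) : continuous (fun u : R * X => (u.1 * a, u.2)).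
Proof.
move=> u; apply: (@cvg_pair _ _ _ (nbhs u) (nbhs (u.1 * a)) (nbhs u.2)); last exact: cvg_snd.
by apply: (@continuousM _ _ fst (cst a)); [exact: cvg_fst | exact: cvg_cst].
Qed.

Let fine M (u : R * X) := forall i, (i < M)%N ->
  0 < inner (u.1 * i.+1%:R / M%:R, u.2) (u.1 * i%:R / M%:R, u.2).

Let cont_th M u : fine M u -> {for u, continuous (th M)}.
Proof.
move=> fu; rewrite /th; apply: continuousD.
  by apply: (@continuous_comp _ _ _ snd th0); [exact: cvg_snd | exact: cth0].
have cf (g : R * X -> R) j : continuous g ->
    {for u, continuous (fun w : R * X => g (w.1 * j%:R / M%:R, w.2))}.
  move=> cg; apply: (@continuous_comp _ _ _ (fun w : R * X => (w.1 * j%:R / M%:R, w.2)) g);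
    last exact: cg.
  have -> : (fun w : R * X => (w.1 * j%:R / M%:R, w.2)) = (fun w : R * X => (w.1 * (j%:R / M%:R),
      w.2)).
    by apply/funext => w; rewrite mulrA.
  exact: cscale.
apply: (continuous_sum_ord (f := fun i : 'I_M => q M i)) => i.
apply: (@continuous_comp _ _ _ (fun w : R * X =>
    complex.Im (cquo _ _) / complex.Re (cquo _ _)) atan);
  last exact: continuous_atan.
have fui := fu i (ltn_ord i).
apply: continuousM.
  have -> : (fun w : R * X => complex.Im (cquo (f (w.1 * i.+1%:R / M%:R,
      w.2)) (f (w.1 * i%:R / M%:R, w.2))))
    = (fun w => complex.Im (f (w.1 * i.+1%:R / M%:R, w.2)) * complex.Re (f (w.1 * i%:R / M%:R, w.2))
       - complex.Re (f (w.1 * i.+1%:R / M%:R, w.2)) * complex.Im (f (w.1 * i%:R / M%:R, w.2))).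
    by apply/funext => w; rewrite Im_cquo.
  by apply: continuousB; apply: continuousM; (exact: (cf _ _ cRe) || exact: (cf _ _ cIm)).
apply: continuousV; first by rewrite gt_eqF.
have -> : (fun w : R * X => complex.Re (cquo (f (w.1 * i.+1%:R / M%:R,
    w.2)) (f (w.1 * i%:R / M%:R, w.2))))
    = (fun w => complex.Re (f (w.1 * i.+1%:R / M%:R, w.2)) * complex.Re (f (w.1 * i%:R / M%:R, w.2))
       + complex.Im (f (w.1 * i.+1%:R / M%:R, w.2)) * complex.Im (f (w.1 * i%:R / M%:R, w.2))).
  by apply/funext => w; rewrite Re_cquo.
by apply: continuousD; apply: continuousM; (exact: (cf _ _ cRe) || exact: (cf _ _ cIm)).
Qed.

(** The product of the successive quotients of f telescopes. *)
Let cis_th M u : fine M u -> (0 < M)%N -> cis (th M u) = f u.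
Proof.
move=> fu M0.
have H k : (k <= M)%N -> cis (th0 u.2 + \sum_(i < k) q M i u) = f (u.1 * k%:R / M%:R, u.2).
  elim: k => [_|k IH kM]; first by rewrite big_ord0 addr0 cis_th0 mulr0 mul0r.
  rewrite big_ord_recr /= addrA cisD IH ?(ltnW kM) // cis_carg_unit ?mulc_cquo //.
    exact: norm_cquo.
  exact: fu.
by rewrite /th H // mulfK ?pnatr_eq0 -?lt0n //; case: u {fu H}.
Qed.

Let th_0 M x : th M (0, x) = th0 x.
Proof.
rewrite /th big1 ?addr0 // => i _; rewrite /q /= !mul0r /carg Im_cquo.
by rewrite [X in X - _]mulrC subrr mul0r atan0.
Qed.

Let fine_near (u0 : R * X) : exists M0, exists N, `|u0.1| < N /\ \forall x \near u0.2,
   forall t M, `|t| <= N -> (M0 <= M)%N -> (0 < M)%N /\ fine M (t, x).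
Proof.
pose N := `|u0.1| + 1; have [d d0 dx] := tube u0.2 N.
have N0 : 0 < N by rewrite ltr_wpDl.
(* From this number of steps on, each step has length |t| / M <= N / M <= d. *)
exists (Num.truncn (N / d)).+1, N; split; first by rewrite ltrDl.
apply: filterS dx => x H t M tN MM; have M0 : (0 < M)%N by exact: leq_trans MM.
split=> // i iM /=; have MR : 0 < M%:R :> R by rewrite ltr0n.
apply: H; last first.
  rewrite -mulrBl -mulrBr -natrB // subSnn mulr1 normrM normfV (@ger0_norm _ M%:R) //.
  rewrite ler_pdivrMr // (le_trans tN) // -ler_pdivrMl // mulrC.
  by rewrite (le_trans (ltW (truncnS_gt _))) // ler_nat.
rewrite -mulrA normrM (le_trans _ tN) // -[leRHS]mulr1 ler_wpM2l //.
rewrite ger0_norm ?divr_ge0 // ler_pdivrMr // mul1r ler_nat; exact: ltnW.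
Qed.

(** Over a fixed x two fine subdivisions give lifts along [-N, N] with the same value at 0, hence
    equal lifts. So [th M] is eventually constant in M, with a bound locally uniform in (t, x), and
    its limit coincides near each point with one continuous [th M0]. *)
Lemma homotopy_lift : exists l : R * X -> R,
  [/\ continuous l, (forall u, cis (l u) = f u) & forall x, l (0, x) = th0 x].
Proof.
have Hstab (u : R * X) M0 N x : `|u.1| <= N -> u.2 = x ->
    (forall t M, `|t| <= N -> (M0 <= M)%N -> (0 < M)%N /\ fine M (t, x)) ->
    forall M, (M0 <= M)%N -> th M u = th M0 u.
  move=> uN <- H M MM.
  have cw K : (M0 <= K)%N -> {within `[- N, N], continuous (fun t => th K (t, u.2))}.
    move=> MK; apply: continuous_in_subspaceT => t; rewrite inE /= in_itv /= -ler_norml => tN.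
    apply: (@continuous_comp _ _ _ (fun t => (t, u.2)) (th K)).
      by apply: (@cvg_pair _ _ _ (nbhs t) (nbhs t) (nbhs u.2)) => //; exact: cvg_cst.
    by apply: cont_th; exact: (H _ _ tN MK).2.
  have N0 : 0 <= N by apply: le_trans uN.
  have := path_lift_unique (cw M MM) (cw M0 (leqnn _)).
  case: u uN H {cw} => t x' /= tN H /(_ 0) HH; apply: HH.
  - move=> s; rewrite -ler_norml => sN.
    have [? ?] := H s M sN MM; have [? ?] := H s M0 sN (leqnn _).
    by rewrite !cis_th.
  - by rewrite -ler_norml normr0.
  - by rewrite !th_0.
  - by rewrite -ler_norml.
pose l (u : R * X) := lim (th M u @[M --> \oo]).
have lE (u : R * X) M0 : (forall M, (M0 <= M)%N -> th M u = th M0 u) -> l u = th M0 u.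
  move=> H; apply/cvg_lim => //; apply: cvg_near_cst.
  by exists M0 => // M /= MM; apply: H.
exists l; split.
- move=> u0; have [M0 [N [u0N Hx]]] := fine_near u0.
  have Hl : \forall u \near u0, l u = th M0 u.
    exists ([set t : R | `|t| < N], [set x | forall t M, `|t| <= N -> (M0 <= M)%N ->
        (0 < M)%N /\ fine M (t, x)]).
      split => //=; have nc : {for u0.1, continuous (fun t : R => `|t|)} by exact: norm_continuous.
      exact: (cvgr_lt `|u0.1| nc N u0N).
    move=> [t x] /= [tN H]; apply: lE => M MM.
    by apply: (Hstab _ _ N x) => //=; exact: ltW.
  have [Mp fM] := nbhs_singleton Hx u0.1 M0 (ltW u0N) (leqnn _).
  have c0 : {for u0, continuous (th M0)} by apply: cont_th; case: (u0) fM.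
  rewrite /prop_for /continuous_at (nbhs_singleton Hl).
  apply: cvg_trans c0; apply: near_eq_cvg.
  by apply: filterS Hl => u ->.
- move=> u; have [M0 [N [uN Hx]]] := fine_near u.
  have H := nbhs_singleton Hx.
  rewrite (lE u M0); last by move=> M MM; apply: (Hstab _ _ N u.2) => //; exact: ltW.
  have [Mp fM] := H u.1 M0 (ltW uN) (leqnn _).
  by apply: cis_th => //; case: (u) fM.
- move=> x; have -> : l (0, x) = th 0%N (0, x) by apply: lE => M _; rewrite !th_0.
  exact: th_0.
Qed.

End HomotopyLifting.

(** * Continuity on subsets, induction along an interval, and clipping *)

Section ContinuousOn.

(** Continuity of the restriction to A, phrased with neighbourhoods of the ambient space, so that f
    keeps its type and pieces on different subsets can be glued. *)
Definition cont_on (S T : topologicalType) (A : set S) (f : S -> T) : Prop :=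
  forall x, A x -> forall N, nbhs (f x) N -> \forall y \near x, A y -> N (f y).

Lemma cont_on_comp (S T U : topologicalType) (A : set S) (B : set T)
    (f : S -> T) (g : T -> U) :
  cont_on A f -> cont_on B g -> (forall x, A x -> B (f x)) -> cont_on A (g \o f).
Proof.
move=> cf cg AB x Ax N /= /(cg _ (AB _ Ax)) /(cf _ Ax).
by apply: filterS => y H Ay; apply: H => //; exact: AB.
Qed.

Lemma cont_on_local (S T : topologicalType) (A B : set S) (f g : S -> T) x :
  cont_on B g -> B x -> f x = g x ->
  (\forall y \near x, A y -> B y /\ f y = g y) ->
  forall N, nbhs (f x) N -> \forall y \near x, A y -> N (f y).
Proof.
move=> cg Bx -> H N /(cg _ Bx) gN; apply: filterS2 gN H => y gN H Ay.
by have [By ->] := H Ay; apply: gN.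
Qed.

Lemma cont_on_sub (S T : topologicalType) (A B : set S) (f : S -> T) :
  B `<=` A -> cont_on A f -> cont_on B f.
Proof.
move=> BA cf x Bx N /(cf _ (BA _ Bx)); apply: filterS => y H By.
by apply: H; exact: BA.
Qed.

Lemma continuous_cont_on (S T : topologicalType) (A : set S) (f : S -> T) :
  (forall x, A x -> {for x, continuous f}) -> cont_on A f.
Proof.
move=> cf x Ax N nN; have H : \forall y \near x, N (f y) by exact: cf nN.
by apply: filterS H.
Qed.

Lemma cont_on_within (S T : topologicalType) (A : set S) (f : S -> T) :
  cont_on A f -> {within A, continuous f}.
Proof. by move=> cf; apply/subspace_continuousP => x Ax N /(cf _ Ax). Qed.

Lemma cont_on_pair (S T U : topologicalType) (A : set S) (f : S -> T) (g : S -> U) :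
  cont_on A f -> cont_on A g -> cont_on A (fun x => (f x, g x)).
Proof.
move=> cf cg x Ax N [[P Q] [/= nP nQ] PQ].
apply: filterS2 (cf _ Ax _ nP) (cg _ Ax _ nQ) => y Hf Hg Ay.
by apply: PQ; split => /=; [apply: Hf | apply: Hg].
Qed.

End ContinuousOn.

(** Connectedness: near every t the property passes from any point of I to any other, so P and its
    negation both hold on relatively open subsets of I. *)
Lemma interval_induction (R : realType) (I : set R) (P : R -> Prop) (t0 : R) :
  is_interval I -> I t0 -> P t0 ->
  (forall t, I t -> exists2 e, 0 < e & forall s s', I s -> I s' ->
      `|s - t| < e -> `|s' - t| < e -> P s -> P s') ->
  forall t, I t -> P t.
Proof.
move=> /connected_intervalP cI It0 Pt0 H.
pose O (Q : R -> Prop) := [set t | exists2 e, 0 < e & forall s, I s -> `|s - t| < e -> Q s].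
have oO Q : open (O Q).
  rewrite openE => t [e e0 eQ]; apply/nbhs_ballP; exists (e / 2); first by rewrite /= divr_gt0.
  move=> t'; rewrite -ball_normE /= => tt'; exists (e / 2); first by rewrite divr_gt0.
  move=> s Is st'; apply: eQ => //.
  rewrite (_ : s - t = (s - t') - (t - t')); last by ring.
  by rewrite (le_lt_trans (ler_normB _ _)) // [e]splitr ltrD.
suff : I `&` P = I by move=> IP t; rewrite -{1}IP => -[].
apply: cI; first by exists t0.
- exists (O P) => //; apply/seteqP; split => [t [It Pt]|t [It [e e0 eP]]].
    split=> //; have [e e0 eH] := H t It; exists e => // s Is st.
    by apply: (eH t s) => //; rewrite subrr normr0.
  by split => //; apply: eP => //; rewrite subrr normr0.
- exists (~` O (fun s => ~ P s)); first exact: open_closedC.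
  apply/seteqP; split => [t [It Pt]|t [It nO]].
    split => // -[e e0 eP]; apply: (eP t) => //; by rewrite subrr normr0.
  split => //; apply: contrapT => nPt; apply: nO.
  have [e e0 eH] := H t It; exists e => // s Is st Ps; apply: nPt.
  by apply: (eH s t) => //; rewrite subrr normr0.
Qed.

Section Clip.
Variable R : realType.
(** For a <= b, the retraction of the line onto [a, b]; it extends data on the interval to the whole
    line, as [homotopy_lift] requires. *)
Definition clip (a b t : R) : R := Num.max a (Num.min b t).

Lemma clip_itv a b t : a <= b -> a <= clip a b t <= b.
Proof. by move=> ab; rewrite /clip le_max lexx /= ge_max ab ge_min lexx. Qed.

Lemma clip_id a b t : a <= t <= b -> clip a b t = t.
Proof. by case/andP=> at_ tb; rewrite /clip min_r // max_r. Qed.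

Lemma continuous_clip a b : continuous (clip a b).
Proof.
move=> t; apply: continuous_max; first exact: cvg_cst.
by apply: continuous_min; [exact: cvg_cst | exact: cvg_id].
Qed.

End Clip.

(** * Lifts over a locally trivial fibration of the line *)

Section FiberedLift.
Variables (R : realType) (Y : topologicalType) (L : set Y) (tau : Y -> R).
Variable w : Y -> R[i].

Let over (I : set R) := L `&` tau @^-1` I.

(* Over [t - e, t + e], with the fibre over t as model fibre. *)
Definition top_trivialization (t e : R) (psi : Y -> Y) (chi : R * Y -> Y) : Prop :=
  let J := [set s | `|s - t| <= e] in let F := L `&` tau @^-1` [set t] in
  [/\ cont_on (L `&` tau @^-1` J) psi, cont_on (J `*` F) chi,
      (forall q, (L `&` tau @^-1` J) q -> F (psi q) /\ chi (tau q, psi q) = q)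
    & (forall s q, J s -> F q -> [/\ L (chi (s, q)), tau (chi (s, q)) = s & psi (chi (s, q)) = q])].

Hypothesis ctau : cont_on L tau.
Hypothesis cRe : cont_on L (fun q => complex.Re (w q)).
Hypothesis cIm : cont_on L (fun q => complex.Im (w q)).
Hypothesis w1 : forall q, L q -> `|w q| = 1.

Definition lift_on (A : set Y) (l : Y -> R) : Prop :=
  cont_on A l /\ forall q, A q -> cis (l q) = w q.

Section Local.
Variables (t e : R) (psi : Y -> Y) (chi : R * Y -> Y).
Hypothesis e0 : 0 < e.
Hypothesis triv : top_trivialization t e psi chi.

Let J := [set s | `|s - t| <= e].
Let F := over [set t].

Let Jitv s : J s <-> t - e <= s <= t + e.
Proof. by rewrite /J /= ler_distl. Qed.

Let cl s := clip (t - e) (t + e) s.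
Let clJ s : J (cl s).
Proof. by apply/Jitv/clip_itv; have := e0; lra. Qed.
Let cl_id s : J s -> cl s = s.
Proof. by move/Jitv; exact: clip_id. Qed.

Let nbhs_F (x : Y) N : F x -> (\forall y \near x, F y -> N y) -> nbhs (x : subspace F) N.
Proof.
by move=> Fx nN; have <- : within F (nbhs x) = nbhs (x : subspace F) by exact: nbhs_subspace_in.
Qed.

Let nbhs_outF (x : Y) N : ~ F x -> N x -> nbhs (x : subspace F) N.
Proof.
move=> Fx Nx; have <- : principal_filter x = nbhs (x : subspace F) by exact: nbhs_subspace_out.
by move=> _ ->.
Qed.

(** Homotopy time is the displacement from T1, because [homotopy_lift] prescribes the value at time
    0; [cl] keeps the point inside J. *)
Let slice (T1 : R) (u : R * subspace F) : R * Y := (cl (T1 + u.1), u.2).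

(** Points outside F are isolated in [subspace F], so a constant default there preserves
    continuity. *)
Let cont_slice T1 (Z : topologicalType) (h : Y -> Z) (d : Z) : cont_on L h ->
  continuous (fun u : R * subspace F => if `[<F u.2>] then h (chi (slice T1 u)) else d).
Proof.
move=> ch [s x] N /=; have [_ cchi _ tr] := triv.
have chc : cont_on (J `*` F) (h \o chi).
  by apply: cont_on_comp cchi ch _ => -[s' y] [/= Js Fy]; have [] := tr _ _ Js Fy.
case: asboolP => Fx hN.
  have [[P Q] [/= nP nQ] PQ] := chc (cl (T1 + s), x) (conj (clJ _) Fx) N hN.
  have cP : \forall s' \near s, P (cl (T1 + s')).
    suff : {for s, continuous (fun s' => cl (T1 + s'))} by apply.
    apply: (@continuous_comp _ _ _ (fun s' => T1 + s') cl); last exact: continuous_clip.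
    by apply: continuousD; [exact: cvg_cst | exact: cvg_id].
  exists ([set s' | P (cl (T1 + s'))], Q `&` F).
    by split => //=; apply: nbhs_F => //; apply: filterS nQ.
  move=> [s' y] [/= Ps [Qy Fy]]; case: asboolP => // _.
  by apply: (PQ (_, _)) => //; split => //; exact: clJ.
exists (setT, [set x]); first by split; [exact: filterT | exact: nbhs_outF].
by move=> [s' y] [_ /= ->]; case: asboolP => // _; exact: nbhs_singleton hN.
Qed.

(** Carry w to J x F by [chi], lift it there from the angle given on the slice T1, and bring the
    lift back by q |-> (tau q - T1, psi q). *)
Lemma local_lift (T1 : R) (l : Y -> R) : J T1 -> lift_on (over [set T1]) l ->
  exists l', lift_on (over J) l' /\ forall q, over [set T1] q -> l' q = l q.
Proof.
move=> JT1 [cl' ll]; have [cpsi cchi tr1 tr2] := triv.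
have chiF s q : J s -> F q -> over [set s] (chi (s, q)).
  by move=> Js Fq; have [? ? _] := tr2 s q Js Fq.
pose f (u : R * subspace F) := if `[<F u.2>] then w (chi (slice T1 u)) else 1.
(* Outside F the map is 1, which the angle 0 lifts. *)
pose th0 (x : subspace F) := if `[<F x>] then l (chi (T1, x)) else 0.
have [||||x|th [cth thf th0E]] := @homotopy_lift R (subspace F) f th0.
- have -> : (fun u => complex.Re (f u)) = (fun u : R * subspace F =>
      if `[<F u.2>] then complex.Re (w (chi (slice T1 u))) else 1).
    by apply/funext => u; rewrite /f; case: ifP.
  exact: (@cont_slice T1 R (fun q => complex.Re (w q)) 1 cRe).
- have -> : (fun u => complex.Im (f u)) = (fun u : R * subspace F =>
      if `[<F u.2>] then complex.Im (w (chi (slice T1 u))) else 0).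
    by apply/funext => u; rewrite /f; case: ifP.
  exact: (@cont_slice T1 R (fun q => complex.Im (w q)) 0 cIm).
- move=> u; rewrite /f; case: asboolP => [Fu|]; last by rewrite normr1.
  by apply: w1; case: (chiF _ _ (clJ (T1 + u.1)) Fu).
- move=> x N; rewrite /th0; case: asboolP => Fx hN.
    apply: nbhs_F => //.
    have cc : cont_on F (fun y : Y => chi (T1, y)).
      apply: (@cont_on_comp _ _ _ _ (J `*` F) (fun y : Y => (T1, y)) chi) => //.
      by apply: cont_on_pair; apply: continuous_cont_on => y _; [exact: cvg_cst | exact: cvg_id].
    have := @cont_on_comp _ _ _ _ (over [set T1]) _ l cc cl' (fun q => chiF _ _ JT1) x Fx N hN.
    by apply: filterS => y H Fy /=; case: asboolP => // _; exact: H.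
  by apply: nbhs_outF => //=; case: asboolP => // _; exact: nbhs_singleton hN.
- rewrite /th0 /f /=; case: asboolP => Fx; last by rewrite /cis cos0 sin0.
  by rewrite ll /slice /= ?addr0 ?cl_id //; exact: chiF.
exists (fun q => th (tau q - T1, psi q)); split; first split.
- move=> q Lq N nN; have [Fq _] := tr1 q Lq.
  have [[P Q] [/= nP nQ] PQ] := cth (tau q - T1, psi q) N nN.
  have nQ' : \forall y \near psi q, F y -> Q y.
    have EF : within F (nbhs (psi q)) = nbhs (psi q : subspace F) by exact: nbhs_subspace_in.
    by move: nQ; rewrite -EF.
  have cs : {for tau q, continuous (fun s => s - T1)}.
    by apply: continuousB; [exact: cvg_id | exact: cvg_cst].
  have H1 := ctau (proj1 Lq) (cs _ nP).
  apply: filterS2 H1 (cpsi q Lq _ nQ') => q' /= H1 H2 Lq'.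
  apply: (PQ (_, _)); split => /=; first exact: H1 (proj1 Lq').
  by apply: H2 => //; exact: (tr1 q' Lq').1.
- move=> q Lq; have [Fq chiq] := tr1 q Lq; rewrite thf /f /slice /=.
  case: asboolP => // _; rewrite addrC subrK cl_id ?chiq //; exact: Lq.2.
- move=> q [Lq tq]; have Jq : over J q by split => //=; rewrite tq.
  have [Fq chiq] := tr1 q Jq.
  by rewrite tq subrr th0E /th0; case: asboolP => // _; rewrite -tq chiq.
Qed.

(** The path s |-> chi (s, psi q) joins the fibre over T1 to q and stays over I because I is an
    interval; path lifts that agree at one end agree. *)
Lemma local_lift_unique (I : set R) (T1 : R) (l1 l2 : Y -> R) :
  is_interval I -> I T1 -> J T1 -> lift_on (over (I `&` J)) l1 -> lift_on (over (I `&` J)) l2 ->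
  (forall q, over [set T1] q -> l1 q = l2 q) ->
  forall q, over (I `&` J) q -> l1 q = l2 q.
Proof.
move=> iI IT1 JT1 [c1 h1] [c2 h2] l12 q [Lq [Iq Jq]]; have [cpsi cchi tr1 tr2] := triv.
have [Fq chiq] := tr1 q (conj Lq Jq).
pose a := Num.min T1 (tau q); pose b := Num.max T1 (tau q).
have IJ s : a <= s <= b -> (I `&` J) s.
  rewrite /a /b => sab; split.
    by move: sab; case: (leP T1 (tau q)) => _ sab;
        [apply: (iI T1 (tau q)) | apply: (iI (tau q) T1)].
  apply/Jitv; move: JT1 Jq => /Jitv /andP[? ?] /Jitv /andP[? ?].
  by move: sab; case: (leP T1 (tau q)) => _ /andP[? ?]; apply/andP; split; lra.
have cch : cont_on `[a, b] (fun s => chi (s, psi q)).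
  apply: (@cont_on_comp _ _ _ _ (J `*` F) (fun s => (s, psi q)) chi) => //.
    by apply: cont_on_pair; apply: continuous_cont_on => y _; [exact: cvg_id | exact: cvg_cst].
  by move=> s; rewrite /= in_itv /= => /IJ[].
have chO s : a <= s <= b -> over (I `&` J) (chi (s, psi q)).
  move=> sab; have [Is Js] := IJ _ sab; have [? ts _] := tr2 s _ Js Fq.
  by split => //; rewrite /preimage /= ts.
have cc (l : Y -> R) : cont_on (over (I `&` J)) l -> {within `[a, b],
    continuous (fun s => l (chi (s, psi q)))}.
  move=> cl0; apply: cont_on_within; apply: cont_on_comp cch cl0 _ => s.
  by rewrite /= in_itv /=; exact: chO.
have := path_lift_unique (cc _ c1) (cc _ c2) (c := T1) _ _ _ (t := tau q).
rewrite chiq; apply.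
- by move=> s sab; rewrite h1 ?h2 //; exact: chO.
- by rewrite /a /b ge_min le_max lexx.
- by have [? ? _] := tr2 T1 _ JT1 Fq; apply: l12.
- by rewrite /a /b ge_min le_max lexx !orbT.
Qed.

End Local.

Hypothesis trivial : forall t, exists e psi chi, 0 < e /\ top_trivialization t e psi chi.

Let lift_sub A B l : A `<=` B -> lift_on B l -> lift_on A l.
Proof. by move=> AB [cl hl]; split; [exact: cont_on_sub cl | move=> q /AB; exact: hl]. Qed.

Let over_sub I I' : I `<=` I' -> over I `<=` over I'.
Proof. by move=> II q [Lq Iq]; split => //; exact: II. Qed.

Lemma lift_unique (I : set R) (t0 : R) (l1 l2 : Y -> R) :
  is_interval I -> I t0 -> lift_on (over I) l1 -> lift_on (over I) l2 ->
  (forall q, over [set t0] q -> l1 q = l2 q) -> forall q, over I q -> l1 q = l2 q.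
Proof.
move=> iI It0 h1 h2 l12 q [Lq Iq].
pose P t := forall q, over [set t] q -> l1 q = l2 q.
suff : P (tau q) by apply.
apply: (@interval_induction _ I P t0) => // t It.
have [e [psi [chi [e0 tr]]]] := trivial t; exists e => // s s' Is Is' st s't Ps q' [Lq' q's'].
have II1 : over (I `&` [set x | `|x - t| <= e]) `<=` over I by apply: over_sub => ? [].
apply: (local_lift_unique tr iI Is (ltW st) (lift_sub II1 h1) (lift_sub II1 h2) Ps).
by split => //; rewrite /preimage /= q's'; split => //; exact: ltW.
Qed.

(** Uniqueness over overlaps lets a partial lift be extended across each trivialization, and
    interval induction reaches every point of the line. *)
Lemma fibered_lift (t0 : R) (l0 : Y -> R) : lift_on (over [set t0]) l0 ->
  exists l, lift_on L l /\ forall q, L q -> tau q = t0 -> l q = l0 q.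
Proof.
move=> h0.
(* All partial lifts live over open intervals containing t0, so two domains always meet in an
   interval containing t0, where [lift_unique] compares them. *)
pose PL (I : set R) l := [/\ open I, is_interval I, I t0, lift_on (over I) l
                           & forall q, over [set t0] q -> l q = l0 q].
have glue (I J : set R) l l' s : PL I l -> open J -> is_interval J -> I s -> J s ->
    lift_on (over J) l' -> (forall q, over (I `&` J) q -> l q = l' q) ->
    exists l'', PL (I `|` J) l''.
  move=> [oI iI It0 hl ll0] oJ iJ Is Js hl' ll'.
  exists (fun q => if `[<I (tau q)>] then l q else l' q); split.
  - exact: openU.
  - apply/connected_intervalP; apply: connectedU; first by exists s.
      exact/connected_intervalP.
    exact/connected_intervalP.
  - by left.
  - have near_tau q (K : set R) : L q -> open K -> K (tau q) ->
        \forall q' \near q, L q' -> K (tau q').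
      by move=> Lq oK Kq; apply: ctau => //; exact: open_nbhs_nbhs.
    have El' q : L q -> J (tau q) -> (if `[<I (tau q)>] then l q else l' q) = l' q.
      by move=> Lq Jq; case: asboolP => // Iq; apply: ll'.
    split=> [q [Lq Iq]|q [Lq [Iq|Jq]]].
    + case: (pselect (I (tau q))) => [Iq'|nIq].
        apply: (@cont_on_local _ _ _ (over I) _ l) => //; first exact: hl.1.
          by case: asboolP.
        apply: filterS (near_tau q I Lq oI Iq') => q' H [Lq' _]; have Iq'' := H Lq'.
        by split => //; case: asboolP.
      have Jq : J (tau q) by case: Iq.
      apply: (@cont_on_local _ _ _ (over J) _ l') => //; first exact: hl'.1.
        exact: El'.
      apply: filterS (near_tau q J Lq oJ Jq) => q' H [Lq' _]; have Jq'' := H Lq'.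
      by split => //; exact: El'.
    + by case: asboolP => // _; apply: hl.2.
    + by rewrite El' //; apply: hl'.2.
  - by move=> q [Lq tq]; case: asboolP => [_|[]]; [exact: ll0 | rewrite tq].
have ball_itv t e : is_interval [set s : R | `|s - t| < e].
  move=> x y /= xt yt z; move: xt yt; rewrite !ltr_distl => xt yt xzy.
  by apply/andP; split; lra.
have ball_open t e : open [set s : R | `|s - t| < e].
  have -> : [set s : R | `|s - t| < e] = ball t e.
    by rewrite -ball_normE; apply/seteqP; split => s /=; rewrite distrC.
  exact: ball_open.
have base : exists I l, PL I l /\ I t0.
  have [e [psi [chi [e0 tr]]]] := trivial t0.
  have Jt0 : `|t0 - t0| <= e by rewrite subrr normr0 ltW.
  have [l' [hl' l'0]] := local_lift e0 tr Jt0 h0.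
  have Bt0 : `|t0 - t0| < e by rewrite subrr normr0.
  exists [set s | `|s - t0| < e], l'; split => //; split => //.
  by apply: lift_sub hl'; apply: over_sub => s /=; exact: ltW.
have all T : exists I l, PL I l /\ I T.
  apply: (@interval_induction _ setT (fun T => exists I l, PL I l /\ I T) t0) => // t _.
  have [e [psi [chi [e0 tr]]]] := trivial t; exists e => // s s' _ _ st s't [I [l [PLl Is]]].
  have [oI iI It0 hl ll0] := PLl.
  have sI : [set s] `<=` I by move=> _ ->.
  have [l' [hl' l's]] := local_lift e0 tr (ltW st) (lift_sub (over_sub sI) hl).
  have JJ : [set x | `|x - t| < e] `<=` [set x | `|x - t| <= e] by move=> x /=; exact: ltW.
  have [|l'' PLl''] := glue _ _ _ l' s PLl (ball_open t e) (ball_itv t e) Is st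
    (lift_sub (over_sub JJ) hl').
    move=> q [Lq [Iq Jq]].
    have II1 : over (I `&` [set x | `|x - t| <= e]) `<=` over I by apply: over_sub => ? [].
    have II2 : over (I `&` [set x | `|x - t| <= e]) `<=` over [set x | `|x - t| <= e] by apply:
        over_sub => ? [].
    apply: (local_lift_unique tr iI Is (ltW st) (lift_sub II1 hl) (lift_sub II2 hl')).
    - by move=> q' Fq'; rewrite l's.
    - by split => //; split => //; exact: ltW.
  by exists (I `|` [set x | `|x - t| < e]), l''; split => //; right.
(* One partial lift is chosen for every T, and q is evaluated in the one chosen for tau q; [agree]
   makes neighbouring choices consistent. *)
have [IT HI] := choice all; have [lT {}HI] := choice HI.
have agree T T' q : L q -> IT T (tau q) -> IT T' (tau q) -> lT T q = lT T' q.
  move=> Lq Tq T'q; have [[oI iI It0 hl ll0] _] := HI T; have [[oI' iI' It0' hl' ll0'] _] := HI T'.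
  have iII : is_interval (IT T `&` IT T').
    move=> x y [Ix I'x] [Iy I'y] z xyz; split; [exact: (iI x y)|exact: (iI' x y)].
  have II1 : over (IT T `&` IT T') `<=` over (IT T) by apply: over_sub => ? [].
  have II2 : over (IT T `&` IT T') `<=` over (IT T') by apply: over_sub => ? [].
  apply: (lift_unique iII (conj It0 It0') (lift_sub II1 hl) (lift_sub II2 hl')) => //.
  by move=> q' Fq'; rewrite ll0 ?ll0'.
exists (fun q => lT (tau q) q); split; first split.
- move=> q Lq; have [[oI iI It0 hl ll0] Iq] := HI (tau q).
  apply: (@cont_on_local _ _ _ (over (IT (tau q))) _ (lT (tau q))) => //; first exact: hl.1.
  have := ctau Lq (open_nbhs_nbhs (conj oI Iq)); apply: filterS => q' H Lq'.
  have Iq' := H Lq'; split => //; apply: agree => //; exact: (HI (tau q')).2.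
- by move=> q Lq; have [[oI iI It0 hl ll0] Iq] := HI (tau q); apply: hl.2.
- move=> q Lq tq; have [[oI iI It0 hl ll0] Iq] := HI (tau q); exact: ll0.
Qed.

End FiberedLift.

Lemma near_eq_continuous (S T : topologicalType) (f g : S -> T) x :
  (\forall y \near x, f y = g y) -> {for x, continuous f} -> {for x, continuous g}.
Proof.
move=> fg cf N; rewrite -(nbhs_singleton fg) => nN.
have H : \forall y \near x, N (f y) by exact: cf nN.
suff : \forall y \near x, N (g y) by [].
by apply: filterS2 fg H => y <-.
Qed.

(** * Calculus of C^N maps *)

Section DifferentiableLocal.
Variables (R : realType) (V W : normedModType R).

(** The zero map serves as differential: the remainder vanishes near x. *)
Let differentiable_near0 (f : V -> W) (x : V) :
  (\forall y \near x, f y = 0) -> differentiable f x.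
Proof.
move=> f0; have c0 : continuous (\0 : {linear V -> W}) by move=> y; exact: cvg_cst.
have H : f \o shift x = cst (f x) + (\0 : {linear V -> W}) +o_ 0 id.
  apply/eqaddoP => _/posnumP[e]; have fx0 : f x = 0 := nbhs_singleton f0.
  move/nbhs0P : f0; apply: filterS => h /=; rewrite addrC => fh.
  by rewrite !fctE /= fh fx0 addr0 subr0 normr0 mulr_ge0.
by apply/diff_locallyP; rewrite (diff_unique c0 H).
Qed.

Lemma near_eq_differentiable (f g : V -> W) (x : V) :
  (\forall y \near x, f y = g y) -> differentiable f x -> differentiable g x.
Proof.
move=> fg df; have -> : g = f + (g - f) by apply/funext => y; rewrite !fctE addrC subrK.
apply: differentiableD => //; apply: differentiable_near0.
by apply: filterS fg => y fgy; rewrite !fctE fgy subrr.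
Qed.

End DifferentiableLocal.

Section Smooth.
Variables (R : realType) (k : nat).
Local Notation E := 'rV[R]_k.
Implicit Types (U : set E).

(* [Ck] with an arbitrary normed space as codomain, so that components can be treated as scalars. *)
Fixpoint Ckn (W : normedModType R) (N : nat) U (f : E -> W) : Prop :=
  match N with
  | 0 => forall x, U x -> {for x, continuous f}
  | N'.+1 => (forall x, U x -> differentiable f x) /\ forall u : E, Ckn N' U (fun x => 'D_u f x)
  end.

Lemma CkE l N U (f : E -> 'rV[R]_l) : Ck N U f <-> Ckn N U f.
Proof.
by elim: N f => [|N IH] f //=; split=> -[df Df]; split=> // u; apply/IH; exact: Df.
Qed.

Lemma Ckn_ext (W : normedModType R) N U (f g : E -> W) : open U ->
  (forall x, U x -> f x = g x) -> Ckn N U f -> Ckn N U g.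
Proof.
move=> oU; have near_U (h h' : E -> W) x : (forall x, U x -> h x = h' x) -> U x ->
    \forall y \near x, h y = h' y.
  by move=> hh' Ux; have := open_nbhs_nbhs (conj oU Ux); apply: filterS.
elim: N f g => [|N IH] f g fg /=.
  by move=> cf x Ux; exact: near_eq_continuous (near_U _ _ _ fg Ux) (cf x Ux).
move=> [df Df]; split=> [x Ux|u];
    first exact: near_eq_differentiable (near_U _ _ _ fg Ux) (df x Ux).
by apply: IH (Df u) => x Ux; apply: near_eq_derive; exact: near_U.
Qed.

Lemma Ckn_sub (W : normedModType R) N U U' (f : E -> W) : U' `<=` U -> Ckn N U f -> Ckn N U' f.
Proof.
move=> UU; elim: N f => [|N IH] f /=; first by move=> cf x /UU; exact: cf.
by move=> [df Df]; split=> [x /UU|u]; [exact: df | apply: IH; exact: Df].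
Qed.

Lemma Ckn_continuous (W : normedModType R) N U (f : E -> W) x :
  Ckn N U f -> U x -> {for x, continuous f}.
Proof.
case: N => [|N] /=; first by move=> cf; exact: cf.
by move=> [df _] Ux; apply: differentiable_continuous; exact: df.
Qed.

Lemma CknW (W : normedModType R) N U (f : E -> W) : Ckn N.+1 U f -> Ckn N U f.
Proof.
elim: N f => [|N IH] f; first by move=> cf x; exact: (Ckn_continuous cf).
by move=> [df Df]; split=> // u; apply: IH; exact: Df.
Qed.

Lemma Ckn_cst (W : normedModType R) N U (c : W) : Ckn N U (fun=> c).
Proof.
elim: N c => [|N IH] c /=; first by move=> x _; exact: cst_continuous.
split=> [x _|u]; first exact: differentiable_cst.
have -> : (fun x : E => 'D_u (fun=> c) x) = (fun=> 0 : W).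
  by apply/funext => x; exact: derive_cst.
exact: IH.
Qed.

Lemma CknD (W : normedModType R) N U (f g : E -> W) : open U ->
  Ckn N U f -> Ckn N U g -> Ckn N U (fun x => f x + g x).
Proof.
move=> oU; elim: N f g => [|N IH] f g /=.
  by move=> cf cg x Ux; apply: continuousD; [exact: cf | exact: cg].
move=> [df Df] [dg Dg]; split=> [x Ux|u].
  by apply: differentiableD; [exact: df | exact: dg].
apply: Ckn_ext (IH _ _ (Df u) (Dg u)) => // x Ux.
by rewrite -deriveD //; apply: diff_derivable; [exact: df | exact: dg].
Qed.

Lemma CknM N U (f g : E -> R) : open U ->
  Ckn N U f -> Ckn N U g -> Ckn N U (fun x => f x * g x).
Proof.
move=> oU; elim: N f g => [|N IH] f g.
  by move=> cf cg x Ux; apply: continuousM; [exact: cf | exact: cg].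
move=> hf hg; have [df Df] := hf; have [dg Dg] := hg; split=> [x Ux|u].
  by apply: differentiableM; [exact: df | exact: dg].
apply: Ckn_ext (CknD oU (IH _ _ (CknW hf) (Dg u)) (IH _ _ (CknW hg) (Df u))) => // x Ux.
by rewrite [RHS]deriveM //; apply: diff_derivable; [exact: df | exact: dg].
Qed.

Lemma CknZ N U (c : R) (f : E -> R) : open U -> Ckn N U f -> Ckn N U (fun x => c * f x).
Proof. by move=> oU; apply: CknM => //; exact: Ckn_cst. Qed.

Lemma CknN N U (f : E -> R) : open U -> Ckn N U f -> Ckn N U (fun x => - f x).
Proof.
move=> oU /(CknZ (-1) oU); apply: Ckn_ext => // x _; exact: mulN1r.
Qed.

Lemma CknB N U (f g : E -> R) : open U ->
  Ckn N U f -> Ckn N U g -> Ckn N U (fun x => f x - g x).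
Proof. by move=> oU hf hg; apply: CknD => //; exact: CknN. Qed.

Lemma Ckn_sum N U (I : finType) (f : I -> E -> R) : open U ->
  (forall i, Ckn N U (f i)) -> Ckn N U (fun x => \sum_i f i x).
Proof.
move=> oU hf; suff H (s : seq I) : Ckn N U (fun x => \sum_(i <- s) f i x).
  by have := H (index_enum I).
elim: s => [|i s IH].
  by apply: Ckn_ext (Ckn_cst N U (0 : R)) => // x _; rewrite big_nil.
by apply: Ckn_ext (CknD oU (hf i) IH) => // x _; rewrite big_cons.
Qed.

Lemma CknV N U (f : E -> R) : open U -> (forall x, U x -> f x != 0) ->
  Ckn N U f -> Ckn N U (fun x => (f x)^-1).
Proof.
move=> oU f0; elim: N f f0 => [|N IH] f f0.
  by move=> cf x Ux; apply: continuousV; [exact: f0 | exact: cf].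
move=> hf; have [df Df] := hf; split=> [x Ux|u].
  by apply: differentiableV; [exact: df | exact: f0].
have hV := IH _ f0 (CknW hf).
apply: Ckn_ext (CknN oU (CknM oU (CknM oU hV hV) (Df u))) => // x Ux.
rewrite deriveV ?f0 //; last by apply: diff_derivable; exact: df.
by rewrite /GRing.scale /= mulNr expr2 invfM.
Qed.

Lemma Ckn_atan N U (f : E -> R) : open U -> Ckn N U f -> Ckn N U (fun x => atan (f x)).
Proof.
move=> oU; elim: N f => [|N IH] f.
  move=> cf x Ux; apply: (@continuous_comp _ _ _ f atan); first exact: cf.
  exact: continuous_atan.
have da (y : R) : differentiable (atan : R -> R) y.
  by apply/derivable1_diffP; exact: derivable_atan.
move=> hf; have [df Df] := hf; split=> [x Ux|u].
  by apply: (@differentiable_comp _ _ _ _ f atan); [exact: df | exact: da].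
have h1 : Ckn N U (fun x => (1 + f x * f x)^-1).
  apply: CknV => // [x _|]; first by rewrite gt_eqF // ltr_pwDl // -expr2 sqr_ge0.
  apply: CknD => //; first exact: Ckn_cst.
  by apply: CknM => //; exact: CknW.
apply: Ckn_ext (CknM oU h1 (Df u)) => // x Ux.
rewrite [RHS](deriveE _ (differentiable_comp (df x Ux) (da (f x)))).
rewrite (diff_comp (df x Ux) (da (f x))) /= -(deriveE _ (df x Ux)).
rewrite diff1E // /GRing.scale /= mulrC derive1_atan expr2 //.
Qed.

End Smooth.
Section SmoothRow.
Variable R : realType.

Lemma continuous_row (T : topologicalType) l (f : T -> 'rV[R]_l) x :
  (forall j, {for x, continuous (fun y => f y ord0 j)}) -> {for x, continuous f}.
Proof.
move=> cf N [P nP PN].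
have H : \forall y \near x, forall j, P ord0 j (f y ord0 j).
  by apply: filter_forall => j; have := cf j (P ord0 j) (nP _ _).
suff : \forall y \near x, N (f y) by [].
by apply: filterS H => y Hy; apply: PN => i j; rewrite (ord1 i).
Qed.

Lemma continuous_coord l (j : 'I_l) : continuous (fun x : 'rV[R]_l => x ord0 j).
Proof. by move=> x; apply: differentiable_continuous; exact: differentiable_coord. Qed.

Lemma differentiable_row (V : normedModType R) l (f : V -> 'rV[R]_l) x :
  (forall j, differentiable (fun y => f y ord0 j : R) x) <-> differentiable f x.
Proof.
split=> df.
  have -> : f = \sum_(j < l) (fun y => f y ord0 j *: (delta_mx ord0 j : 'rV[R]_l)).
    apply/funext => y; rewrite fct_sumE [LHS]row_sum_delta.
    by apply: eq_bigr.
  by apply: differentiable_sum => j; apply: differentiableZl.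
move=> j; apply: (@differentiable_comp _ _ _ _ f (fun y : 'rV[R]_l => y ord0 j : R)) => //.
exact: differentiable_coord.
Qed.

Lemma derive_coord (V : normedModType R) l (f : V -> 'rV[R]_l) x v j :
  differentiable f x -> ('D_v f x) ord0 j = 'D_v (fun y => f y ord0 j : R) x.
Proof.
move=> df; rewrite derive_mx ?mxE //; exact: diff_derivable.
Qed.

Lemma derive_comp (V : normedModType R) l (f : V -> 'rV[R]_l) (g : 'rV[R]_l -> R) x v :
  differentiable f x -> differentiable g (f x) ->
  'D_v (g \o f) x = \sum_j 'D_(delta_mx ord0 j) g (f x) * 'D_v (fun y => f y ord0 j : R) x.
Proof.
move=> df dg; rewrite deriveE; last exact: differentiable_comp.
rewrite diff_comp //= -(deriveE _ df) {1}(row_sum_delta ('D_v f x)) linear_sum.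
by apply: eq_bigr => j _; rewrite linearZ -(deriveE _ dg) derive_coord // mulrC.
Qed.

Lemma Ckn_row k l N (U : set 'rV[R]_k) (f : 'rV[R]_k -> 'rV[R]_l) : open U ->
  Ckn N U f <-> forall j, Ckn N U (fun x => f x ord0 j : R).
Proof.
move=> oU; elim: N f => [|N IH] f /=.
  split=> [cf j x Ux|cf x Ux]; last by apply: continuous_row => j; exact: cf.
  apply: (@continuous_comp _ _ _ f (fun x : 'rV[R]_l => x ord0 j)); first exact: cf.
  exact: continuous_coord.
split=> [[df Df] j|H].
  split=> [x Ux|u]; first by have /differentiable_row := df x Ux; apply.
  have /IH /(_ j) := Df u; apply: Ckn_ext => // x Ux; rewrite derive_coord //; exact: df.
have df x : U x -> differentiable f x.
  by move=> Ux; apply/differentiable_row => j; have [+ _] := H j; apply.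
split=> // u; apply/IH => j; have [_ /(_ u)] := H j; apply: Ckn_ext => // x Ux.
by rewrite derive_coord //; exact: df.
Qed.

Lemma Ckn_coordf k N (U : set 'rV[R]_k) j : Ckn N U (fun x => x ord0 j : R).
Proof.
case: N => [|N] /=; first by move=> x _; exact: continuous_coord.
split=> [x _|u]; first exact: differentiable_coord.
have -> : (fun x => 'D_u (fun x : 'rV[R]_k => x ord0 j : R) x) = (fun=> u ord0 j).
  by apply/funext => x; rewrite -(derive_coord (f := id)) // derive_id.
exact: Ckn_cst.
Qed.

(** Induction on N through the chain rule: a directional derivative of the composite is a sum of
    products of partial derivatives of g along f with derivatives of components of f, each of class
    one lower. *)
Lemma Ckn_comp k l N (U : set 'rV[R]_k) (V : set 'rV[R]_l) (f : 'rV[R]_k -> 'rV[R]_l)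
    (g : 'rV[R]_l -> R) : open U -> open V ->
  (forall x, U x -> V (f x)) -> Ckn N U f -> Ckn N V g -> Ckn N U (fun x => g (f x)).
Proof.
move=> oU oV UV; elim: N g => [|N IH] g.
  by move=> cf cg x Ux; apply: (@continuous_comp _ _ _ f g); [exact: cf | exact/cg/UV].
move=> hf hg; have [df Df] := hf; have [dg Dg] := hg; split=> [x Ux|u].
  by apply: (@differentiable_comp _ _ _ _ f g); [exact: df | exact/dg/UV].
have H : Ckn N U (fun x => \sum_j 'D_(delta_mx ord0 j) g (f x) * 'D_u (fun y => f y ord0 j : R) x).
  apply: Ckn_sum => // j; apply: CknM => //; first by apply: IH (CknW hf) (Dg _).
  by have /(Ckn_row _ _ oU) /(_ j) [_ /(_ u)] := hf.
apply: Ckn_ext H => // x Ux.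
by rewrite -derive_comp //; [exact: df | exact/dg/UV].
Qed.

Lemma Ckn_comp_row k l m N (U : set 'rV[R]_k) (V : set 'rV[R]_l) (f : 'rV[R]_k -> 'rV[R]_l)
    (g : 'rV[R]_l -> 'rV[R]_m) : open U -> open V ->
  (forall x, U x -> V (f x)) -> Ckn N U f -> Ckn N V g -> Ckn N U (g \o f).
Proof.
move=> oU oV UV hf /(Ckn_row _ _ oV) hg; apply/(Ckn_row _ _ oU) => j.
exact: (Ckn_comp oU oV UV hf (hg j)).
Qed.

Lemma smoothE k l (U : set 'rV[R]_k) (f : 'rV[R]_k -> 'rV[R]_l) :
  smooth U f <-> forall N, Ckn N U f.
Proof. by split=> H N; apply/CkE; exact: H. Qed.

Lemma smooth_comp k l m (U : set 'rV[R]_k) (V : set 'rV[R]_l) (f : 'rV[R]_k -> 'rV[R]_l)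
    (g : 'rV[R]_l -> 'rV[R]_m) : open U -> open V ->
  (forall x, U x -> V (f x)) -> smooth U f -> smooth V g -> smooth U (g \o f).
Proof.
by move=> oU oV UV /smoothE hf /smoothE hg; apply/smoothE => N; exact: Ckn_comp_row (hf N) (hg N).
Qed.

Lemma smooth_sub k l (U V : set 'rV[R]_k) (f : 'rV[R]_k -> 'rV[R]_l) :
  V `<=` U -> smooth U f -> smooth V f.
Proof. by move=> VU /smoothE hf; apply/smoothE => N; exact: Ckn_sub (hf N). Qed.

Lemma smooth_ext k l (U : set 'rV[R]_k) (f g : 'rV[R]_k -> 'rV[R]_l) : open U ->
  (forall x, U x -> f x = g x) -> smooth U f -> smooth U g.
Proof. by move=> oU fg /smoothE hf; apply/smoothE => N; exact: Ckn_ext (hf N). Qed.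

Lemma smooth_differentiable k l (U : set 'rV[R]_k) (f : 'rV[R]_k -> 'rV[R]_l) x :
  smooth U f -> U x -> differentiable f x.
Proof. by move=> /(_ 1%N)[+ _]; apply. Qed.

Lemma smooth_continuous k l (U : set 'rV[R]_k) (f : 'rV[R]_k -> 'rV[R]_l) x :
  smooth U f -> U x -> {for x, continuous f}.
Proof. by move=> /(_ 0%N); apply. Qed.

End SmoothRow.
Section Jacobian.
Variable R : realType.
Lemma row_jacobian k l (f : 'rV[R]_k -> 'rV[R]_l) x i : differentiable f x ->
  row i ('J f x) = 'D_(delta_mx ord0 i) f x.
Proof.
by move=> df; rewrite (rowE i ('J f x)) (deriveEjacobian (delta_mx ord0 i) df).
Qed.

Lemma jacobian_comp k l m (f : 'rV[R]_k -> 'rV[R]_l) (g : 'rV[R]_l -> 'rV[R]_m) x :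
  differentiable f x -> differentiable g (f x) -> 'J (g \o f) x = 'J f x *m 'J g (f x).
Proof.
move=> df dg; apply/row_matrixP => i.
have dgf := differentiable_comp df dg.
rewrite (row_jacobian i dgf) row_mul (row_jacobian i df).
rewrite -(deriveEjacobian _ dg) (deriveE _ dgf) (diff_comp df dg) (deriveE _ df).
by rewrite (deriveE _ dg).
Qed.

Lemma jacobian_near_eq k l (f g : 'rV[R]_k -> 'rV[R]_l) x :
  differentiable f x -> (\forall y \near x, f y = g y) -> 'J f x = 'J g x.
Proof.
move=> df fg; have dg := near_eq_differentiable fg df; apply/row_matrixP => i.
apply: etrans (row_jacobian i df) _.
apply: etrans _ (esym (row_jacobian i dg)).
exact: (@near_eq_derive R ('rV[R]_k : normedModType R) ('rV[R]_l : normedModType R) f g x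
  (delta_mx ord0 i) fg).
Qed.

Lemma jacobian_id k (x : 'rV[R]_k) : 'J (fun y : 'rV[R]_k => y) x = 1%:M.
Proof.
have di : differentiable (fun y : 'rV[R]_k => y) x by [].
apply/row_matrixP => i; rewrite (row_jacobian i di) row1.
exact: (derive_id x (delta_mx ord0 i : 'rV[R]_k)).
Qed.

Lemma jacobianE k l (f : 'rV[R]_k -> 'rV[R]_l) x i j : differentiable f x ->
  'J f x i j = 'D_(delta_mx ord0 i) (fun y => f y ord0 j : R) x.
Proof.
move=> df.
have H := derive_coord (delta_mx ord0 i) j df.
have H2 := row_jacobian i df.
by rewrite -H -H2 [RHS]mxE.
Qed.

End Jacobian.

(** * Charts and tangent vectors *)

Section Atlas.
Variable R : realType.

(** The chart axioms behind [smooth_on] and [Dmx], which at a point involve only the charts centred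
    there and at its image. They hold for the line, R^k, products and Y alike; transition maps are
    treated apart, in [holomorphic_transition]. *)
Record atlas k (X : charted R k) : Prop := Atlas {
  cdom_center : forall p : X, cdom p p;
  cdom_open : forall p : X, open (cdom p);
  cimg_open : forall p : X, open (cimg p);
  cmapK : forall p q : X, cdom p q -> cinv p (cmap p q) = q;
  cmap_continuous : forall p q : X, cdom p q -> {for q, continuous (cmap p)};
  cinv_continuous : forall p : X, forall x, cimg p x -> {for x, continuous (cinv p)} }.

Lemma atlas_model k : atlas (model R k).
Proof.
split=> //= p; last by move=> x _; exact: cvg_id.
- exact: openT.
- rewrite (_ : @cimg _ _ (model R k) p = setT); first exact: openT.
  by apply/seteqP; split => // x _; exists x.
- by move=> q _; exact: cvg_id.
Qed.

Lemma atlas_line : atlas (line R).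
Proof.
split=> //= p.
- exact: openT.
- rewrite (_ : @cimg _ _ (line R) p = setT); first exact: openT.
  apply/seteqP; split => // x _; exists (x ord0 ord0) => //=.
  by apply/rowP => j; rewrite mxE (ord1 j).
- by move=> q _; rewrite mxE.
- move=> q _; apply: continuous_row => j.
  have -> : (fun y : R => (const_mx y : 'rV[R]_1) ord0 j) = id by apply/funext => y; rewrite mxE.
  exact: cvg_id.
- by move=> x _; exact: continuous_coord.
Qed.

Lemma atlas_prod k l (X : charted R k) (Z : charted R l) :
  atlas X -> atlas Z -> atlas (prodC X Z).
Proof.
move=> [cX oX iX kX mX vX] [cZ oZ iZ kZ mZ vZ].
have cl : continuous (fun x : 'rV[R]_(k + l) => lsubmx x).
  move=> x; apply: continuous_row => j.
  have -> : (fun y : 'rV[R]_(k + l) => lsubmx y ord0 j) = (fun y => y ord0 (lshift l j)).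
    by apply/funext => y; rewrite mxE.
  exact: continuous_coord.
have cr : continuous (fun x : 'rV[R]_(k + l) => rsubmx x).
  move=> x; apply: continuous_row => j.
  have -> : (fun y : 'rV[R]_(k + l) => rsubmx y ord0 j) = (fun y => y ord0 (rshift k j)).
    by apply/funext => y; rewrite mxE.
  exact: continuous_coord.
have imgE (p : prodC X Z) (x : 'rV[R]_(k + l)) :
    cimg p x <-> cimg p.1 (lsubmx x) /\ cimg p.2 (rsubmx x).
  split=> [[q [q1 q2] <-] /=|[[q1 hq1 e1] [q2 hq2 e2]]].
    by rewrite row_mxKl row_mxKr; split; [exists q.1|exists q.2].
  by exists (q1, q2) => //=; rewrite e1 e2 hsubmxK.
split=> [p|p|p|p q [h1 h2]|p q [h1 h2]|p x /imgE [h1 h2]].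
- by split; [exact: cX | exact: cZ].
- rewrite openE => -[q1 q2] [/= h1 h2]; exists (cdom p.1, cdom p.2) => //.
  by split; apply: open_nbhs_nbhs; split; [exact: oX | | exact: oZ |].
- rewrite openE => x /imgE [h1 h2].
  have n1 : \forall y \near x, cimg p.1 (lsubmx y).
    by apply: cl; apply: open_nbhs_nbhs; split.
  have n2 : \forall y \near x, cimg p.2 (rsubmx y).
    by apply: cr; apply: open_nbhs_nbhs; split.
  suff : \forall y \near x, cimg p y by [].
  by apply: filterS2 n1 n2 => y *; apply/imgE.
- by rewrite /= row_mxKl row_mxKr kX // kZ //; case: q h1 h2.
- apply: continuous_row => j; rewrite -(fintype.splitK j); case: (fintype.split j) => i /=.
    have -> : (fun y : X * Z => row_mx (cmap p.1 y.1) (cmap p.2 y.2) ord0 (lshift l i)) =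
        (fun y => cmap p.1 y.1 ord0 i) by apply/funext => y; rewrite row_mxEl.
    apply: (@continuous_comp _ _ _ (fun y : X * Z => cmap p.1 y.1) (fun x : 'rV[R]_k => x ord0 i));
      last exact: continuous_coord.
    by apply: (@continuous_comp _ _ _ fst (cmap p.1)); [exact: cvg_fst | exact: mX].
  have -> : (fun y : X * Z => row_mx (cmap p.1 y.1) (cmap p.2 y.2) ord0 (rshift k i)) =
      (fun y => cmap p.2 y.2 ord0 i) by apply/funext => y; rewrite row_mxEr.
  apply: (@continuous_comp _ _ _ (fun y : X * Z => cmap p.2 y.2) (fun x : 'rV[R]_l => x ord0 i));
    last exact: continuous_coord.
  by apply: (@continuous_comp _ _ _ snd (cmap p.2)); [exact: cvg_snd | exact: mZ].
- move=> N [[P Q] [/= nP nQ] PQ].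
  have c1 : \forall y \near x, P (cinv p.1 (lsubmx y)).
    by apply: (@continuous_comp _ _ _ _ (cinv p.1) _ (cl x) (vX _ _ h1)).
  have c2 : \forall y \near x, Q (cinv p.2 (rsubmx y)).
    by apply: (@continuous_comp _ _ _ _ (cinv p.2) _ (cr x) (vZ _ _ h2)).
  suff : \forall y \near x, N (cinv p y) by [].
  by apply: filterS2 c1 c2 => y *; apply: PQ.
Qed.

Section OneAtlas.
Variables (k : nat) (X : charted R k).
Hypothesis aX : atlas X.

Lemma chart_open (p : X) (W : set X) : open W -> W `<=` cdom p -> open (cmap p @` W).
Proof.
move=> oW WD; rewrite openE => x [q Wq qx].
have xi : cimg p x by exists q => //; exact: WD.
have cq : cinv p x = q by rewrite -qx cmapK //; exact: WD.
have n1 : \forall y \near x, W (cinv p y).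
  by apply: (cinv_continuous aX xi); rewrite cq; apply: open_nbhs_nbhs.
have n2 : \forall y \near x, cimg p y.
  by apply: open_nbhs_nbhs; split => //; exact: cimg_open.
suff : \forall y \near x, (cmap p @` W) y by [].
apply: filterS2 n1 n2 => y Wy [q' q'D e]; exists q' => //.
by move: Wy; rewrite -e cmapK.
Qed.

Lemma near_chart (p q : X) (P : X -> Prop) : cdom p q ->
  (\forall y \near q, P y) -> \forall x \near cmap p q, P (cinv p x).
Proof.
move=> pq nP; apply: (cinv_continuous aX); first by exists q.
by rewrite cmapK.
Qed.

Lemma smooth_on_cont_on l (Z : charted R l) (A : set X) (f : X -> Z) :
  atlas Z -> smooth_on A f -> cont_on A f.
Proof.
move=> aZ sf p Ap; have [W [g [[oW Wp] WD Wg gf sg]]] := sf p Ap.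
have gp : g p = f p by exact: gf.
pose F := cmap (f p) \o g \o cinv p.
have cF : {for cmap p p, continuous F}.
  by apply: (smooth_continuous sg); exists p.
have Fp : F (cmap p p) = cmap (f p) (f p) by rewrite /F /= cmapK ?gp //; exact: WD.
have cG : {for p, continuous (fun q => cinv (f p) (F (cmap p q)))}.
  apply: (@continuous_comp _ _ _ (cmap p) (fun x => cinv (f p) (F x))).
    by apply: (cmap_continuous aX); exact: WD.
  apply: (@continuous_comp _ _ _ F (cinv (f p))) => //.
  by apply: (cinv_continuous aZ); rewrite Fp; exists (f p) => //; exact: cdom_center.
have E q : W q -> cinv (f p) (F (cmap p q)) = g q.
  by move=> Wq; rewrite /F /= (cmapK aX (WD q Wq)) (cmapK aZ) //; exact: Wg.
move=> N nN; have := cG N; rewrite /= E // gp => /(_ nN) H.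
have H' : \forall q \near p, N (cinv (f p) (F (cmap p q))) by exact: H.
apply: filterS2 H' (open_nbhs_nbhs (conj oW Wp)) => q Nq Wq Aq.
by rewrite -(gf q Aq Wq) -E.
Qed.

(** On an open set the local extension in [smooth_on] can be taken to be f itself, after shrinking
    its domain to A; derivatives of f then make sense. *)
Lemma smooth_on_open l (Z : charted R l) (A : set X) (f : X -> Z) p :
  open A -> smooth_on A f -> A p ->
  exists W : set X, [/\ open W /\ W p, W `<=` cdom p, W `<=` A, W `<=` f @^-1` cdom (f p)
    & smooth (cmap p @` W) (cmap (f p) \o f \o cinv p)].
Proof.
move=> oA sf Ap; have [W [g [[oW Wp] WD Wg gf sg]]] := sf p Ap.
have sub : W `&` A `<=` W by move=> q [].
have oWA : open (cmap p @` (W `&` A)).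
  by apply: chart_open; [exact: openI | move=> q [/WD]].
exists (W `&` A); split.
- by split; [exact: openI | split].
- by move=> q [/WD].
- by move=> q [].
- by move=> q [Wq Aq]; have := Wg q Wq; rewrite /preimage /= (gf q Aq Wq).
- have sg' : smooth (cmap p @` (W `&` A)) (cmap (f p) \o g \o cinv p).
    by apply: smooth_sub sg; exact: image_subset.
  apply: smooth_ext sg' => // x [q [Wq Aq] <-] /=.
  by rewrite cmapK ?gf //; exact: WD.
Qed.

End OneAtlas.

Lemma model_image k (W : set 'rV[R]_k) (p : model R k) : cmap p @` W = W.
Proof. by apply/seteqP; split => [x [y Wy <-]|x Wx] //; exists x. Qed.

End Atlas.

(** * Chain rule, velocities of curves, and tangent spaces of slices *)

Section TangentVectors.
Variable R : realType.

Lemma differentiable_idfun k (x : 'rV[R]_k) : differentiable (fun y : 'rV[R]_k => y) x.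
Proof. by []. Qed.

Lemma smooth_on_subset k l (X : charted R k) (Z : charted R l) (A B : set X) (f : X -> Z) :
  B `<=` A -> smooth_on A f -> smooth_on B f.
Proof.
move=> BA sf p /BA Ap; have [W [g [? ? ? gf ?]]] := sf p Ap.
by exists W, g; split => // q /BA; exact: gf.
Qed.

Section Chain.
Variables (k l m : nat) (X : charted R k) (Z : charted R l) (V : charted R m).
Variables (A : set X) (B : set Z) (f : X -> Z) (g : Z -> V).
Hypotheses (aX : atlas X) (aZ : atlas Z) (oA : open A) (oB : open B).
Hypotheses (sf : smooth_on A f) (sg : smooth_on B g).

Lemma smooth_on_comp : (forall q, A q -> B (f q)) -> smooth_on A (g \o f).
Proof.
move=> AB p Ap; have [W [[oW Wp] WD WA Wf sF]] := smooth_on_open aX oA sf Ap.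
have [W' [[oW' Wfp] W'D W'B W'g sG]] := smooth_on_open aZ oB sg (AB p Ap).
have cf := smooth_on_cont_on aX aZ sf.
pose P := W `&` f @^-1` W'.
have oP : open P.
  rewrite openE => q [Wq fq]; have Aq := WA q Wq.
  have n1 := cf q Aq W' (open_nbhs_nbhs (conj oW' fq)).
  suff : \forall y \near q, P y by [].
  apply: filterS2 n1 (open_nbhs_nbhs (conj oW Wq)) => y H Wy.
  by split => //; apply: H; exact: WA.
have PW : P `<=` W by move=> q [].
have PD : P `<=` cdom p by move=> q /PW /WD.
exists P, (g \o f); split => //; first by move=> q [_ fq]; exact: W'g.
have sF' : smooth (cmap p @` P) (cmap (f p) \o f \o cinv p).
  by apply: smooth_sub sF; exact: image_subset.
have := smooth_comp (chart_open aX oP PD) (chart_open aZ oW' W'D) _ sF' sG.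
move=> H; apply: smooth_ext (H _); first exact: chart_open.
  move=> x [q Pq <-] /=; rewrite (cmapK aX (PD q Pq)) (cmapK aZ) //.
  by apply: W'D; case: Pq.
move=> x [q Pq <-] /=; rewrite (cmapK aX (PD q Pq)).
by exists (f q) => //; case: Pq.
Qed.

Lemma Dmx_comp p : A p -> B (f p) -> Dmx (g \o f) p = Dmx f p *m Dmx g (f p).
Proof.
move=> Ap Bfp; have [W [[oW Wp] WD WA Wf sF]] := smooth_on_open aX oA sf Ap.
have [W' [[oW' Wfp] W'D W'B W'g sG]] := smooth_on_open aZ oB sg Bfp.
have dF : differentiable (cmap (f p) \o f \o cinv p) (cmap p p).
  by apply: (smooth_differentiable sF); exists p.
have E : (cmap (f p) \o f \o cinv p) (cmap p p) = cmap (f p) (f p).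
  by rewrite /= (cmapK aX) //; exact: WD.
have dG : differentiable (cmap (g (f p)) \o g \o cinv (f p)) ((cmap (f p) \o f \o cinv p) (cmap p
    p)).
  by rewrite E; apply: (smooth_differentiable sG); exists (f p).
have dGF := differentiable_comp dF dG.
have nE : \forall x \near cmap p p,
    ((cmap (g (f p)) \o g \o cinv (f p)) \o (cmap (f p) \o f \o cinv p)) x
    = (cmap ((g \o f) p) \o (g \o f) \o cinv p) x.
  have nW : \forall y \near p, W y by apply: open_nbhs_nbhs.
  have := near_chart aX (WD p Wp) nW; apply: filterS => x Wx /=.
  by rewrite (cmapK aZ) //; exact: Wf.
rewrite /Dmx; apply: etrans (esym (jacobian_near_eq dGF nE)) _.
apply: etrans (jacobian_comp dF dG) _.
by rewrite E.
Qed.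

End Chain.

Section Curves.
Variables (k : nat) (X : charted R k).
Hypothesis aX : atlas X.

Lemma tangent_sub (S S' : set X) q : S `<=` S' -> tangent S q `<=` tangent S' q.
Proof.
by move=> SS u [I [c [oI sc cS c0 ->]]]; exists I, c; split => // t /cS /SS.
Qed.

Lemma tangent_image l (Z : charted R l) (S : set X) (h : X -> Z) q u :
  smooth_on setT h -> tangent S q u -> tangent (h @` S) (h q) (u *m Dmx h q).
Proof.
move=> sh [I [c [[oI I0] sc cS c0 ->]]]; exists I, (h \o c); split => //.
- by apply: (smooth_on_comp (@atlas_line R) aX oI openT sc sh).
- by move=> t It /=; exists (c t) => //; exact: cS.
- by rewrite /= c0.
- by rewrite -c0; apply: esym; apply: (Dmx_comp (@atlas_line R) aX oI openT sc sh).
Qed.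

(** Along a curve in S the i-th coordinate of h is constant, so its derivative vanishes. *)
Lemma tangent_coord l (S A : set X) (h : X -> model R l) (i : 'I_l) (a : R) q u :
  open A -> A q -> smooth_on A h -> (forall q', A q' -> S q' -> h q' ord0 i = a) ->
  tangent S q u -> (u *m Dmx h q) ord0 i = 0.
Proof.
move=> oA Aq sh hS [I [c [[oI I0] sc cS c0 ->]]].
have cc := smooth_on_cont_on (@atlas_line R) aX sc.
have Ac0 : A (c 0) by rewrite c0.
pose J := I `&` c @^-1` A.
have oJ : open J.
  rewrite openE => t [It At]; have n1 := cc t It A (open_nbhs_nbhs (conj oA At)).
  suff : \forall y \near t, J y by [].
  by apply: filterS2 n1 (open_nbhs_nbhs (conj oI It)) => y H Iy; split => //; exact: H.
have JI : J `<=` I by move=> t [].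
have sJ : @smooth_on R 1 k (line R) X J c by exact: smooth_on_subset sc.
have sJh : @smooth_on R 1 l (line R) (model R l) J (h \o c).
  by apply: (smooth_on_comp (@atlas_line R) aX oJ oA sJ sh) => t [].
have E := Dmx_comp (@atlas_line R) aX oJ oA sJ sh (conj I0 Ac0) Ac0.
rewrite c0 in E; apply: etrans (esym (congr1 (fun M : 'rV[R]_l => M ord0 i) E)) _.
have [W [[oW W0] WD WJ Wh sF]] := smooth_on_open (@atlas_line R) oJ sJh (conj I0 Ac0).
have dF : differentiable (h \o c \o (fun w : 'rV[R]_1 => w ord0 ord0)) (const_mx 0).
  by apply: (smooth_differentiable sF); exists 0.
apply: etrans (jacobianE ord0 i dF) _.
have nE : \forall w \near (const_mx 0 : 'rV[R]_1), (cst a : 'rV[R]_1 -> R) w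
    = (h \o c \o (fun w : 'rV[R]_1 => w ord0 ord0)) w ord0 i.
  have nJ : \forall t \near (0 : R), J t by apply: open_nbhs_nbhs; split.
  have := @near_chart R 1 (line R) (@atlas_line R) 0 0 J Logic.I nJ.
  by apply: filterS => w [Iw Aw] /=; rewrite hS //; exact: cS.
have H := @near_eq_derive R _ _ _ _ _ (delta_mx ord0 ord0 : 'rV[R]_1) nE.
apply: etrans (esym H) _; exact: derive_cst.
Qed.

Lemma smooth_on_affine (a w : 'rV[R]_k) :
  @smooth_on R 1 k (line R) (model R k) setT (fun t => a + t *: w).
Proof.
move=> t _; exists setT, (fun t => a + t *: w); split => //; first by split=> //; exact: openT.
have oT : open (@cmap R 1 (line R) t @` setT) by apply: (chart_open (@atlas_line R)) => //;
    exact: openT.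
apply/smoothE => N; apply/(Ckn_row _ _ oT) => j.
have H : Ckn N (@cmap R 1 (line R) t @` setT) (fun x => a ord0 j + x ord0 ord0 * w ord0 j).
  apply: CknD => //; first exact: Ckn_cst.
  by apply: CknM => //; [exact: Ckn_coordf | exact: Ckn_cst].
by apply: Ckn_ext H => // x _; rewrite !mxE.
Qed.

Lemma Dmx_affine (a w : 'rV[R]_k) : @Dmx R 1 k (line R) (model R k) (fun t => a + t *: w) 0 = w.
Proof.
have T0 : @setT (line R) 0 by [].
have oT : @open (line R) setT by exact: openT.
have [W [[oW W0] _ _ _ sF]] := smooth_on_open (@atlas_line R) oT (smooth_on_affine a w) T0.
have dF : differentiable (fun x : 'rV[R]_1 => a + x ord0 ord0 *: w) (const_mx 0).
  by apply: (smooth_differentiable sF); exists 0.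
apply/rowP => j; rewrite /Dmx; apply: etrans (jacobianE ord0 j dF) _.
have -> : (fun y : 'rV[R]_1 => (a + y ord0 ord0 *: w) ord0 j : R) =
    (fun y => cst (a ord0 j) y + y ord0 ord0 * w ord0 j).
  by apply/funext => y; rewrite !mxE.
have dc : derivable (fun y : 'rV[R]_1 => y ord0 ord0 : R) (const_mx 0) (delta_mx ord0 ord0).
  by apply: diff_derivable; exact: differentiable_coord.
rewrite deriveD; first last.
- exact: (derivableM dc (derivable_cst (w ord0 j) _ _)).
- exact: derivable_cst.
rewrite derive_cst add0r; apply: etrans (deriveM dc (derivable_cst (w ord0 j) _ _)) _.
rewrite derive_cst scaler0 add0r -(derive_coord (f := id)) // derive_id mxE eqxx.
by rewrite /GRing.scale /= mulr1.
Qed.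

End Curves.

Section HalfDimensional.
Variables (m : nat) (X : charted R (m + m)).
Hypothesis aX : atlas X.

(* Basis of the tangent space of the submanifold cut out by the last m of the
   coordinates z with inverse zi. *)
Definition frame (zi : 'rV[R]_(m + m) -> X) (q : X) (x : 'rV[R]_(m + m)) : 'M[R]_(m, m + m) :=
  usubmx ('J (cmap q \o zi) x).

(** The differentials D of z and J of [zi] are inverse matrices. A tangent vector u has vanishing
    last m coordinates in u D, so u = (u D) J lies in the span of the first m rows of J; conversely
    every vector of this span is the velocity of the image of a straight line. *)
Lemma tangent_frame (S W : set X) (z : X -> 'rV[R]_(m + m)) (zi : 'rV[R]_(m + m) -> X) q :
  [/\ open W, open (z @` W), @smooth_on R _ _ X (model R (m + m)) W z,
      @smooth_on R _ _ (model R (m + m)) X (z @` W) zi & forall q, W q -> zi (z q) = q] ->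
  (forall q, W q -> (S q <-> forall i : 'I_(m + m), (m <= i)%N -> z q ord0 i = 0)) ->
  W q -> S q ->
  row_free (frame zi q (z q)) /\ tangent S q = rowspace (frame zi q (z q)).
Proof.
move=> [oW ozW sz szi zK] SW Wq Sq.
pose D := @Dmx R _ _ X (model R (m + m)) z q.
pose J := 'J (cmap q \o zi) (z q).
have Jdef : @Dmx R _ _ (model R (m + m)) X zi (z q) = J by rewrite /Dmx zK.
have DJ : D *m J = 1%:M.
  rewrite -Jdef /D.
  have zz q' : W q' -> (z @` W) (z q') by move=> Wq'; exists q'.
  apply: etrans (esym (Dmx_comp aX (@atlas_model R _) oW ozW sz szi Wq (zz q Wq))) _.
  have did : differentiable (fun x : 'rV[R]_(m + m) => x) (cmap q q) by exact: differentiable_idfun.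
  have nE : \forall x \near cmap q q, x = (cmap ((zi \o z) q) \o (zi \o z) \o cinv q) x.
    have nW : \forall y \near q, W y by exact: (open_nbhs_nbhs (conj oW Wq)).
    have n1 := near_chart (P := W) aX (cdom_center aX q) nW.
    have n2 : \forall x \near cmap q q, cimg q x.
      apply: (open_nbhs_nbhs (conj (cimg_open aX (p := q)) _)); exists q;
          [exact: (cdom_center aX) | reflexivity].
    apply: filterS2 n1 n2 => x Wx [q' q'D xE] /=.
    rewrite (zK _ Wq) (zK _ Wx) -xE (cmapK aX q'D); reflexivity.
  rewrite /Dmx; apply: etrans (esym (jacobian_near_eq did nE)) _; exact: jacobian_id.
have JD : J *m D = 1%:M by apply: mulmx1C.
have coordD (u : 'rV[R]_(m + m)) (i : 'I_(m + m)) : tangent S q u -> (m <= i)%N ->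
    (u *m D) ord0 i = 0.
  move=> Tu mi; apply: (tangent_coord aX oW Wq sz _ Tu) => q' Wq' Sq'; exact: ((SW q' Wq').1 Sq').
rewrite /frame -/J; clearbody D J.
split.
  apply/row_freeP; exists (D *m col_mx 1%:M 0).
  rewrite mulmxA -[X in X *m col_mx _ _](_ : usubmx (J *m D) = _); last first.
    by rewrite -mul_usub_mx.
  rewrite JD scalar_mx_block block_mxEv col_mxKu mul_row_col mul1mx mul0mx addr0 //.
apply/seteqP; split => [u Tu|u /submxP [a ->]].
  have uE : u = (u *m D) *m J by rewrite -mulmxA DJ mulmx1.
  apply/submxP; exists (lsubmx (u *m D)); rewrite {1}uE.
  have {1}-> : u *m D = row_mx (lsubmx (u *m D)) 0.
    rewrite -[LHS]hsubmxK; congr row_mx; apply/rowP => j.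
    by rewrite [LHS]mxE [RHS]mxE coordD // leq_addr.
  by rewrite -[J in LHS]vsubmxK mul_row_col mul0mx addr0.
(* Direction of a straight line inside the slice, which [zi] maps into S as long as it stays in the
   coordinate image. *)
pose w := row_mx a 0 : 'rV[R]_(m + m).
pose I := [set t : R | (z @` W) (z q + t *: w)].
have oI : open I.
  apply: (@open_comp _ _ (fun t : R => z q + t *: w)) => // t _.
  have := smooth_on_cont_on (@atlas_line R) (@atlas_model R _) (smooth_on_affine (z q) w).
  by move=> H N nN; have := H t Logic.I N nN; apply: filterS => t' Ht'; exact: Ht'.
have I0 : I 0 by rewrite /I /= scale0r addr0; exists q.
have saff : @smooth_on R 1 _ (line R) (model R (m + m)) I (fun t => z q + t *: w).
  by apply: smooth_on_subset (smooth_on_affine (z q) w).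
exists I, (fun t => zi (z q + t *: w)); split => //.
- exact: (smooth_on_comp (@atlas_line R) (@atlas_model R _) oI ozW saff szi).
- move=> t [q' Wq' zq']; rewrite -zq' zK //; apply/(SW q' Wq') => i mi.
  have zi0 := (SW q Wq).1 Sq i mi.
  rewrite zq' !mxE zi0 add0r; case: splitP => [j ij|j ij]; last by rewrite mxE mulr0.
  by move: mi; rewrite ij leqNgt ltn_ord.
- by rewrite scale0r addr0 zK.
- have I0' : (z @` W) (z q + 0 *: w) by exact: I0.
  have := Dmx_comp (@atlas_line R) (@atlas_model R _) oI ozW saff szi I0 I0'.
  rewrite scale0r addr0 Jdef => E; apply: etrans _ (esym E).
  have -> : @Dmx R 1 _ (line R) (model R (m + m)) (fun t =>
      z q + t *: w) 0 = w by exact: Dmx_affine.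
  by rewrite /w -[X in _ = _ *m X]vsubmxK mul_row_col mul0mx addr0.
Qed.

End HalfDimensional.
End TangentVectors.

(** * Squared phases of real subspaces *)

Section Phase.
Variable R : realType.
Implicit Types z w : R[i].

Definition phase z : R[i] := z ^+ 2 / `|z| ^+ 2.

(** The parts of the phase as rational functions of those of z, from which continuity is read off;
    at z = 0 both sides are 0. *)
Lemma phaseE z : phase z =
  Complex ((complex.Re z ^+ 2 - complex.Im z ^+ 2) / (complex.Re z ^+ 2 + complex.Im z ^+ 2))
          (2 * complex.Re z * complex.Im z / (complex.Re z ^+ 2 + complex.Im z ^+ 2)).
Proof.
have [->|z0] := eqVneq z 0; first by rewrite /phase expr0n mul0r /= !mulr0 expr0n /= subrr !mul0r.
rewrite /phase -add_Re2_Im2; set d := _ + _.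
have d0 : (d%:C)%C != 0.
  by rewrite /d add_Re2_Im2 expf_neq0 // normr_eq0.
apply: (mulIf d0); rewrite mulfVK //.
have dr : d != 0 by move: d0; rewrite eq_complex /= eqxx andbT.
rewrite /d in dr *; case: z z0 d d0 dr => a b _ /= _ _ dr.
apply/eqP; rewrite eq_complex expr2 /=; apply/andP; split; apply/eqP; field; exact: dr.
Qed.

Lemma phase_norm z : z != 0 -> `|phase z| = 1.
Proof.
move=> z0; rewrite /phase normf_div !normrX normr_id divff //.
by rewrite expf_neq0 // normr_eq0.
Qed.

Lemma phaseM z w : phase (z * w) = phase z * phase w.
Proof. by rewrite /phase normrM !exprMn invfM mulrACA. Qed.

Lemma phase_real (r : R) : r != 0 -> phase (r%:C)%C = 1.
Proof.
move=> r0; rewrite phaseE /= expr0n /= subr0 addr0 mulr0 mul0r divff //.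
by rewrite expf_neq0.
Qed.

Lemma continuous_phase (T : topologicalType) (f : T -> R[i]) x :
  {for x, continuous (fun t => complex.Re (f t))} ->
  {for x, continuous (fun t => complex.Im (f t))} -> f x != 0 ->
  {for x, continuous (fun t => complex.Re (phase (f t)))} /\
  {for x, continuous (fun t => complex.Im (phase (f t)))}.
Proof.
move=> cr ci fx0.
have cr2 : {for x, continuous (fun t => complex.Re (f t) ^+ 2)} by apply: continuousM.
have ci2 : {for x, continuous (fun t => complex.Im (f t) ^+ 2)} by apply: continuousM.
have cV : {for x, continuous (fun t => (complex.Re (f t) ^+ 2 + complex.Im (f t) ^+ 2)^-1)}.
  apply: continuousV; last by apply: continuousD.
  apply: contraNneq fx0 => e; have /esym/eqP := add_Re2_Im2 (f x).
  by rewrite e expf_eq0 /= normr_eq0.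
have -> : (fun t => complex.Re (phase (f t))) = (fun t =>
   (complex.Re (f t) ^+ 2 - complex.Im (f t) ^+ 2) * (complex.Re (f t) ^+ 2 +
       complex.Im (f t) ^+ 2)^-1).
  by apply/funext => t; rewrite phaseE.
have -> : (fun t => complex.Im (phase (f t))) = (fun t =>
   2 * complex.Re (f t) * complex.Im (f t) * (complex.Re (f t) ^+ 2 + complex.Im (f t) ^+ 2)^-1).
  by apply/funext => t; rewrite phaseE.
split; apply: continuousM => //; first by apply: continuousB.
by apply: continuousM => //; apply: continuousM => //; exact: cst_continuous.
Qed.

(** Two bases of the same space differ by an invertible real matrix, which multiplies the value of
    the form by a nonzero real number, and such a number has phase 1. *)
Lemma squared_phaseE m k (Om : 'M[R]_(m, k) -> R[i]) (e : 'M[R]_(m, k)) :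
  row_free e -> (forall P : 'M[R]_m, Om (P *m e) = ((\det P)%:C)%C * Om e) ->
  squared_phase Om (rowspace e) = phase (Om e).
Proof.
move=> fe OmP; rewrite /squared_phase.
have [e' [fe' ee' ->]] := xgetPex 0 (ex_intro [set w | exists e0, [/\ row_free e0,
  rowspace e = rowspace e0 & w = Om e0 ^+ 2 / `|Om e0| ^+ 2]] (phase (Om e))
  (ex_intro _ e (And3 fe erefl erefl))).
have e'e : (e' <= e)%MS.
  apply/row_subP => i; have : rowspace e' (row i e') by exact: row_sub.
  by rewrite -ee'.
have /submxP [P PE] := e'e.
have Pu : \det P != 0.
  have : row_free (P *m e) by rewrite -PE.
  rewrite /row_free => /eqP rP; rewrite -unitfE -unitmxE -row_free_unit /row_free.
  by rewrite eqn_leq rank_leq_row /= -{1}rP mxrankM_maxl.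
by rewrite -/(phase _) PE OmP phaseM phase_real // mul1r.
Qed.

End Phase.

(** * Complex matrices of real frames *)

Section ComplexMatrices.
Variable R : realType.

Local Notation toC := (fun r : R => (r%:C)%C).

Lemma cmxD d m (A B : 'M[R]_(d, m + m)) : cmx (A + B) = cmx A + cmx B.
Proof. by apply/matrixP => i j; rewrite !mxE. Qed.

Lemma cmx_mull d d' m (P : 'M[R]_(d', d)) (A : 'M[R]_(d, m + m)) :
  cmx (P *m A) = map_mx toC P *m cmx A.
Proof.
apply/matrixP => i j; rewrite !mxE; apply/eqP; rewrite eq_complex /= !raddf_sum /=.
apply/andP; split; apply/eqP; apply: eq_bigr => h _; rewrite !mxE /=; ring.
Qed.

Lemma cmx_eq0 d m (A : 'M[R]_(d, m + m)) : cmx A = 0 -> A = 0.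
Proof.
move=> /matrixP A0; rewrite -[A]hsubmxK; apply/matrixP => i j; rewrite [RHS]mxE.
rewrite -(fintype.splitK j); case: (fintype.split j) => l /=; rewrite ?row_mxEl ?row_mxEr mxE;
  by have := A0 i l; rewrite !mxE => -[].
Qed.

Lemma cmxJ d m (A : 'M[R]_(d, m + m)) : cmx (A *m Jmx R m) = 'i%C *: cmx A.
Proof.
apply/matrixP => i j; rewrite -{1}[A]hsubmxK /Jmx mul_row_block !mulmx0 !mulmxN !mulmx1 add0r addr0.
rewrite [LHS]mxE row_mxEl row_mxEr !mxE.
by apply/eqP; rewrite eq_complex /=; apply/andP; split; apply/eqP; ring.
Qed.

(** Complex linearity makes the lower half of T equal to i times the upper half, so [usubmx T] alone
    encodes the complex matrix. *)
Lemma cmx_mulr d m l (A : 'M[R]_(d, m + m)) (T : 'M[R]_(m + m, l + l)) :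
  Jmx R m *m T = T *m Jmx R l -> cmx (A *m T) = cmx A *m cmx (usubmx T).
Proof.
move=> JT; have dT : dsubmx T = usubmx T *m Jmx R l.
  rewrite mul_usub_mx -JT -{2}[T]vsubmxK /Jmx mul_block_col.
  by rewrite mul0mx mul1mx add0r col_mxKu.
rewrite -{1}[A]hsubmxK -{1}[T]vsubmxK mul_row_col dT mulmxA cmxD cmxJ !cmx_mull.
rewrite scalemxAl -mulmxDl; congr (_ *m _).
apply/matrixP => i j; rewrite !mxE.
by apply/eqP; rewrite eq_complex /=; apply/andP; split; apply/eqP; ring.
Qed.

Lemma volfM m (a : R[i]) (P : 'M[R]_m) (e : 'M[R]_(m, m + m)) :
  volf a (P *m e) = ((\det P)%:C)%C * volf a e.
Proof.
rewrite /volf cmx_mull det_mulmx mulrCA; congr (_ * _).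
by rewrite (det_map_mx (real_complex R)).
Qed.

Definition compatible m (om : 'M[R]_(m + m)) : Prop :=
  [/\ om^T = - om, Jmx R m *m om *m (Jmx R m)^T = om
    & forall u : 'rV[R]_(m + m), u != 0 -> 0 < Defs.form om u (u *m Jmx R m)].

(** Write x = a + i b. Then a e + (b e) J = 0, so (b e) J lies in the isotropic span of e and om (b
    e, (b e) J) = 0; positivity forces b e = 0, hence a e = 0. *)
Lemma totally_real m d (om : 'M[R]_(m + m)) (e : 'M[R]_(d, m + m)) (x : 'rV[R[i]]_d) :
  compatible om -> row_free e -> e *m om *m e^T = 0 -> x *m cmx e = 0 -> x = 0.
Proof.
move=> [_ _ pos] fe iso x0.
pose a : 'rV[R]_d := map_mx (@complex.Re R) x; pose b : 'rV[R]_d := map_mx (@complex.Im R) x.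
have xE : x = map_mx toC a + 'i%C *: map_mx toC b.
  by apply/rowP => j; rewrite !mxE [LHS]complexE.
have e0 : a *m e + b *m e *m Jmx R m = 0.
  apply: cmx_eq0; rewrite cmxD cmxJ !cmx_mull -x0 xE mulmxDl -scalemxAl //.
have be : b *m e = 0.
  apply/eqP; apply: contraT => /pos; rewrite /Defs.form.
  have -> : b *m e *m Jmx R m = - (a *m e) by apply/eqP; rewrite -addr_eq0 addrC e0.
  rewrite linearN /= trmx_mul mulmxN.
  have -> : b *m e *m om *m (e^T *m a^T) = b *m (e *m om *m e^T) *m a^T by rewrite !mulmxA.
  by rewrite iso mulmx0 mul0mx oppr0 mxE ltxx.
have ae : a *m e = 0 by move: e0; rewrite be mul0mx addr0.
have z0 (c : 'rV[R]_d) : c *m e = 0 -> c = 0.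
  by move=> ce; apply: (row_free_inj fe); rewrite ce mul0mx.
by rewrite xE (z0 _ ae) (z0 _ be) !map_mx0 scaler0 addr0.
Qed.

Lemma det_cmx_neq0 m (om : 'M[R]_(m + m)) (e : 'M[R]_(m, m + m)) :
  compatible om -> row_free e -> e *m om *m e^T = 0 -> \det (cmx e) != 0.
Proof.
move=> com fe iso; apply/negP => /det0P [x /negP x0 xe]; apply: x0.
by rewrite (totally_real com fe iso xe).
Qed.

End ComplexMatrices.

(** * Gradings of Lagrangians *)

Section ComplexSmooth.
Variables (R : realType) (k : nat).
Implicit Types (U : set 'rV[R]_k) (f g : 'rV[R]_k -> R[i]).

Definition csmooth U f : Prop :=
  forall N, Ckn N U (fun x => complex.Re (f x)) /\ Ckn N U (fun x => complex.Im (f x)).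

Lemma csmooth_cst U (a : R[i]) : csmooth U (fun=> a).
Proof. by move=> N; split; exact: Ckn_cst. Qed.

Lemma csmooth_ext U f g : open U -> (forall x, U x -> f x = g x) -> csmooth U f -> csmooth U g.
Proof.
by move=> oU fg hf N; have [h1 h2] := hf N; split;
  [apply: Ckn_ext h1 | apply: Ckn_ext h2] => // x Ux; rewrite fg.
Qed.

Lemma csmoothD U f g : open U -> csmooth U f -> csmooth U g -> csmooth U (fun x => f x + g x).
Proof.
move=> oU hf hg N; have [f1 f2] := hf N; have [g1 g2] := hg N.
split; [apply: Ckn_ext (CknD oU f1 g1) | apply: Ckn_ext (CknD oU f2 g2)] => // x _;
    by rewrite raddfD.
Qed.

Lemma csmoothM U f g : open U -> csmooth U f -> csmooth U g -> csmooth U (fun x => f x * g x).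
Proof.
move=> oU hf hg N; have [f1 f2] := hf N; have [g1 g2] := hg N; split.
  apply: Ckn_ext (CknB oU (CknM oU f1 g1) (CknM oU f2 g2)) => // x _.
  by case: (f x) (g x) => a b [c d].
apply: Ckn_ext (CknD oU (CknM oU f1 g2) (CknM oU f2 g1)) => // x _.
by case: (f x) (g x) => a b [c d].
Qed.

Lemma csmooth_sum U (I : Type) (r : seq I) (F : I -> 'rV[R]_k -> R[i]) : open U ->
  (forall i, csmooth U (F i)) -> csmooth U (fun x => \sum_(i <- r) F i x).
Proof.
move=> oU hF; elim: r => [|i r IH].
  by apply: csmooth_ext (csmooth_cst U 0) => // x _; rewrite big_nil.
by apply: csmooth_ext (csmoothD oU (hF i) IH) => // x _; rewrite big_cons.
Qed.

Lemma csmooth_prod U (I : Type) (r : seq I) (F : I -> 'rV[R]_k -> R[i]) : open U ->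
  (forall i, csmooth U (F i)) -> csmooth U (fun x => \prod_(i <- r) F i x).
Proof.
move=> oU hF; elim: r => [|i r IH].
  by apply: csmooth_ext (csmooth_cst U 1) => // x _; rewrite big_nil.
by apply: csmooth_ext (csmoothM oU (hF i) IH) => // x _; rewrite big_cons.
Qed.

Lemma csmooth_det m U (M : 'rV[R]_k -> 'M[R[i]]_m) : open U ->
  (forall i j, csmooth U (fun x => M x i j)) -> csmooth U (fun x => \det (M x)).
Proof.
move=> oU hM; rewrite /determinant; apply: csmooth_sum => // s.
by apply: csmoothM => //; [exact: csmooth_cst | apply: csmooth_prod].
Qed.

Lemma csmooth_continuous U f x : csmooth U f -> U x ->
  {for x, continuous (fun y => complex.Re (f y))} /\ {for x,
      continuous (fun y => complex.Im (f y))}.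
Proof. by move=> /(_ 0%N) [h1 h2] Ux; split; [exact: h1 | exact: h2]. Qed.

End ComplexSmooth.

Lemma vol_transition (R : realType) m (a : R[i]) (A P : 'M[R]_(m + m)) :
  Jmx R m *m P = P *m Jmx R m ->
  volf a (usubmx (A *m P)) = volf a (usubmx P) * \det (cmx (usubmx A)).
Proof.
by move=> JP; rewrite -mul_usub_mx /volf (cmx_mulr _ JP) det_mulmx -mulrA (mulrC (\det _)).
Qed.

(** * The squared phase along a Lagrangian of a Kaehler manifold *)

Section LagrangianPhase.
Variables (R : realType) (m : nat) (Y : charted R (m + m)).
Variables (om : Y -> 'M[R]_(m + m)) (Om : Y -> R[i]).
Hypothesis Y_kahler : kahler om.
Hypothesis Om_volume : holo_volume_form Om.

Lemma kahler_atlas : atlas Y.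
Proof.
have [[_ _ h1 h2 _] _ _ _] := Y_kahler.
split=> p; [| | | move=> q | move=> q | move=> x];
  by have [? ? ?] := h1 p; have [H1 H2 H3] := h2 p => // H; auto.
Qed.

Lemma kahler_compatible p : compatible (om p).
Proof. by have [_ _ _ H] := Y_kahler; have [? ? ?] := H p; split. Qed.

Lemma holomorphic_transition (p q : Y) :
  holomorphic (cmap p @` (cdom p `&` cdom q)) (cmap q \o cinv p).
Proof. by have [[_ _ _ _ H] _ _ _] := Y_kahler; exact: H. Qed.

Let aY := kahler_atlas.

Lemma vol_locE (p q : Y) : cdom p q ->
  vol_loc Om p (cmap p q) = volf (Om q) (usubmx ('J (cmap q \o cinv p) (cmap p q))).
Proof.
move=> pq; rewrite /vol_loc (cmapK aY pq); congr (volf _ _).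
apply/row_matrixP => i; rewrite rowK -rowE.
by apply/rowP => j; rewrite [LHS]mxE [RHS]mxE [RHS]mxE.
Qed.

Variable L : set Y.
Hypothesis Lag : lagrangian m om L.

(** In the chart at p, a frame from slice coordinates and the coefficient of the volume form vary
    smoothly, and T is the value of the form on the frame. The phase at q is defined in the chart at
    q; since the transition is complex linear at first order, its determinant passes from the frame
    to the coefficient. T does not vanish on L because Lagrangian frames are totally real. *)
Lemma local_phase p : L p -> exists (W : set Y) (T : 'rV[R]_(m + m) -> R[i]),
  [/\ open W /\ W p, W `<=` cdom p, csmooth (cmap p @` W) T
    & forall q, W q -> L q -> T (cmap p q) != 0 /\
        squared_phase (volf (Om q)) (tangent L q) = phase (T (cmap p q))].
Proof.
move=> Lp; have [W0 [z [W0p [zi czi] SW]]] := Lag.1 p Lp.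
have [oW0 ozW0 sz szi zK] := czi.
have [W1 [[oW1 W1p] W1D W1W0 _ sz1]] := smooth_on_open aY oW0 sz W0p.
have zW0p : (z @` W0) (z p) by exists p.
have [V [[oV Vp] _ VW0 Vzi sV]] := smooth_on_open (@atlas_model R _) ozW0 szi zW0p.
rewrite (zK p W0p) in Vzi sV; rewrite model_image in sV.
have cz := smooth_on_cont_on aY (@atlas_model R _) sz.
pose W := W1 `&` z @^-1` V.
have oW : open W.
  rewrite openE => q [W1q Vq]; have n1 := cz q (W1W0 q W1q) V (open_nbhs_nbhs (conj oV Vq)).
  suff : \forall y \near q, W y by [].
  by apply: filterS2 n1 (open_nbhs_nbhs (conj oW1 W1q)) => y H W1y; split => //; apply: H;
      exact: W1W0.
have WW1 : W `<=` W1 by move=> q [].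
have WD : W `<=` cdom p by move=> q /WW1 /W1D.
have oU := chart_open aY oW WD.
pose h := cmap p \o zi.
pose fr x := usubmx ('J h (z (cinv p x))).
pose T x := vol_loc Om p x * \det (cmx (fr x)).
exists W, T; split => //.
- rewrite /T; apply: csmoothM => //.
    move=> N; have [_ /(_ p) [+ _]] := Om_volume => /smoothE /(_ N).
    have UC : cmap p @` W `<=` cimg p by move=> _ [q Wq <-]; exists q => //; exact: WD.
    move=> /(Ckn_sub UC) /(Ckn_row _ _ oU) H.
    split; [have := H (lshift 1 ord0) | have := H (rshift 1 ord0)]; apply: Ckn_ext => // x _.
      by rewrite row_mxEl mxE.
    by rewrite row_mxEr mxE.
  apply: csmooth_det => // i j.
  have entry (a : 'I_m) (b : 'I_(m + m)) N : Ckn N (cmap p @` W) (fun x => fr x a b : R).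
    have /smoothE sV' := sV.
    have sD : Ckn N V (fun y => 'D_(delta_mx ord0 (lshift m a)) (fun y => h y ord0 b : R) y).
      have /(Ckn_row _ _ oV) /(_ b) [_] := sV' N.+1; apply.
    have /smoothE sz2 := smooth_sub (@image_subset _ _ (cmap p) _ _ WW1) sz1.
    have UV x : (cmap p @` W) x -> V ((z \o cinv p) x).
      by move=> [q [W1q Vq] <-] /=; rewrite (cmapK aY) //; exact: W1D.
    apply: Ckn_ext (Ckn_comp oU oV UV (sz2 N) sD) => // x Ux.
    have dh : differentiable h (z (cinv p x)).
      by apply: (smooth_differentiable sV); exact: UV.
    by rewrite /fr [RHS]mxE; apply: esym; apply: jacobianE dh.
  have E : (fun x => cmx (fr x) i j) = (fun x =>
      Complex (fr x i (lshift m j)) (fr x i (rshift m j))).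
    by apply/funext => x; rewrite mxE.
  by rewrite E => N; split; exact: entry.
- move=> q Wq Lq; have W1q := WW1 q Wq; have W0q := W1W0 q W1q.
  have [fe tE] := tangent_frame aY czi SW W0q Lq.
  have iso : frame zi q (z q) *m om q *m (frame zi q (z q))^T = 0.
    apply/matrixP => i j; rewrite [RHS]mxE.
    have Ti l : tangent L q (row l (frame zi q (z q))) by rewrite tE; exact: row_sub.
    have := Lag.2 q Lq _ _ (Ti i) (Ti j); rewrite /Defs.form => <-.
    rewrite -row_mul tr_row [LHS]mxE [RHS]mxE; apply: eq_bigr => l _.
    by congr (_ * _); apply: esym; [exact: mxE | rewrite [LHS]mxE].
  have dn := det_cmx_neq0 (kahler_compatible q) fe iso.
  have TE : T (cmap p q) = volf (Om q) (frame zi q (z q)).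
    rewrite /T (vol_locE (WD q Wq)) /fr (cmapK aY (WD q Wq)).
    pose P := 'J (cmap q \o cinv p) (cmap p q).
    have Uq : (cmap p @` (cdom p `&` cdom q)) (cmap p q).
      by exists q => //; split; [exact: WD | exact: (cdom_center aY)].
    have [sP JP] := holomorphic_transition p q.
    have {}JP := JP _ Uq; have dP := smooth_differentiable sP Uq.
    have dh : differentiable h (z q) by apply: (smooth_differentiable sV); case: Wq.
    have hq : h (z q) = cmap p q by rewrite /h /= zK.
    have dP' : differentiable (cmap q \o cinv p) (h (z q)) by rewrite hq.
    have nE : \forall y \near z q, ((cmap q \o cinv p) \o h) y = (cmap q \o zi) y.
      have nV : \forall y \near z q, V y by apply: (open_nbhs_nbhs (conj oV _)); case: Wq.
      by apply: filterS nV => y Vy /=; rewrite (cmapK aY) //; exact: Vzi.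
    have JE : 'J (cmap q \o zi) (z q) = 'J h (z q) *m P.
      apply: etrans (esym (jacobian_near_eq (differentiable_comp dh dP') nE)) _.
      by apply: etrans (jacobian_comp dh dP') _; rewrite hq.
    by rewrite /frame JE (vol_transition _ _ JP).
  split; first by rewrite TE mulf_neq0 //; exact: Om_volume.1.
  rewrite TE tE; apply: squared_phaseE => // P; exact: volfM.
Qed.

End LagrangianPhase.

Section LagrangianGrading.
Variables (R : realType) (m : nat) (Y : charted R (m + m)).
Variables (om : Y -> 'M[R]_(m + m)) (Om : Y -> R[i]).
Hypothesis Y_kahler : kahler om.
Hypothesis Om_volume : holo_volume_form Om.
Variable L : set Y.
Hypothesis Lag : lagrangian m om L.

Let aY := kahler_atlas Y_kahler.
Let w q := squared_phase (volf (Om q)) (tangent L q).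

Lemma lagrangian_phase_norm q : L q -> `|w q| = 1.
Proof.
move=> Lq; have [W [T [[oW Wq] WD sT HT]]] := local_phase Y_kahler Om_volume Lag Lq.
by have [Tn0 E] := HT q Wq Lq; rewrite /w E; exact: phase_norm.
Qed.

Lemma lagrangian_phase_continuous :
  cont_on L (fun q => complex.Re (w q)) /\ cont_on L (fun q => complex.Im (w q)).
Proof.
have H p : L p -> exists (W : set Y) (f : Y -> R[i]), [/\ nbhs p W,
    {for p, continuous (fun q => complex.Re (f q))},
    {for p, continuous (fun q => complex.Im (f q))} & forall q, W q -> L q -> w q = f q].
  move=> Lp; have [W [T [[oW Wp] WD sT HT]]] := local_phase Y_kahler Om_volume Lag Lp.
  have Ux : (cmap p @` W) (cmap p p) by exists p.
  have [Tp _] := HT p Wp Lp.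
  have [cr ci] := csmooth_continuous sT Ux.
  have [cr' ci'] := continuous_phase cr ci Tp.
  have cm := cmap_continuous aY (WD p Wp).
  exists W, (fun q => phase (T (cmap p q))); split.
  - exact: (open_nbhs_nbhs (conj oW Wp)).
  - exact: (@continuous_comp _ _ _ (cmap p) (fun y => complex.Re (phase (T y)))).
  - exact: (@continuous_comp _ _ _ (cmap p) (fun y => complex.Im (phase (T y)))).
  - by move=> q Wq Lq; have [_ E] := HT q Wq Lq; rewrite /w E.
split=> p Lp N; have [W [f [nW cr ci wf]]] := H p Lp.
  rewrite wf //; last exact: nbhs_singleton.
  move=> nN; have n1 : \forall q \near p, N (complex.Re (f q)) by exact: cr nN.
  by apply: filterS2 n1 nW => q Nq Wq Lq; rewrite wf.
rewrite wf //; last exact: nbhs_singleton.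
move=> nN; have n1 : \forall q \near p, N (complex.Im (f q)) by exact: ci nN.
by apply: filterS2 n1 nW => q Nq Wq Lq; rewrite wf.
Qed.

Lemma cis_inj_near (a b : R) : cis a = cis b -> `|a - b| < pi -> a = b.
Proof.
move=> /cis_inj_cos; rewrite -cos_norm -[RHS]cos0 => c ab.
apply/eqP; rewrite -subr_eq0 -normr_eq0; apply/eqP; apply: cos_inj c.
  by rewrite in_itv /= normr_ge0 ltW.
by rewrite in_itv /= lexx pi_ge0.
Qed.

(** [cquo] is a quotient up to a positive real factor, which the normalization removes. *)
Lemma cquo_sqr_phase (z z0 : R[i]) : z0 != 0 -> `|z| != 0 ->
  cquo (z ^+ 2) (z0 ^+ 2) / `|cquo (z ^+ 2) (z0 ^+ 2)| * phase z0 = phase z.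
Proof.
move=> z00 z0'; rewrite /cquo /phase normrM normcJ !normrX.
have -> : (z0 ^+ 2)^*%C = `|z0| ^+ 2 * `|z0| ^+ 2 / z0 ^+ 2.
  apply: (mulIf (expf_neq0 2 z00)); rewrite mulfVK ?expf_neq0 //.
  have zz : z0 * z0^*%C = `|z0| ^+ 2.
    rewrite -add_Re2_Im2; case: (z0) => a b /=; apply/eqP; rewrite eq_complex /=.
    by apply/andP; split; apply/eqP; ring.
  have -> : (z0 ^+ 2)^*%C = z0^*%C ^+ 2 by rewrite rmorphXn.
  by rewrite -exprMn mulrC zz expr2.
have n0 : `|z0| != 0 by rewrite normr_eq0.
by field; rewrite z00 n0 z0'.
Qed.

(** A continuous lift is automatically smooth: near p it equals l p plus the [carg] of the quotient
    of T squared by its value at p, since both functions lift the same phase and differ by less than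
    pi. *)
Lemma grading_of_lift (l : Y -> R) :
  cont_on L l -> (forall q, L q -> cis (l q) = w q) ->
  grading (fun q => volf (Om q)) L (fun q => l q / (2 * pi)).
Proof.
move=> cl hl; have pi0 : (2 * pi : R) != 0 by rewrite mulf_neq0 // gt_eqF // pi_gt0.
split; last by move=> q Lq; rewrite mulrC mulfVK // hl.
move=> p Lp; have [W [T [[oW Wp] WD sT HT]]] := local_phase Y_kahler Om_volume Lag Lp.
have [Tp wp] := HT p Wp Lp.
have oU := chart_open aY oW WD.
pose z x := cquo (T x ^+ 2) (T (cmap p p) ^+ 2).
have sz : csmooth (cmap p @` W) z.
  rewrite /z /cquo; apply: csmoothM => //; last exact: csmooth_cst.
  by have := csmoothM oU sT sT; apply: csmooth_ext => // x _; rewrite expr2.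
have zp : 0 < complex.Re (z (cmap p p)).
  rewrite /z Re_cquo -!expr2 -ltcR.
  by rewrite add_Re2_Im2 exprn_gt0 // normr_gt0 expf_neq0.
have Up : (cmap p @` W) (cmap p p) by exists p.
have [czr _] := csmooth_continuous sz Up.
have n1 : \forall q \near p, 0 < complex.Re (z (cmap p q)).
  have nx : \forall x \near cmap p p, 0 < complex.Re (z x) by exact: (cvgr_gt _ czr 0 zp).
  exact: (cmap_continuous aY (WD p Wp)) nx.
(* Each of the two angle increments stays below pi / 2, so their difference stays below pi, as
   [cis_inj_near] demands. *)
have n2 : \forall q \near p, L q -> `|l q - l p| < pi / 2.
  apply: (cl p Lp [set x | `|x - l p| < pi / 2]).
  apply/nbhs_ballP; exists (pi / 2) => /=; first by rewrite divr_gt0 // pi_gt0.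
  by move=> x; rewrite -ball_normE /= distrC.
pose V := W `&` [set q | 0 < complex.Re (z (cmap p q)) /\ (L q -> `|l q - l p| < pi / 2)]°.
have oV : open V by apply: openI => //; exact: open_interior.
have VW : V `<=` W by move=> q [].
have VH q : V q -> 0 < complex.Re (z (cmap p q)) /\ (L q -> `|l q - l p| < pi / 2).
  by move=> [_ /interior_subset].
have oVU : open (cmap p @` V) by apply: (chart_open aY) => // q /VW /WD.
pose G x := (l p + carg (z x)) / (2 * pi).
exists V, (fun q => G (cmap p q)); split => //.
- split => //; split => //; suff : \forall q \near p,
    0 < complex.Re (z (cmap p q)) /\ (L q -> `|l q - l p| < pi / 2) by [].
  exact: filterS2 n1 n2.
- by move=> q /VW /WD.
- move=> q Lq Vq; have [zq0 /(_ Lq) lq] := VH q Vq; rewrite /G; congr (_ / _).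
  have [Tq wq] := HT q (VW q Vq) Lq.
  apply: cis_inj_near.
    rewrite cisD cis_carg // hl // hl // /w wq wp mulrC.
    by apply: cquo_sqr_phase => //; rewrite normr_eq0.
  have ab : `|carg (z (cmap p q))| < pi / 2.
    by rewrite ltr_norml atan_gtNpi2 atan_ltpi2.
  rewrite addrAC -opprB addrC (le_lt_trans (ler_normB _ _)) // [pi]splitr ltrD //.
- have sV : csmooth (cmap p @` V) z.
    move=> N; have [h1 h2] := sz N.
    by split; [apply: Ckn_sub h1 | apply: Ckn_sub h2]; exact: image_subset.
  apply/smoothE => N; apply/(Ckn_row _ _ oVU) => j; have [h1 h2] := sV N.
  have nz x : (cmap p @` V) x -> complex.Re (z x) != 0.
    by move=> [q Vq <-]; have [? _] := VH q Vq; rewrite gt_eqF.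
  have hG : Ckn N (cmap p @` V) (fun x =>
      (l p + atan (complex.Im (z x) * (complex.Re (z x))^-1)) * (2 * pi)^-1).
    apply: CknM => //; last exact: Ckn_cst.
    apply: CknD => //; first exact: Ckn_cst.
    by apply: Ckn_atan => //; apply: CknM => //; exact: CknV.
  apply: Ckn_ext hG => // x [q Vq <-] /=.
  by rewrite mxE (cmapK aY) //; exact: WD (VW _ Vq).
Qed.

End LagrangianGrading.

(** * Extending a lift from one fibre to the whole fibered Lagrangian *)

Section FiberedLagrangian.
Variables (R : realType) (n : nat) (Y : charted R (n.+1 + n.+1)).
Variables (om : Y -> 'M[R]_(n.+1 + n.+1)) (v : Y -> plane R).
Hypothesis aY : atlas Y.
Hypothesis v_holo : holo_function v.

Lemma holo_smooth_on : @smooth_on R _ _ Y (plane R) setT v.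
Proof.
move=> p _; exists (cdom p), v; split => //.
- by split; [exact: (cdom_open aY) | exact: (cdom_center aY)].
- exact: (v_holo p).1.
Qed.

Lemma holo_continuous : continuous v.
Proof.
move=> p N nN; have := smooth_on_cont_on aY (@atlas_model R _) holo_smooth_on (x := p) Logic.I nN.
by move=> H; suff : \forall q \near p, N (v q) by []; apply: filterS H => q; exact.
Qed.

(** Parametrizing the base curve by g turns v into a real function [tau] on L, continuous because g
    is a homeomorphism onto its image; the trivializations of v over open sets of the plane restrict
    to trivializations of [tau] over intervals, to which [fibered_lift] applies. *)
Lemma lift_from_fiber (L : set Y) (w : Y -> R[i]) (l0 : Y -> R) (p : Y) :
  fibered_lagrangian om v L -> L p ->
  (forall q, L q -> `|w q| = 1) ->
  cont_on L (fun q => complex.Re (w q)) -> cont_on L (fun q => complex.Im (w q)) ->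
  cont_on (L `&` fiber v (v p)) l0 -> (forall q, (L `&` fiber v (v p)) q -> cis (l0 q) = w q) ->
  exists l, [/\ cont_on L l, forall q, L q -> cis (l q) = w q & l p = l0 p].
Proof.
move=> [_ [g [[sg ig _ eg] _ vL lt _]]] Lp w1 cRe cIm cl0 hl0.
have rg q : L q -> exists t, g t = v q.
  by move=> Lq; have : (v @` L) (v q) by [exists q]; rewrite vL => -[t _ e]; exists t.
(* The default 0 is not reached on L, where v takes values on the curve. *)
pose tau q := xget 0 [set t | g t = v q].
have tauE q : L q -> g (tau q) = v q.
  by move=> /rg [t e]; exact: (@xgetPex _ 0 [set t | g t = v q] (ex_intro _ t e)).
have tauP q t : L q -> v q = g t -> tau q = t.
  by move=> Lq e; apply: ig; rewrite tauE.
have cg : continuous g.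
  move=> t N nN; have H := smooth_on_cont_on (@atlas_line R) (@atlas_model R _) sg (x :=
      t) Logic.I nN.
  by suff : \forall s \near t, N (g s) by []; apply: filterS H => s; exact.
have ctau : cont_on L tau.
  move=> q Lq N nN; have [U [oU Ug UI]] := eg (tau q) N° (open_interior N) nN.
  rewrite tauE // in Ug.
  have nU : \forall q' \near q, U (v q') by apply: holo_continuous; exact: open_nbhs_nbhs.
  apply: filterS nU => q' Uq' Lq'; apply: interior_subset; apply: UI; by rewrite tauE.
have trivial t : exists e psi chi, 0 < e /\ top_trivialization L tau t e psi chi.
  have [_ _ /(_ (g t))[|U [psi [chi [[oU Ut] spsi schi T1 T2]]]]] := lt; first by exists t.
  have nU : \forall s \near t, U (g s) by apply: cg; exact: open_nbhs_nbhs.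
  have [e /= e0 eU] := (nbhs_ballP _ _).1 nU.
  (* Halving the radius turns the open ball given by continuity into the closed interval of
     [top_trivialization]. *)
  have JU s : `|s - t| <= e / 2 -> U (g s).
    move=> st; apply: eU; rewrite -ball_normE /= distrC (le_lt_trans st) //.
    by rewrite ltr_pdivrMr // ltr_pMr // ltr1n.
  have FE q : (L `&` tau @^-1` [set t]) q -> (L `&` v @^-1` [set g t]) q.
    by move=> [Lq tq]; split => //; rewrite /preimage /= -tauE // tq.
  exists (e / 2), psi, (fun u => chi (g u.1, u.2)); split; first by rewrite divr_gt0.
  split.
  - have := smooth_on_cont_on aY aY spsi; apply: cont_on_sub => q [Lq Jq].
    by split => //; rewrite /preimage /= -tauE //; exact: JU.
  - have cchi := smooth_on_cont_on (atlas_prod (@atlas_model R _) aY) aY schi.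
    apply: (@cont_on_comp _ _ _ _ _ (fun u : R * Y => (g u.1, u.2)) chi _ cchi).
      apply: cont_on_pair; apply: continuous_cont_on => u _; last exact: cvg_snd.
      by apply: (@continuous_comp _ _ _ fst g); [exact: cvg_fst | exact: cg].
    by move=> [s q] [Js Fq]; split; [split; [exact: JU | exists s] | exact: FE].
  - move=> q [Lq Jq]; have Uq : U (v q) by rewrite -tauE //; exact: JU.
    have [Lpsi vpsi chiq] := T1 q Lq Uq.
    by split; [split => //; exact: tauP | rewrite /= tauE].
  - move=> s q Js Fq; have [Lq vq] := FE q Fq.
    have rs : range g (g s) by exists s.
    have [? vchi ?] := T2 (g s) q (JU s Js) rs Lq vq.
    by split => //; exact: tauP.
have E q : (L `&` tau @^-1` [set tau p]) q -> (L `&` fiber v (v p)) q.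
  by move=> [Lq tq]; split => //; rewrite /fiber /preimage /= -!tauE // tq.
have h0 : lift_on w (L `&` tau @^-1` [set tau p]) l0.
  by split; [exact: cont_on_sub cl0 | move=> q /E; exact: hl0].
have [l [[cl hl] ll0]] := fibered_lift ctau cRe cIm w1 trivial h0.
by exists l; split => //; exact: ll0.
Qed.

End FiberedLagrangian.

(** * Splitting at a point of a fibered Lagrangian *)

Lemma row_free_ker (F : fieldType) d k (A : 'M[F]_(d, k)) :
  (forall x : 'rV_d, x *m A = 0 -> x = 0) -> row_free A.
Proof.
move=> H; rewrite -kermx_eq0; apply/eqP/row_matrixP => i; rewrite row0.
by apply: H; rewrite -row_mul mulmx_ker row0.
Qed.

Lemma det0_ker (F : fieldType) d (A : 'M[F]_d) :
  (forall x : 'rV_d, x *m A = 0 -> x = 0) -> \det A != 0.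
Proof.
move=> /row_free_ker; rewrite row_free_unit unitmxE unitfE //.
Qed.

Lemma row_free_inj0 (F : fieldType) d k (A : 'M[F]_(d, k)) (x : 'rV_d) :
  row_free A -> x *m A = 0 -> x = 0.
Proof. by move=> fA xA; apply: (row_free_inj fA); rewrite xA mul0mx. Qed.

Lemma cmx0 (R : realType) d m : cmx (0 : 'M[R]_(d, m + m)) = 0.
Proof. by apply/matrixP => i j; rewrite !mxE. Qed.

Section PointwiseResidue.
Variables (R : realType) (n : nat).
Local Notation k := (n.+1 + n.+1)%N.
Variables (om : 'M[R]_k) (D : 'M[R]_(k, 1 + 1)) (a : R[i]) (res : 'M[R]_(n, k) -> R[i]).

(* [D] is dv, [a] the coefficient of Omega and [res] its Poincare residue, at one point. *)
Record residue_data : Prop := ResidueData {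
  rd_compatible : compatible om;
  rd_holo : Jmx R n.+1 *m D = D *m Jmx R 1;
  rd_regular : D != 0;
  rd_volume : a != 0;
  rd_residue : forall (h : 'rV[R]_k) (e : 'M[R]_(n, k)), e *m D = 0 ->
    volf a (col_mx h e : 'M[R]_(1 + n, n.+1 + n.+1)) = (-1) ^+ n * cmx (h *m D) ord0 ord0 * res e }.

Hypothesis rd : residue_data.

Lemma cmx_dv d (u : 'M[R]_(d, k)) : cmx (u *m D) = cmx u *m cmx (usubmx D).
Proof. exact: cmx_mulr (rd_holo rd). Qed.

Lemma cmx11_eq0 (b : 'rV[R]_(1 + 1)) : (cmx b ord0 ord0 == 0) = (b == 0).
Proof.
apply/eqP/eqP => [b0|->]; last by rewrite !mxE.
by apply: cmx_eq0; apply/matrixP => i j; rewrite (ord1 i) (ord1 j) b0 mxE.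
Qed.

(** A Lagrangian frame is a basis over the complex numbers, so a complex linear D that kills it is
    zero. *)
Lemma dv_neq0 (e : 'M[R]_(n.+1, k)) :
  row_free e -> e *m om *m e^T = 0 -> e *m D != 0.
Proof.
move=> fe iso; apply/eqP => eD; have /negP := rd_regular rd; apply; apply/eqP.
have dn := det_cmx_neq0 (rd_compatible rd) fe iso.
have U0 : cmx (usubmx D) = 0.
  have cu : cmx e \in unitmx by rewrite unitmxE unitfE.
  by rewrite -[LHS](mulKmx cu) -cmx_dv eD cmx0 mulmx0.
have {}U0 := cmx_eq0 U0.
have d0 : dsubmx D = 0.
  have := rd_holo rd; rewrite -{1}[D]vsubmxK /Jmx mul_block_col !mul0mx !mul1mx add0r U0.
  move=> /(congr1 usubmx); rewrite col_mxKu -mul_usub_mx U0 mul0mx //.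
by rewrite -[D]vsubmxK U0 d0 col_mx0.
Qed.

Lemma regular_vector : exists h : 'rV[R]_k, h *m D != 0.
Proof.
have [i Di] : exists i, row i D != 0.
  apply: contrapT => H; have /negP := rd_regular rd; apply; apply/eqP/row_matrixP => i.
  rewrite row0; apply/eqP; apply: contraT => Di; exfalso; apply: H; by exists i.
by exists (delta_mx ord0 i); rewrite -rowE.
Qed.

Lemma frame_free (h : 'rV[R]_k) (e : 'M[R]_(n, k)) :
  e *m D = 0 -> row_free e -> h *m D != 0 -> row_free (col_mx h e : 'M[R]_(1 + n, n.+1 + n.+1)).
Proof.
move=> eD fe hD; apply: row_free_ker => x; rewrite -[x]hsubmxK mul_row_col => x0.
have s0 : lsubmx x = 0.
  have := congr1 (mulmx^~ D) x0; rewrite mul0mx mulmxDl -[X in _ + X]mulmxA eD mulmx0 addr0.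
  rewrite (mx11_scalar (lsubmx x)) -mulmxA mul_scalar_mx => /eqP.
  by rewrite scaler_eq0 (negbTE hD) orbF => /eqP ->; rewrite raddf0.
move: x0; rewrite s0 mul0mx add0r => /(row_free_inj0 fe) ->; exact: row_mx0.
Qed.

(** Take h with dv(h) nonzero. The frame e is independent over the complex numbers inside ker dv, so
    h and e form a complex basis; the volume form is nonzero on it, and the residue is a factor of
    that value. *)
Lemma residue_neq0 (e : 'M[R]_(n, k)) :
  e *m D = 0 -> row_free e -> e *m om *m e^T = 0 -> res e != 0.
Proof.
move=> eD fe iso; have [h hD] := regular_vector.
have := rd_residue rd h eD; apply: contra_eq_neq => ->; rewrite mulr0.
rewrite mulf_neq0 ?(rd_volume rd) //; apply: det0_ker => x.
have -> : cmx (col_mx h e : 'M[R]_(1 + n, n.+1 + n.+1)) = col_mx (cmx h) (cmx e).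
  by apply/matrixP => i j; rewrite !mxE; case: fintype.split => l; rewrite !mxE.
rewrite -[x](@hsubmxK _ _ 1 n) mul_row_col => x0.
have s0 : (@lsubmx _ _ 1 n x) = 0.
  have := congr1 (mulmx^~ (cmx (usubmx D))) x0; rewrite mul0mx mulmxDl -!mulmxA -!cmx_dv eD.
  rewrite cmx0 mulmx0 addr0 (mx11_scalar (lsubmx _)) mul_scalar_mx => /eqP.
  rewrite scaler_eq0 => /orP[/eqP ->|/eqP/cmx_eq0 hD0]; first by rewrite raddf0.
  by rewrite hD0 eqxx in hD.
move: x0; rewrite s0 mul0mx add0r => /(totally_real (rd_compatible rd) fe iso) ->.
exact: row_mx0.
Qed.

(** Apply the volume form to a fixed h with dv(h) nonzero followed by the frame, where P acts
    through the block matrix diag (1, P), and cancel the factor dv(h). *)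
Lemma residueM (P : 'M[R]_n) (e : 'M[R]_(n, k)) : e *m D = 0 ->
  res (P *m e) = ((\det P)%:C)%C * res e.
Proof.
move=> eD; have [h hD] := regular_vector.
have PeD : P *m e *m D = 0 by rewrite -mulmxA eD mulmx0.
have c0 : (-1) ^+ n * cmx (h *m D) ord0 ord0 != 0.
  by rewrite mulf_neq0 ?signr_eq0 // cmx11_eq0.
apply: (mulfI c0); rewrite -rd_residue // mulrCA -rd_residue //.
have -> : col_mx h (P *m e) = block_mx 1%:M 0 0 P *m col_mx h e.
  by rewrite mul_block_col !mul0mx mul1mx addr0 add0r.
by rewrite volfM det_ublock det1 mul1r.
Qed.

Lemma residue_phase (e : 'M[R]_(n, k)) : e *m D = 0 -> row_free e ->
  squared_phase res (rowspace e) = phase (res e).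
Proof. by move=> eD fe; apply: squared_phaseE => // P; exact: residueM. Qed.

Lemma base_phase (b : 'rV[R]_(1 + 1)) : b != 0 ->
  squared_phase (@volf R 1 1) (rowspace b) = phase (cmx b ord0 ord0).
Proof.
move=> b0; rewrite squared_phaseE; first by rewrite /volf mul1r det_mx11.
  by apply: row_free_ker => x; rewrite (mx11_scalar x) mul_scalar_mx => /eqP;
    rewrite scaler_eq0 (negbTE b0) orbF => /eqP ->; rewrite raddf0.
by move=> P; exact: volfM.
Qed.

(** The sign coming from the position of h is a nonzero real number, so it disappears in the
    phase. *)
Lemma total_phase (h : 'rV[R]_k) (e : 'M[R]_(n, k)) :
  e *m D = 0 -> row_free e -> h *m D != 0 ->
  squared_phase (volf a) (rowspace (col_mx h e : 'M[R]_(1 + n, n.+1 + n.+1))) =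
    phase (res e) * phase (cmx (h *m D) ord0 ord0).
Proof.
move=> eD fe hD; rewrite squared_phaseE; first last.
- by move=> P; exact: volfM.
- exact: frame_free.
rewrite rd_residue // !phaseM mulrC; congr (_ * _).
have -> : (-1 : R[i]) ^+ n = (((-1) ^+ n : R)%:C)%C by rewrite rmorphXn rmorphN1.
by rewrite phase_real ?mul1r // signr_eq0.
Qed.

(** Some vector of TL has nonzero image under dv by [dv_neq0]; this image lies on the line TC, and
    rescaling makes it b. Together with e it gives n + 1 independent vectors of TL, which has that
    dimension. *)
Lemma split_tangent (TL TF : set 'rV[R]_k) (TC : set 'rV[R]_(1 + 1))
    (E : 'M[R]_(n.+1, k)) (e : 'M[R]_(n, k)) (b : 'rV[R]_(1 + 1)) :
  TL = rowspace E -> TF = rowspace e -> TC = rowspace b ->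
  row_free E -> row_free e -> row_free b -> E *m om *m E^T = 0 ->
  TF `<=` TL -> (forall u, TF u -> u *m D = 0) -> (forall u, TL u -> TC (u *m D)) ->
  e *m D = 0 /\ exists h, h *m D = b /\ TL = rowspace (col_mx h e : 'M[R]_(1 + n, n.+1 + n.+1)).
Proof.
move=> -> -> -> fE fe fb iso FL Fv LC.
have eD : e *m D = 0.
  by apply/row_matrixP => i; rewrite row_mul row0; apply: Fv; exact: row_sub.
split=> //; have ED := dv_neq0 fE iso.
have [i Ei] : exists i, row i E *m D != 0.
  apply: contrapT => H; move: ED => /negP; apply; apply/eqP/row_matrixP => i.
  rewrite row0 row_mul; apply/eqP; apply: contraT => Di; exfalso; apply: H; by exists i.
have /submxP [s sE] := LC _ (row_sub i E).
rewrite (mx11_scalar s) mul_scalar_mx in sE; set r := s ord0 ord0 in sE.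
have r0 : r != 0 by apply: contraNneq Ei => r0; rewrite sE r0 scale0r.
pose h := r^-1 *: row i E.
have hD : h *m D = b by rewrite /h -scalemxAl sE scalerA mulVf // scale1r.
have b0 : h *m D != 0.
  by rewrite hD; apply: contraTneq fb => ->; rewrite /row_free mxrank0.
exists h; split => //.
have sub : (col_mx h e <= E)%MS.
  rewrite col_mx_sub scalemx_sub ?row_sub //=.
  by apply/row_subP => j; apply: (FL (row j e)); exact: row_sub.
have ff := frame_free eD fe b0.
have eqE : (col_mx h e :=: E)%MS.
  apply/eqmxP; rewrite sub /=; have := mxrank_leqif_sup sub => /leqifP.
  case: ifP => // _; move: ff fE; rewrite /row_free => /eqP rh /eqP rE.
  by rewrite rE; rewrite rh ltnn.
by apply/seteqP; split => u /=; rewrite /rowspace /= eqE.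
Qed.

End PointwiseResidue.

Lemma mul_col_mxEd (R : pzSemiRingType) d d' k l (h : 'M[R]_(d, k)) (e : 'M[R]_(d', k))
    (B : 'M[R]_(k, l)) i j : (col_mx h e *m B) (rshift d i) j = (e *m B) i j.
Proof. by rewrite mul_col_mx col_mxEd. Qed.

Lemma mul_col_mxEu (R : pzSemiRingType) d d' k l (h : 'M[R]_(d, k)) (e : 'M[R]_(d', k))
    (B : 'M[R]_(k, l)) i j : (col_mx h e *m B) (lshift d' i) j = (h *m B) i j.
Proof. by rewrite mul_col_mx col_mxEu. Qed.

(** * The Poincare residue and the phases of a fibered Lagrangian *)

Section ResidueData.
Variables (R : realType) (n : nat) (Y : charted R (n.+1 + n.+1)).
Variables (om : Y -> 'M[R]_(n.+1 + n.+1)) (Om : Y -> R[i]) (v : Y -> plane R).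
Hypothesis Y_kahler : kahler om.
Hypothesis Om_volume : holo_volume_form Om.
Hypothesis v_holo : holo_function v.

Let aY := kahler_atlas Y_kahler.

(** Expansion along the last column, whose only possibly nonzero entry is in row 0 and column n,
    whence the sign. *)
Lemma expand_det_last (M : 'M[R[i]]_(1 + n)) (c : R[i]) :
  (forall i : 'I_(1 + n), M i ord_max = if i == ord0 then c else 0) ->
  \det M = (-1) ^+ n * c * \det (\matrix_(i < n, j < n) M (rshift 1 i) (widen_ord (leqnSn n) j)).
Proof.
move=> Mc; rewrite (expand_det_col M (ord_max : 'I_(1 + n))) (bigD1 (ord0 : 'I_(1 + n))) //=.
rewrite big1 ?addr0 => [|i i0]; last by rewrite Mc (negbTE i0) mul0r.
rewrite Mc eqxx /cofactor mulrCA mulrA; congr (_ * \det _).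
apply/matrixP => i j; rewrite !mxE; congr (M _ _); apply: val_inj => //=.
by rewrite /bump leqNgt ltn_ord.
Qed.

(** A nonzero value on a single [e0] excludes the default of [xget], so coordinates with last
    coordinate v exist at q. In such coordinates the last column of dz is dv; for e inside ker dv
    this column vanishes except in the row of h, and [expand_det_last] gives the residue formula. *)
Lemma residue_dataP (q : Y) (e0 : 'M[R]_(n, n.+1 + n.+1)) :
  regv v (v q) -> residue Om v q e0 != 0 ->
  residue_data (om q) (Dmx v q) (Om q) (residue Om v q).
Proof.
move=> rq r0.
pose wit W (z : Y -> 'rV[R]_(n.+1 + n.+1)) a := let D := @Dmx R _ _ Y (model R (n.+1 + n.+1)) z q in
  [/\ W q, holo_coords W z,
        (forall q', W q' -> cmx (z q') ord0 ord_max
                            = cmx (v q' : 'rV[R]_(1 + 1)) ord0 ord0)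
     & (forall E : 'M[R]_(n.+1, n.+1 + n.+1), volf (Om q) E = a * \det (cmx (E *m D)))].
have [W [z [a hw]]] : exists W z a, wit W z a.
  apply: contrapT => H; move: r0; rewrite /residue;
      case: xgetP => [w _ [W [z [a [h1 h2 h3 h4 _]]]] _|_];
    last by rewrite eqxx.
  by apply: H; exists W, z, a.
split.
- exact: kahler_compatible.
- apply: (v_holo q).2; exists q => //; exact: (cdom_center aY).
- by apply: contra_notN rq => /eqP Dq; exists q.
- exact: Om_volume.1.
(* The coordinates found from [e0] serve for every e, so the selection is never the default; the
   coordinates actually selected for e may be different ones. *)
move=> h e eD; rewrite /residue; case: xgetP => [w _|Hno]; last first.
  case: hw => h1 h2 h3 h4; exfalso; apply: (Hno _); exists W, z, a; split;
      [done|done|done|done|reflexivity].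
move=> {W z a hw} [W [z [a [Wq [[zi [oW ozW sz szi zK]] _] zv volE ->]]]].
pose D := @Dmx R _ _ Y (model R (n.+1 + n.+1)) z q.
rewrite volE -/D.
have sv := holo_smooth_on aY v_holo.
have colE (s : 'I_(1 + 1)) (t : 'I_(n.+1 + n.+1)) :
    (forall q', W q' -> z q' ord0 t = (v q' : 'rV[R]_(1 + 1)) ord0 s) ->
    forall i, D i t = Dmx v q i s.
  move=> E i; have [W1 [[oW1 W1q] W1D W1W _ sz1]] := smooth_on_open aY oW sz Wq.
  have dz : differentiable (z \o cinv q) (cmap q q) by apply: (smooth_differentiable sz1); exists q.
  have dv : differentiable (v \o cinv q) (cmap q q).
    by apply: (smooth_differentiable (v_holo q).1); exists q => //; exact: (cdom_center aY).
  have nE : \forall x \near cmap q q, (z \o cinv q) x ord0 t = (v \o cinv q) x ord0 s.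
    have nW : \forall y \near q, W y by exact: (open_nbhs_nbhs (conj oW Wq)).
    have := near_chart (P := W) aY (cdom_center aY q) nW; apply: filterS => x Wx; exact: E.
  apply: etrans (jacobianE i t dz) _; apply: etrans _ (esym (jacobianE i s dv)).
  exact: (@near_eq_derive R _ _ _ _ _ (delta_mx ord0 i : 'rV[R]_(n.+1 + n.+1)) nE).
have cl : forall i, D i (lshift n.+1 ord_max) = Dmx v q i (lshift 1 ord0).
  by apply: colE => q' /zv; rewrite !mxE => -[].
have cr : forall i, D i (rshift n.+1 ord_max) = Dmx v q i (rshift 1 ord0).
  by apply: colE => q' /zv; rewrite !mxE => -[].
have lastE d (u : 'M[R]_(d, n.+1 + n.+1)) i : cmx (u *m D) i ord_max = cmx (u *m Dmx v q) i ord0.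
  rewrite [LHS]mxE [RHS]mxE; congr Complex; rewrite [LHS]mxE [RHS]mxE; apply: eq_bigr => l _.
    by congr (_ * _); exact: cl.
  by congr (_ * _); exact: cr.
rewrite (@expand_det_last _ (cmx (h *m Dmx v q) ord0 ord0)).
  rewrite mulrCA; congr (_ * (_ * \det _)); apply/matrixP => i j.
  rewrite [LHS]mxE [RHS]mxE [LHS]mxE [RHS]mxE.
  congr Complex; [exact: (mul_col_mxEd h e D i (lshift n.+1 (widen_ord (leqnSn n) j)))
                 |exact: (mul_col_mxEd h e D i (rshift n.+1 (widen_ord (leqnSn n) j)))].
move=> i; rewrite lastE -(fintype.splitK (i : 'I_(1 + n))).
case: (fintype.split _) => l /=.
  by rewrite (ord1 l) [LHS]mxE [RHS]mxE; congr Complex; exact: mul_col_mxEu.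
by rewrite [LHS]mxE; rewrite -[RHS]/(Complex (0 : R) 0); congr Complex;
  apply: etrans (mul_col_mxEd _ _ _ _ _) _; rewrite eD mxE.
Qed.

Variable L : set Y.
Hypothesis Lfib : fibered_lagrangian om v L.

Let Lag : lagrangian n.+1 om L. Proof. by case: Lfib. Qed.

(** Being nonzero rules out both the default and a vanishing value of the form. This is how gradings
    supply bases of tangent spaces. *)
Lemma squared_phase_neq0 m k (F : 'M[R]_(m, k) -> R[i]) (V : set 'rV[R]_k) :
  squared_phase F V != 0 -> exists e, [/\ row_free e, V = rowspace e & F e != 0].
Proof.
rewrite /squared_phase; case: xgetP => [w _ [e [fe Ve ->]] w0|_]; last by rewrite eqxx.
by exists e; split => //; apply: contraNneq w0 => ->; rewrite expr0n mul0r.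
Qed.

Lemma lagrangian_frame q : L q -> exists E : 'M[R]_(n.+1, n.+1 + n.+1),
  [/\ row_free E, tangent L q = rowspace E & E *m om q *m E^T = 0].
Proof.
move=> Lq; have [W0 [z [W0q [zi czi] SW]]] := Lag.1 q Lq.
have [fe tE] := tangent_frame aY czi SW W0q Lq.
move: (frame zi q (z q)) fe tE => E fe tE; exists E; split => //.
apply/matrixP => i j; rewrite [RHS]mxE.
have Ti l : tangent L q (row l E) by rewrite tE; exact: row_sub.
have := Lag.2 q Lq _ _ (Ti i) (Ti j); rewrite /Defs.form => <-.
rewrite -row_mul tr_row [LHS]mxE [RHS]mxE; apply: eq_bigr => l _.
by congr (_ * _); apply: esym; [exact: mxE | rewrite [LHS]mxE].
Qed.

(** The fibre phase gives e and the nonvanishing residue, the base phase gives the tangent line of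
    v(L), and [split_tangent] assembles them inside the tangent space of L. *)
Lemma fibered_split q :
  L q ->
  squared_phase (OmF Om v q) (tangent (L `&` fiber v (v q)) q) != 0 ->
  squared_phase (@OmC R (v q)) (tangent (v @` L) (v q)) != 0 ->
  residue_data (om q) (Dmx v q) (Om q) (residue Om v q) /\
  exists e h, [/\ row_free e /\ e *m Dmx v q = 0, h *m Dmx v q != 0,
    tangent (L `&` fiber v (v q)) q = rowspace e,
    tangent (v @` L) (v q) = rowspace (h *m Dmx v q)
  & tangent L q = rowspace (col_mx h e : 'M[R]_(1 + n, _))].
Proof.
move=> Lq /squared_phase_neq0 [e [fe Te r0]] /squared_phase_neq0 [b [fb Tb _]].
have rq : regv v (v q).
  have [_ [g [_ gr vL _ _]]] := Lfib; apply: gr; rewrite -vL; by exists q.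
have rd := residue_dataP rq r0; split => //.
have [E [fE TE iso]] := lagrangian_frame Lq.
have sv := holo_smooth_on aY v_holo.
have Tsub : tangent (L `&` fiber v (v q)) q `<=` tangent L q by apply: tangent_sub => ? [].
have Tv u : tangent (L `&` fiber v (v q)) q u -> u *m Dmx v q = 0.
  move=> Tu; apply/rowP => j; rewrite [RHS]mxE.
  have T0 : (setT : set Y) q by [].
  apply: (tangent_coord (a := (v q : 'rV[R]_(1 + 1)) ord0 j) aY openT T0 sv _ Tu).
  by move=> q' _ [_ vq']; rewrite vq'.
have TC u : tangent L q u -> tangent (v @` L) (v q) (u *m Dmx v q).
  exact: tangent_image.
have [eD [h [hb Th]]] := split_tangent rd TE Te Tb fE fe fb iso Tsub Tv TC.
exists e, h; split; rewrite ?hb //.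
by apply: contraTneq fb => ->; rewrite /row_free mxrank0.
Qed.

Lemma fibered_phase q :
  L q ->
  squared_phase (OmF Om v q) (tangent (L `&` fiber v (v q)) q) != 0 ->
  squared_phase (@OmC R (v q)) (tangent (v @` L) (v q)) != 0 ->
  squared_phase (OmY Om q) (tangent L q) =
    squared_phase (OmF Om v q) (tangent (L `&` fiber v (v q)) q) *
    squared_phase (@OmC R (v q)) (tangent (v @` L) (v q)).
Proof.
move=> Lq p1 p2; have [rd [e [h [[fe eD] hD TF TC TL]]]] := fibered_split Lq p1 p2.
rewrite TF TC TL; apply: etrans (total_phase rd eD fe hD) _.
by congr (_ * _); [exact: (esym (residue_phase rd eD fe)) | exact: (esym (base_phase hD))].
Qed.

(** The value at p is recorded because the degree compares gradings there; it fixes the integer left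
    free by the phase. *)
Lemma fibered_grading (aF : Y -> R) (aC : plane R -> R) p : L p ->
  grading (OmF Om v) (L `&` fiber v (v p)) aF -> grading (@OmC R) (v @` L) aC ->
  exists a, grading (OmY Om) L a /\ a p = aF p + aC (v p).
Proof.
move=> Lp [sF hF] [sC hC].
have pi0 : (2 * pi : R) != 0 by rewrite mulf_neq0 // gt_eqF // pi_gt0.
(* Only the fibre over v p is involved, so the base grading enters as the constant aC (v p). *)
pose l0 q := 2 * pi * (aF q + aC (v p)).
have cl0 : cont_on (L `&` fiber v (v p)) l0.
  have cF := smooth_on_cont_on aY (@atlas_line R) sF.
  apply: (cont_on_comp (B := setT) (g := fun x : R => 2 * pi * (x + aC (v p))) cF) => //.
  apply: continuous_cont_on => x _; apply: continuousM; first exact: cst_continuous.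
  by apply: continuousD; [exact: cvg_id | exact: cst_continuous].
have hl0 q : (L `&` fiber v (v p)) q ->
    cis (l0 q) = squared_phase (volf (Om q)) (tangent L q).
  move=> Fq; have [Lq vq] := Fq; rewrite /l0 mulrDr cisD (hF q Fq).
  have vLp : (v @` L) (v p) by exists p.
  rewrite (hC _ vLp).
  have p1 : squared_phase (OmF Om v q) (tangent (L `&` fiber v (v q)) q) != 0.
    by rewrite vq -(hF q Fq) cis_neq0.
  have p2 : squared_phase (@OmC R (v q)) (tangent (v @` L) (v q)) != 0.
    by rewrite vq -(hC _ vLp) cis_neq0.
  by have := fibered_phase Lq p1 p2; rewrite vq => <-.
have [cRe cIm] := lagrangian_phase_continuous Y_kahler Om_volume Lag.
have w1 := lagrangian_phase_norm Y_kahler Om_volume Lag.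
have [l [cl hl lp]] := lift_from_fiber aY v_holo Lfib Lp w1 cRe cIm cl0 hl0.
exists (fun q => l q / (2 * pi)); split;
    first exact: (grading_of_lift Y_kahler Om_volume Lag cl hl).
by rewrite lp /l0 mulrC mulKf.
Qed.

End ResidueData.

(** * Degrees *)

Section ComplexContinuity.
Variables (R : realType) (T : topologicalType) (u : T).
Implicit Types f g : T -> R[i].

Definition ccont f : Prop := {for u, continuous (fun x => complex.Re (f x))} /\
  {for u, continuous (fun x => complex.Im (f x))}.

Lemma ccont_cst (a : R[i]) : ccont (fun=> a).
Proof. by split; exact: cst_continuous. Qed.

Lemma ccontD f g : ccont f -> ccont g -> ccont (fun x => f x + g x).
Proof.
move=> [f1 f2] [g1 g2]; split.
  have -> : (fun x => complex.Re (f x + g x)) = (fun x => complex.Re (f x) + complex.Re (g x)).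
    by apply/funext => x; rewrite raddfD.
  exact: continuousD.
have -> : (fun x => complex.Im (f x + g x)) = (fun x => complex.Im (f x) + complex.Im (g x)).
  by apply/funext => x; rewrite raddfD.
exact: continuousD.
Qed.

Lemma ccontM f g : ccont f -> ccont g -> ccont (fun x => f x * g x).
Proof.
move=> [f1 f2] [g1 g2]; split.
  have -> : (fun x => complex.Re (f x * g x)) =
      (fun x => complex.Re (f x) * complex.Re (g x) - complex.Im (f x) * complex.Im (g x)).
    by apply/funext => x; case: (f x) (g x) => a b [c d].
  by apply: continuousB; exact: continuousM.
have -> : (fun x => complex.Im (f x * g x)) =
    (fun x => complex.Re (f x) * complex.Im (g x) + complex.Im (f x) * complex.Re (g x)).
  by apply/funext => x; case: (f x) (g x) => a b [c d].
by apply: continuousD; exact: continuousM.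
Qed.

Lemma ccont_sum (I : Type) (r : seq I) (F : I -> T -> R[i]) :
  (forall i, ccont (F i)) -> ccont (fun x => \sum_(i <- r) F i x).
Proof.
move=> hF; elim: r => [|i r IH].
  have -> : (fun x => \sum_(i <- [::]) F i x) = (fun=> 0).
    by apply/funext => x; rewrite big_nil.
  exact: ccont_cst.
have -> : (fun x => \sum_(j <- i :: r) F j x) = (fun x => F i x + \sum_(j <- r) F j x).
  by apply/funext => x; rewrite big_cons.
exact: ccontD.
Qed.

Lemma ccont_prod (I : Type) (r : seq I) (F : I -> T -> R[i]) :
  (forall i, ccont (F i)) -> ccont (fun x => \prod_(i <- r) F i x).
Proof.
move=> hF; elim: r => [|i r IH].
  have -> : (fun x => \prod_(i <- [::]) F i x) = (fun=> 1).
    by apply/funext => x; rewrite big_nil.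
  exact: ccont_cst.
have -> : (fun x => \prod_(j <- i :: r) F j x) = (fun x => F i x * \prod_(j <- r) F j x).
  by apply/funext => x; rewrite big_cons.
exact: ccontM.
Qed.

Lemma ccont_volf m (a : R[i]) (M : T -> 'M[R]_(m, m + m)) :
  (forall i j, {for u, continuous (fun x => M x i j)}) -> ccont (fun x => volf a (M x)).
Proof.
move=> cM; apply: ccontM; first exact: ccont_cst.
rewrite /determinant; apply: ccont_sum => s; apply: ccontM; first exact: ccont_cst.
apply: ccont_prod => i.
suff cmxc j : ccont (fun x => cmx (M x) i j) by exact: cmxc.
have -> : (fun x => cmx (M x) i j) = (fun x => Complex (M x i (lshift m j)) (M x i (rshift m j))).
  by apply/funext => x; rewrite mxE.
by split; exact: cM.
Qed.

End ComplexContinuity.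

(** * Symplectic frames, short paths and lifts of their phases *)

Section SymplecticFrames.
Variables (R : realType) (d k : nat) (om : 'M[R]_k).

Definition symplectic_frame (B1 B2 : 'M[R]_(d, k)) : Prop :=
  [/\ B1 *m om *m B1^T = 0, B1 *m om *m B2^T = 1%:M,
      B2 *m om *m B1^T = - 1%:M & B2 *m om *m B2^T = 0].

Lemma symplectic_frameP (B1 B2 : 'M[R]_(d, k)) :
  col_mx B1 B2 *m om *m (col_mx B1 B2)^T = omega_std R d <-> symplectic_frame B1 B2.
Proof.
rewrite tr_col_mx mul_col_mx mul_col_row /omega_std; split.
  by move=> /eq_block_mx [h1 h2 h3 h4].
by move=> [-> -> -> ->].
Qed.

Lemma row_space_image (d' : nat) (B : 'M[R]_(d', k)) (A : 'M[R]_(d, d')) :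
  [set (x *m A) *m B | x in [set: 'rV[R]_d]] = rowspace (A *m B).
Proof.
apply/seteqP; split => [_ [x _ <-]|u /submxP [x ->]].
  by rewrite /rowspace /= -mulmxA submxMl.
by exists x => //; rewrite mulmxA.
Qed.

Lemma frame_left (B1 B2 : 'M[R]_(d, k)) :
  [set row_mx x 0 *m col_mx B1 B2 | x in [set: 'rV[R]_d]] = rowspace B1.
Proof.
rewrite -[in RHS](mul1mx B1) -row_space_image; apply: eq_imagel => x _.
by rewrite mul_row_col mul0mx addr0 mulmx1.
Qed.

Lemma frame_right (B1 B2 : 'M[R]_(d, k)) :
  [set row_mx 0 x *m col_mx B1 B2 | x in [set: 'rV[R]_d]] = rowspace B2.
Proof.
rewrite -[in RHS](mul1mx B2) -row_space_image; apply: eq_imagel => x _.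
by rewrite mul_row_col mul0mx add0r mulmx1.
Qed.

Definition short_path (B1 B2 : 'M[R]_(d, k)) (t : R) : 'M[R]_(d, k) :=
  cos (pi * t / 2) *: B1 - sin (pi * t / 2) *: B2.

Lemma short_pathE (B1 B2 : 'M[R]_(d, k)) t :
  [set short_rot t x *m col_mx B1 B2 | x in [set: 'rV[R]_d]] = rowspace (short_path B1 B2 t).
Proof.
rewrite -[in RHS](mul1mx (short_path _ _ _)) -row_space_image; apply: eq_imagel => x _.
by rewrite /short_rot /short_path mul_row_col mulmx1 mulmxBr -!scalemxAl -!scalemxAr scaleNr.
Qed.

Lemma short_path0 (B1 B2 : 'M[R]_(d, k)) : short_path B1 B2 0 = B1.
Proof. by rewrite /short_path mulr0 mul0r cos0 sin0 scale1r scale0r subr0. Qed.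

Lemma short_path1 (B1 B2 : 'M[R]_(d, k)) : short_path B1 B2 1 = - B2.
Proof. by rewrite /short_path mulr1 cos_pihalf sin_pihalf scale0r scale1r sub0r. Qed.

Lemma symplectic_frame_free (B1 B2 : 'M[R]_(d, k)) (x y : 'rV[R]_d) :
  symplectic_frame B1 B2 -> x *m B1 + y *m B2 = 0 -> x = 0 /\ y = 0.
Proof.
move=> [h1 h2 h3 h4] xy; split.
  have := congr1 (fun u => u *m om *m B2^T) xy.
  by rewrite !mulmxDl -!(mulmxA x) -!(mulmxA y) h2 h4 mulmx1 mulmx0 addr0 !mul0mx.
have := congr1 (fun u => u *m om *m B1^T) xy.
rewrite !mulmxDl -!(mulmxA x) -!(mulmxA y) h1 h3 mulmx0 add0r !mul0mx.
by rewrite mulmxN mulmx1 => /eqP; rewrite oppr_eq0 => /eqP.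
Qed.

(* The case S = 1 is the canonical short path; a change of symplectic frame replaces 1 by a
   positive definite S. *)
Lemma short_path_lagrangian (B1 B2 : 'M[R]_(d, k)) (S : 'M[R]_d) t :
  symplectic_frame B1 B2 -> S^T = S -> S \in unitmx ->
  let e := short_path B1 (S *m B2) t in row_free e /\ e *m om *m e^T = 0.
Proof.
move=> sf ST Su e; split.
  apply: row_free_ker => x; rewrite /e /short_path mulmxBr -!scalemxAr mulmxA.
  rewrite !scalemxAl -mulNmx => /(symplectic_frame_free sf) [x1 x2].
  have cs := cos2Dsin2 (pi * t / 2); apply/eqP; apply: contraT => x0.
  move: x1 => /eqP; rewrite scaler_eq0 (negbTE x0) orbF => /eqP c0.
  move: x2 => /eqP; rewrite oppr_eq0 -?scalemxAl scaler_eq0 => /orP [/eqP s0|/eqP xS].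
    by move: cs; rewrite c0 s0 expr0n /= addr0 => /eqP; rewrite eq_sym oner_eq0.
  by rewrite -(mulmxK Su x) xS mul0mx eqxx in x0.
have [h1 h2 h3 h4] := sf; rewrite /e /short_path.
set c := cos _; set r := sin _.
have -> : (c *: B1 - r *: (S *m B2))^T = c *: B1^T - r *: (B2^T *m S).
  by rewrite linearB /= !linearZ /= trmx_mul ST.
have -> : (c *: B1 - r *: (S *m B2)) *m om *m (c *: B1^T - r *: (B2^T *m S)) =
    (c * c) *: (B1 *m om *m B1^T) - (c * r) *: (B1 *m om *m B2^T *m S)
    - (r * c) *: (S *m (B2 *m om *m B1^T)) + (r * r) *: (S *m (B2 *m om *m B2^T) *m S).
  rewrite !mulmxBl !mulmxBr -!scalemxAl -!scalemxAr !scalerA !mulmxA.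
  by rewrite opprB addrA -!addrA; congr (_ + (_ + _)); rewrite addrC.
rewrite h1 h2 h3 h4 !(mulmx0, mul0mx, scaler0) mul1mx mulmxN mulmx1 scalerN opprK.
by rewrite sub0r addr0 (mulrC r) addNr.
Qed.

End SymplecticFrames.
Section SymplecticFrameExistence.
Variables (R : realType) (m d : nat) (om : 'M[R]_(m + m)).

(** The pairing G of e0 with e1 is nondegenerate: if x G = 0, then u = x e0 is orthogonal to T, in
    particular to u J, against positivity. The basis of the span of e1 dual to e0 is then obtained
    from the transposed inverse of G. *)
Lemma symplectic_frame_exists (T : set 'rV[R]_(m + m)) (e0 e1 : 'M[R]_(d, m + m)) :
  compatible om -> (forall u, T u -> T (u *m Jmx R m)) ->
  (forall u, T u <-> exists x y, u = x *m e0 + y *m e1) ->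
  row_free e0 -> e0 *m om *m e0^T = 0 -> e1 *m om *m e1^T = 0 ->
  exists B2, [/\ symplectic_frame om e0 B2, T = rowspace (col_mx e0 B2)
    & rowspace B2 = rowspace e1].
Proof.
move=> com TJ Te f0 i0 i1; have [anti _ pos] := com.
pose G := e0 *m om *m e1^T.
have Gu : G \in unitmx.
  rewrite unitmxE unitfE; apply: det0_ker => x xG.
  have Tw : T (x *m e0) by apply/Te; exists x, 0; rewrite mul0mx addr0.
  apply: (row_free_inj0 f0); apply/eqP; apply: contraT => /pos.
  have /Te [x' [y' ->]] := TJ _ Tw.
  rewrite /Defs.form linearD /= !trmx_mul mulmxDr -!(mulmxA x) !(mulmxA (e0 *m om)) i0 mul0mx
      mulmx0 add0r.
  by rewrite mulmxA xG mul0mx mxE ltxx.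
pose N := (invmx G)^T; have Nu : N \in unitmx by rewrite unitmx_tr unitmx_inv.
pose B2 := N *m e1; exists B2.
have RB : (B2 :=: e1)%MS by apply: eqmxMfull; rewrite row_full_unit.
have h2 : e0 *m om *m B2^T = 1%:M by rewrite trmx_mul trmxK mulmxA mulmxV.
split.
- split => //.
    have -> : B2 *m om *m e0^T = - (e0 *m om *m B2^T)^T.
      by rewrite [(_ *m B2^T)^T]trmx_mul trmxK trmx_mul anti mulNmx mulmxN opprK mulmxA.
    by rewrite h2 trmx1.
  by rewrite /B2 trmx_mul mulmxA -!(mulmxA N) i1 mul0mx mulmx0.
- apply/seteqP; split => u /=; rewrite /rowspace /=.
    move=> /Te [x [y ->]]; rewrite addmx_sub // mulmx_sub //.
      apply: submx_trans (addsmxSl e0 B2) _. by rewrite addsmxE.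
    have e1B : (e1 <= B2)%MS by rewrite RB.
    by apply: submx_trans e1B _; apply: submx_trans (addsmxSr e0 B2) _; rewrite addsmxE.
  rewrite -addsmxE => /sub_addsmxP [[x y] /= ->]; apply/Te.
  by exists x, (y *m N); rewrite mulmxA.
- by apply/seteqP; split => u; rewrite /rowspace /= RB.
Qed.

End SymplecticFrameExistence.

Section Degree.
Variables (R : realType) (m k : nat).
Implicit Types (T V : set 'rV[R]_k) (om : 'M[R]_k) (Om : 'M[R]_(m, k) -> R[i]).

(** The relation from which [degree] selects, with the symplectic basis cut into its two Lagrangian
    halves. *)
Definition is_degree T om Om (V0 V1 : set 'rV[R]_k) (a0 a1 d : R) : Prop :=
  exists (B1 B2 : 'M[R]_(m, k)) (l : R -> R),
    [/\ T = rowspace (col_mx B1 B2) /\ symplectic_frame om B1 B2,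
        V0 = rowspace B1 /\ V1 = rowspace B2,
        {within `[0, 1], continuous l} /\ l 0 = a0,
        (forall t, 0 <= t <= 1 ->
            cis (2 * pi * l t) = squared_phase Om (rowspace (short_path B1 B2 t)))
      & d = (a1 - a0) - (l 1 - l 0)].

Lemma degreeP T om Om (V0 V1 : set 'rV[R]_k) (a0 a1 d : R) :
  is_degree T om Om V0 V1 a0 a1 d ->
  is_degree T om Om V0 V1 a0 a1 (degree T om Om V0 V1 a0 a1).
Proof.
move=> dP; rewrite /degree; case: xgetP => [y _|/(_ d) []].
  move=> [B [l [[TB sf] [-> ->] lc hl ->]]].
  move: TB sf hl; rewrite -[B]vsubmxK => TB /symplectic_frameP sf hl.
  exists (usubmx B), (dsubmx B), l; split=> //.
    by rewrite frame_left frame_right.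
  by move=> t t01; rewrite hl // short_pathE.
have [B1 [B2 [l [[TB sf] [-> ->] lc hl ->]]]] := dP.
exists (col_mx B1 B2), l; split => //.
- by split => //; apply/symplectic_frameP.
- by rewrite frame_left frame_right.
- by move=> t t01; rewrite short_pathE hl.
Qed.

(** Path lifting obtained from [homotopy_lift]: the second factor R is a dummy parameter, set to 0
    at the end, and [clip] extends the path beyond [0, 1]. *)
Lemma short_path_lift Om (B1 B2 : 'M[R]_(m, k)) (f : R -> R[i]) (a0 : R) :
  (forall t, 0 <= t <= 1 -> squared_phase Om (rowspace (short_path B1 B2 t)) = phase (f t)) ->
  (forall t, 0 <= t <= 1 -> f t != 0) -> (forall t, ccont t f) ->
  cis (2 * pi * a0) = squared_phase Om (rowspace B1) ->
  exists l : R -> R, [/\ {within `[0, 1], continuous l}, l 0 = a0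
    & forall t, 0 <= t <= 1 ->
        cis (2 * pi * l t) = squared_phase Om (rowspace (short_path B1 B2 t))].
Proof.
move=> fE f0 cf h0.
have pi0 : (2 * pi : R) != 0 by rewrite mulf_neq0 // gt_eqF // pi_gt0.
have c01 (t : R) : 0 <= clip 0 1 t <= 1 by exact: clip_itv.
pose F (u : R * R) := phase (f (clip 0 1 u.1)).
have cF : continuous (fun u => complex.Re (F u)) /\ continuous (fun u => complex.Im (F u)).
  have H t : {for t, continuous (fun s => complex.Re (phase (f (clip 0 1 s))))} /\
             {for t, continuous (fun s => complex.Im (phase (f (clip 0 1 s))))}.
    have [cr ci] := cf (clip 0 1 t); apply: continuous_phase; last exact: f0.
      by apply: (@continuous_comp _ _ _ (clip 0 1) (fun s => complex.Re (f s))) cr;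
          exact: continuous_clip.
    by apply: (@continuous_comp _ _ _ (clip 0 1) (fun s => complex.Im (f s))) ci;
        exact: continuous_clip.
  split=> u; have [cr ci] := H u.1.
    by apply: (@continuous_comp _ _ _ fst (fun s => complex.Re (phase (f (clip 0 1 s))))) cr;
        exact: cvg_fst.
  by apply: (@continuous_comp _ _ _ fst (fun s => complex.Im (phase (f (clip 0 1 s))))) ci;
      exact: cvg_fst.
have F1 u : `|F u| = 1 by apply: phase_norm; exact: f0.
have c0 : continuous (fun _ : R => 2 * pi * a0) by move=> x; exact: cst_continuous.
have [|l [cl hl l0]] := homotopy_lift cF.1 cF.2 F1 c0.
  by move=> x; rewrite h0 /F /= clip_id ?lexx ?ler01 // -fE ?lexx ?ler01 // short_path0.
exists (fun t => l (t, 0) / (2 * pi)); split.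
- apply: continuous_subspaceT => t.
  suff ct : {for t, continuous (fun t : R => l (t, 0))} by apply: (continuousM ct);
      exact: cst_continuous.
  apply: (@continuous_comp _ _ _ (fun t : R => (t, 0 : R)) l); last exact: cl.
  by apply: (@cvg_pair _ _ _ (nbhs t) (nbhs t) (nbhs (0 : R))) => //; exact: cst_continuous.
- by rewrite l0 mulrC mulKf.
- by move=> t t01; rewrite mulrC mulfVK // hl /F /= clip_id // fE.
Qed.

End Degree.

Lemma within_cont_on (S T : topologicalType) (A : set S) (f : S -> T) :
  {within A, continuous f} -> cont_on A f.
Proof.
by move=> /subspace_continuousP cf x Ax N nN; have := cf x Ax N nN; exact.
Qed.

Lemma continuous_scale (R : realType) (T : topologicalType) (f : T -> R) (c : R) x :
  {for x, continuous f} -> {for x, continuous (fun t => c * f t)}.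
Proof. by move=> cf; apply: continuousM => //; exact: cst_continuous. Qed.

(** * Independence of the degree from the adapted basis *)

Section DegreeUnique.
Variables (R : realType) (m : nat) (om : 'M[R]_(m + m)) (a : R[i]).
Hypothesis com : compatible om.
Hypothesis a_neq0 : a != 0.

(** Segment from the identity to Q^T Q, through positive definite matrices when Q is invertible and
    0 <= s <= 1. *)
Let interpolate (Q : 'M[R]_m) (s : R) : 'M[R]_m := (1 - s)%:M + s *: (Q^T *m Q).

Let interpolate_sym Q s : (interpolate Q s)^T = interpolate Q s.
Proof. by rewrite /interpolate linearD /= linearZ /= tr_scalar_mx trmx_mul trmxK. Qed.

Let sqr_row_ge0 d (x : 'rV[R]_d) : 0 <= (x *m x^T) ord0 ord0.
Proof. by rewrite mxE sumr_ge0 // => i _; rewrite mxE -expr2 sqr_ge0. Qed.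

Let sqr_row_eq0 d (x : 'rV[R]_d) : (x *m x^T) ord0 ord0 = 0 -> x = 0.
Proof.
rewrite mxE => /eqP; rewrite psumr_eq0 => [/allP x0|i _]; last by rewrite mxE -expr2 sqr_ge0.
apply/rowP => i; have := x0 i (mem_index_enum _).
by rewrite !mxE -expr2 sqrf_eq0 => /eqP.
Qed.

Let interpolate_unit Q s : Q \in unitmx -> 0 <= s <= 1 -> interpolate Q s \in unitmx.
Proof.
move=> Qu /andP[s0 s1]; rewrite unitmxE unitfE; apply: det0_ker => x xS.
have /eqP : (1 - s) * (x *m x^T) ord0 ord0 + s * ((x *m Q^T) *m (x *m Q^T)^T) ord0 ord0 = 0.
  have := congr1 (fun u : 'rV_m => (u *m x^T) ord0 ord0) xS.
  rewrite mul0mx [RHS]mxE => <-.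
  rewrite /interpolate mulmxDr mul_mx_scalar -scalemxAr mulmxDl -!scalemxAl.
  rewrite trmx_mul trmxK !mulmxA [RHS]mxE.
  by congr (_ + _); rewrite [RHS]mxE.
rewrite paddr_eq0 ?mulr_ge0 ?subr_ge0 ?sqr_row_ge0 // !mulf_eq0 =>
    /andP[/orP[|/eqP/sqr_row_eq0 //]].
rewrite subr_eq0 => /eqP <-; rewrite oner_eq0 /= => /eqP/sqr_row_eq0 xQ.
by rewrite -(mulmxK (_ : Q^T \in unitmx) x) ?unitmx_tr // xQ mul0mx.
Qed.

(** With C1 = P B1, C2 = Q B2 and P Q^T = 1, one has C2 = P Q^T Q B2, so the second short path spans
    the same spaces as the deformation at s = 1. The lift is transported in s, and its increment
    over t is preserved. *)
Lemma degree_unique (V0 V1 : set 'rV[R]_(m + m)) (a0 a1 d d' : R) :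
  is_degree setT om (volf a) V0 V1 a0 a1 d -> is_degree setT om (volf a) V0 V1 a0 a1 d' -> d = d'.
Proof.
move=> [B1 [B2 [l [[_ sf] [V0B V1B] [lc l0] hl ->]]]].
move=> [C1 [C2 [l' [[_ sf'] [V0C V1C] [lc' l'0] hl' ->]]]].
have /submxP [P PE] : (C1 <= B1)%MS.
  by apply/row_subP => i; suff : rowspace B1 (row i C1) by []; rewrite -V0B V0C; exact: row_sub.
have /submxP [Q QE] : (C2 <= B2)%MS.
  by apply/row_subP => i; suff : rowspace B2 (row i C2) by []; rewrite -V1B V1C; exact: row_sub.
have PQ : P *m Q^T = 1%:M.
  have [_ <- _ _] := sf'; have [_ h2 _ _] := sf.
  by rewrite PE QE trmx_mul mulmxA -!(mulmxA P) h2 mul1mx.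
have QP : Q^T *m P = 1%:M by exact: mulmx1C.
have Qu : Q \in unitmx by rewrite -unitmx_tr; case: (mulmx1_unit QP).
have Pu : P \in unitmx by case: (mulmx1_unit PQ).
pose e s t := short_path B1 (interpolate Q s *m B2) t.
pose F (u : R * R) := phase (volf a (e (clip 0 1 u.1) (clip 0 1 u.2))).
have c01 (t : R) : 0 <= clip 0 1 t <= 1 by exact: clip_itv.
have g0 s t : 0 <= s <= 1 -> volf a (e s t) != 0.
  move=> s01; have [fe iso] :=
      short_path_lagrangian t sf (interpolate_sym Q s) (interpolate_unit Qu s01).
  by rewrite mulf_neq0 // (det_cmx_neq0 com).
have cF : continuous (fun u => complex.Re (F u)) /\ continuous (fun u => complex.Im (F u)).
  have cfst : continuous (fun u : R * R => clip 0 1 u.1).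
    move=> u; apply: (@continuous_comp _ _ _ fst (clip 0 1)); first exact: cvg_fst.
    exact: continuous_clip.
  have csnd : continuous (fun u : R * R => clip 0 1 u.2).
    move=> u; apply: (@continuous_comp _ _ _ snd (clip 0 1)); first exact: cvg_snd.
    exact: continuous_clip.
  have H u : ccont u (fun u : R * R => volf a (e (clip 0 1 u.1) (clip 0 1 u.2))).
    apply: ccont_volf => i j.
    have -> : (fun x : R * R => e (clip 0 1 x.1) (clip 0 1 x.2) i j) = (fun x =>
        cos (pi * clip 0 1 x.2 / 2) * B1 i j - sin (pi * clip 0 1 x.2 / 2) *
        ((1 - clip 0 1 x.1) * B2 i j + clip 0 1 x.1 * (Q^T *m Q *m B2) i j)).
      apply/funext => x; rewrite /e /short_path /interpolate mulmxDl mul_scalar_mx -scalemxAl.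
      by rewrite !mxE.
    have ct : {for u, continuous (fun x : R * R => pi * clip 0 1 x.2 / 2)}.
      by apply: continuousM; [apply: continuousM;
          [exact: cst_continuous|exact: csnd]|exact: cst_continuous].
    have c1 : {for u, continuous (fun x : R * R => cos (pi * clip 0 1 x.2 / 2))}.
      by apply: (@continuous_comp _ _ _ _ cos _ ct); exact: continuous_cos.
    have c2 : {for u, continuous (fun x : R * R => sin (pi * clip 0 1 x.2 / 2))}.
      by apply: (@continuous_comp _ _ _ _ sin _ ct); exact: continuous_sin.
    apply: continuousB; first by apply: continuousM; [exact: c1 | exact: cst_continuous].
    apply: continuousM; first exact: c2.
    apply: continuousD; apply: continuousM; try exact: cst_continuous; last exact: cfst.
    by apply: continuousB; [exact: cst_continuous | exact: cfst].
  by split=> u; have [cr ci] := H u; have [] := continuous_phase cr ci (g0 _ _ (c01 u.1)).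
have F1 u : `|F u| = 1 by apply: phase_norm; exact: g0.
(* The homotopy time is s and the space variable is t, so the initial data is the first lift along
   its whole path. *)
pose th0 t := 2 * pi * l (clip 0 1 t).
have cth0 : continuous th0.
  move=> t; apply: continuous_scale.
  have lcl : cont_on [set: R] (l \o clip 0 1).
    apply: (@cont_on_comp R R R setT `[0, 1]%classic (clip 0 1) l).
    - by apply: continuous_cont_on => s _; exact: continuous_clip.
    - exact: within_cont_on.
    - by move=> s _; rewrite /= in_itv /=; exact: c01.
  move=> N nN; have H := lcl t Logic.I N nN.
  by suff : \forall s \near t, N (l (clip 0 1 s)) by []; apply: filterS H => s; apply.
have volE (P' : 'M[R]_m) X : P' \in unitmx -> phase (volf a (P' *m X)) = phase (volf a X).
  by move=> P'u; rewrite volfM phaseM phase_real ?mul1r // -unitfE -unitmxE.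
have spE (X : 'M[R]_(m, m + m)) : row_free X ->
    squared_phase (volf a) (rowspace X) = phase (volf a X).
  by move=> fX; apply: squared_phaseE => // P'; exact: volfM.
have i0 : interpolate Q 0 = 1%:M by rewrite /interpolate subr0 scale0r addr0.
have i1 : interpolate Q 1 = Q^T *m Q by rewrite /interpolate subrr raddf0 add0r scale1r.
have e0E t : e 0 t = short_path B1 B2 t by rewrite /e i0 mul1mx.
have C2E : C2 = P *m (Q^T *m Q *m B2) by rewrite QE !mulmxA PQ mul1mx.
have e1E t : short_path C1 C2 t = P *m e 1 t.
  by rewrite /e i1 /short_path PE C2E mulmxBr -!scalemxAr.
have s00 : 0 <= (0 : R) <= 1 by rewrite lexx ler01.
have s11 : 0 <= (1 : R) <= 1 by rewrite lexx ler01.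
have free s t : 0 <= s <= 1 -> row_free (e s t).
  by move=> s01; have [] :=
      short_path_lagrangian t sf (interpolate_sym Q s) (interpolate_unit Qu s01).
have h0 t : cis (th0 t) = F (0, t).
  rewrite /th0 /F /= (clip_id s00) e0E hl // spE //.
  by rewrite -e0E; exact: free.
have [th [cth hth th_0]] := homotopy_lift cF.1 cF.2 F1 cth0 h0.
have cths t : {within `[0, 1], continuous (fun s => th (s, t))}.
  apply: continuous_subspaceT => s.
  apply: (@continuous_comp _ _ _ (fun s : R => (s, t)) th); last exact: cth.
  by apply: (@cvg_pair _ _ _ (nbhs s) (nbhs s) (nbhs t)) => //; exact: cst_continuous.
have ctht s : {within `[0, 1], continuous (fun t => th (s, t))}.
  apply: continuous_subspaceT => t.
  apply: (@continuous_comp _ _ _ (fun t : R => (s, t)) th); last exact: cth.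
  by apply: (@cvg_pair _ _ _ (nbhs t) (nbhs s) (nbhs t)) => //; exact: cst_continuous.
have cc (c : R) : {within `[0, 1],
    continuous (fun _ : R => c)} by apply: continuous_subspaceT => t; exact: cst_continuous.
(* The phase is constant in s on the edges t = 0, where the frame is B1, and t = 1, where only the
   basis of the span of B2 changes; so the lift is constant there. *)
have end0 : th (1, 0) = th (0, 0).
  apply: (path_lift_unique (cths 0) (cc (th (0, 0))) _ s00) => // s s01.
  by rewrite !hth /F /= !(clip_id s00) (clip_id s01) /e !short_path0.
have end1 : th (1, 1) = th (0, 1).
  apply: (path_lift_unique (cths 1) (cc (th (0, 1))) _ s00) => // s s01.
  rewrite !hth /F /= !(clip_id s00) !(clip_id s11) (clip_id s01) /e !short_path1 i0 mul1mx.
  by rewrite -mulmxN volE //; exact: interpolate_unit.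
(* At s = 1 the second lift and the transported one lift the same phase, hence differ by a constant,
   which cancels in the increment. *)
pose c := th (1, 0) - 2 * pi * l' 0.
have cl'c : {within `[0, 1], continuous (fun t => 2 * pi * l' t + c)}.
  have ca : continuous (fun x : R => 2 * pi * x + c).
    move=> x; suff cx : {for x, continuous (fun x : R => 2 * pi * x)}.
      by apply: (continuousD cx); exact: cst_continuous.
    by apply: continuous_scale; exact: cvg_id.
  apply: cont_on_within;
      apply: (@cont_on_comp R R R `[0, 1]%classic setT l' (fun x => 2 * pi * x + c)) => //.
    exact: within_cont_on.
  by apply: continuous_cont_on => x _; exact: ca.
have h1 t : 0 <= t <= 1 -> cis (2 * pi * l' t) = cis (th (1, t)).
  move=> t01; rewrite hl' // e1E spE //; last first.
    by rewrite /row_free mxrankMfree ?free // -/(row_free P) row_free_unit.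
  rewrite (volE P (e 1 t) Pu) (hth (1, t)) /F.
  by rewrite [(1, t).1]/= [(1, t).2]/= (clip_id s11) (clip_id t01).
have cc1 : cis c = 1.
  apply: (mulfI (cis_neq0 (2 * pi * l' 0))); rewrite mulr1 -cisD /c addrC subrK.
  by rewrite h1.
have end2 : th (1, 1) = 2 * pi * l' 1 + c.
  apply: (path_lift_unique (ctht 1) cl'c _ s00) => //; last by rewrite /c addrC subrK.
  by move=> t t01; rewrite cisD cc1 mulr1 h1.
have pi0 : (2 * pi : R) != 0 by rewrite mulf_neq0 // gt_eqF // pi_gt0.
suff -> : l 1 - l 0 = l' 1 - l' 0 by [].
apply: (mulfI pi0); rewrite !mulrBr.
have -> : 2 * pi * l' 1 = th (1, 1) - c by rewrite end2 addrK.
rewrite end1 /c end0 !th_0 /th0 (clip_id s00) (clip_id s11); ring.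
Qed.

End DegreeUnique.

Section PlaneLinear.
Variable R : realType.

Lemma cmxZ d m (x : R) (A : 'M[R]_(d, m + m)) : cmx (x *: A) = (x%:C)%C *: cmx A.
Proof.
by apply/matrixP => i j; rewrite !mxE; apply/eqP; rewrite eq_complex /=;
  apply/andP; split; apply/eqP; ring.
Qed.

Lemma Jmx_tr m : (Jmx R m)^T = - Jmx R m.
Proof.
by rewrite /Jmx tr_block_mx !linear0 linearN /= !tr_scalar_mx opp_block_mx oppr0 opprK.
Qed.

Lemma Jmx_sqr m : Jmx R m *m (Jmx R m)^T = 1%:M.
Proof.
rewrite Jmx_tr mulmxN /Jmx mulmx_block !(mulmx0, mul0mx, add0r, addr0, mulmx1, mul1mx, mulmxN).
by rewrite opp_block_mx oppr0 opprK scalar_mx_block.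
Qed.

Lemma antisym_row k (om : 'M[R]_k) (u : 'rV[R]_k) : om^T = - om -> u *m om *m u^T = 0.
Proof.
move=> anti; set M := u *m om *m u^T.
have : M^T = - M by rewrite /M !trmx_mul trmxK anti mulNmx mulmxN mulmxA.
move: M => M /matrixP/(_ ord0 ord0); rewrite [LHS]mxE [RHS]mxE => h.
by apply/matrixP => i j; rewrite (ord1 i) (ord1 j) [RHS]mxE; lra.
Qed.

Lemma omega_std_compatible m : compatible (omega_std R m).
Proof.
have -> : omega_std R m = Jmx R m by [].
split; first exact: Jmx_tr.
  by rewrite -mulmxA Jmx_sqr mulmx1.
move=> u u0; rewrite /Defs.form trmx_mul mulmxA -[u *m _ *m _]mulmxA Jmx_sqr mulmx1 mxE.
have [i ui] : exists i, u ord0 i != 0.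
  apply: contrapT => H; move: u0 => /negP; apply; apply/eqP/rowP => i; rewrite mxE.
  by apply/eqP; apply: contraT => ui; exfalso; apply: H; exists i.
rewrite (bigD1 i) //= ltr_pwDl //; first by rewrite mxE -expr2 exprn_even_gt0.
by apply: sumr_ge0 => j _; rewrite mxE -expr2 sqr_ge0.
Qed.

(** The coefficients are the real and imaginary parts of the complex quotient of b by b0. *)
Lemma complex_line (b0 b : 'rV[R]_(1 + 1)) : b0 != 0 ->
  exists x y, b = x *: b0 + y *: (b0 *m Jmx R 1).
Proof.
move=> b00; pose c := cmx b ord0 ord0 / cmx b0 ord0 ord0.
exists (complex.Re c), (complex.Im c); apply/eqP; rewrite -subr_eq0; apply/eqP.
apply: cmx_eq0; rewrite opprD !cmxD -!scaleNr !cmxZ cmxJ.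
apply/matrixP => i j; rewrite (ord1 i) (ord1 j) [RHS]mxE.
have c0 : cmx b0 ord0 ord0 != 0.
  by apply: contraNneq b00 => e; apply/eqP/cmx_eq0/matrixP => s t; rewrite (ord1 s) (ord1 t) e mxE.
have cE : cmx b ord0 ord0 = c * cmx b0 ord0 ord0 by rewrite /c mulfVK.
move: cE; rewrite {1}(complexE c); clearbody c; move: (cmx b) (cmx b0) => B B0 cE.
by rewrite !mxE cE !rmorphN /=; ring.
Qed.

End PlaneLinear.

(** * Combining adapted bases of the fibre and of the base *)

Section FiberBase.
Variables (R : realType) (n : nat).
Local Notation k := (n.+1 + n.+1)%N.
Variables (om : 'M[R]_k) (D : 'M[R]_(k, 1 + 1)) (a : R[i]) (res : 'M[R]_(n, k) -> R[i]).
Hypothesis rd : residue_data om D a res.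

Let com := rd_compatible rd.

Lemma vert_J (u : 'rV[R]_k) : u *m D = 0 -> u *m Jmx R n.+1 *m D = 0.
Proof. by move=> uD; rewrite -mulmxA (rd_holo rd) mulmxA uD mul0mx. Qed.

Lemma om_J (u w : 'rV[R]_k) : u *m Jmx R n.+1 *m om *m w^T = - (u *m om *m (w *m Jmx R n.+1)^T).
Proof.
have [_ inv _] := com.
have Jom : Jmx R n.+1 *m om = om *m Jmx R n.+1.
  have := congr1 (mulmx^~ (Jmx R n.+1)) inv; rewrite -mulmxA => <-.
  have -> : (Jmx R n.+1)^T *m Jmx R n.+1 = 1%:M by apply: mulmx1C; exact: Jmx_sqr.
  by rewrite mulmx1.
by rewrite trmx_mul Jmx_tr mulNmx mulmxN opprK -(mulmxA u) Jom !mulmxA.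
Qed.

(** The fibre direction is J-stable, so u J is an admissible w and om (u, u J) = 0 contradicts
    positivity unless u = 0. *)
Lemma vert_orth_eq0 (u : 'rV[R]_k) : u *m D = 0 ->
  (forall w : 'rV[R]_k, w *m D = 0 -> u *m om *m w^T = 0) -> u = 0.
Proof.
move=> uD orth; have [_ _ pos] := com; apply/eqP; apply: contraT => /pos.
by rewrite /Defs.form orth ?mxE ?ltxx //; exact: vert_J.
Qed.

(* The complement of the fibre is a complex line on which dv is complex linear,
    so dv is conformal there. *)
Lemma horizontal_pos (H0 H1 : 'rV[R]_k) :
  (forall w : 'rV[R]_k, w *m D = 0 -> H0 *m om *m w^T = 0) ->
  (forall w : 'rV[R]_k, w *m D = 0 -> H1 *m om *m w^T = 0) ->
  H0 *m D *m omega_std R 1 *m (H1 *m D)^T = 1%:M ->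
  0 < (H0 *m om *m H1^T) ord0 ord0.
Proof.
move=> o0 o1 w01; have [anti _ pos] := com.
have b00 : H0 *m D != 0.
  apply: contra_eq_neq w01 => ->; rewrite !mul0mx; apply/eqP => /matrixP/(_ ord0 ord0).
  by rewrite !mxE eqxx => /eqP; rewrite eq_sym oner_eq0.
have [x [y bE]] := complex_line (H1 *m D) b00.
(* In the plane the pairing of H0 D with H1 D is y times a positive number, and it equals 1. *)
have y0 : 0 < y.
  have [_ _ pos1] := omega_std_compatible R 1.
  have := pos1 _ b00; rewrite /Defs.form => p1.
  have := w01; rewrite bE linearD /= !linearZ /= mulmxDr -!scalemxAr.
  have -> : H0 *m D *m omega_std R 1 *m (H0 *m D)^T = 0.
    by apply: antisym_row; have [] := omega_std_compatible R 1.
  rewrite scaler0 add0r => /matrixP/(_ ord0 ord0); rewrite [LHS]mxE [RHS]mxE eqxx => yp.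
  have : 0 < y * (H0 *m D *m omega_std R 1 *m (H0 *m D *m Jmx R 1)^T) ord0 ord0 by rewrite yp ltr01.
  by rewrite pmulr_lgt0.
(* This difference is killed by dv and orthogonal to the fibre, hence zero. *)
have N0 : H1 - x *: H0 - y *: (H0 *m Jmx R n.+1) = 0.
  apply: vert_orth_eq0.
    rewrite !mulmxBl -!scalemxAl bE -[H0 *m Jmx R n.+1 *m D]mulmxA (rd_holo rd) mulmxA.
    by rewrite addrAC addrK subrr.
  move=> w wD; rewrite !mulmxBl -!scalemxAl o0 // o1 // om_J o0 ?vert_J //.
  by rewrite oppr0 !scaler0 !subr0.
have -> : H1 = x *: H0 + y *: (H0 *m Jmx R n.+1).
  by apply/eqP; rewrite -subr_eq0 opprD addrA N0.
rewrite linearD /= !linearZ /= mulmxDr -!scalemxAr antisym_row // scaler0 add0r mxE mulr_gt0 //.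
by apply: pos; apply: contraNneq b00 => ->; rewrite mul0mx.
Qed.

Lemma rebase (h : 'rV[R]_k) (B : 'M[R]_(n, k)) (s : R) (x : 'rV[R]_n) : s != 0 ->
  rowspace (col_mx (s *: h + x *m B) B) = rowspace (col_mx h B).
Proof.
move=> s0; have -> : col_mx (s *: h + x *m B) B = block_mx s%:M x 0 1%:M *m col_mx h B.
  by rewrite mul_block_col !mul_scalar_mx mul0mx add0r scale1r.
have U : block_mx s%:M x 0 (1%:M : 'M[R]_n) \in unitmx.
  by rewrite unitmxE det_ublock det1 mulr1 det_scalar1 unitfE.
have E : (block_mx s%:M x 0 (1%:M : 'M[R]_n) *m col_mx h B :=: col_mx h B)%MS.
  by apply: eqmxMfull; rewrite row_full_unit.
by apply/seteqP; split => u; rewrite /rowspace /= E.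
Qed.

Lemma rowspace_eqmx d d' l (A : 'M[R]_(d, l)) (B : 'M[R]_(d', l)) :
  rowspace A = rowspace B -> (A :=: B)%MS.
Proof.
move=> AB; apply/eqmxP/andP; split; apply/row_subP => i.
  by have : rowspace A (row i A) by [exact: row_sub]; rewrite AB.
by have : rowspace B (row i B) by [exact: row_sub]; rewrite -AB.
Qed.

Lemma rebase_frame (h : 'rV[R]_k) (e B : 'M[R]_(n, k)) (b : 'rV[R]_(1 + 1)) :
  rowspace e = rowspace B -> rowspace (h *m D) = rowspace b -> b != 0 ->
  exists h', h' *m D = b /\ rowspace (col_mx h e) = rowspace (col_mx h' B).
Proof.
move=> eB hb b0; have : rowspace b b by rewrite /rowspace /=.
rewrite -hb => /submxP [s sE]; rewrite (mx11_scalar s) mul_scalar_mx in sE.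
set r := s ord0 ord0 in sE.
have r0 : r != 0 by apply: contraNneq b0 => r0; rewrite sE r0 scale0r.
exists (r *: h); split; first by rewrite -scalemxAl.
have := rebase h B 0 r0; rewrite mul0mx addr0 => ->.
have E := rowspace_eqmx eB.
have E2 : (col_mx h e :=: col_mx h B)%MS.
  apply: eqmx_trans (eqmx_sym (addsmxE _ _)) _; apply: eqmx_trans _ (addsmxE _ _).
  exact: adds_eqmx.
by apply/seteqP; split => u; rewrite /rowspace /= E2.
Qed.

Let vert0 : set 'rV[R]_k := [set u | u *m D = 0].

Lemma short_path_col (K0 K1 : 'rV[R]_k) (B1 B2 : 'M[R]_(n, k)) t :
  short_path (col_mx K0 B1) (col_mx K1 B2) t = col_mx (short_path K0 K1 t) (short_path B1 B2 t).
Proof. by rewrite /short_path !scale_col_mx opp_col_mx add_col_mx. Qed.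

Lemma symplectic_frame_col (K0 K1 : 'rV[R]_k) (B1 B2 : 'M[R]_(n, k)) :
  symplectic_frame om K0 K1 -> symplectic_frame om B1 B2 ->
  (forall i, K0 *m om *m (row i B1)^T = 0) -> (forall i, K0 *m om *m (row i B2)^T = 0) ->
  (forall i, K1 *m om *m (row i B1)^T = 0) -> (forall i, K1 *m om *m (row i B2)^T = 0) ->
  @symplectic_frame R (1 + n) k om (col_mx K0 B1) (col_mx K1 B2).
Proof.
have [anti _ _] := com.
have Z (K : 'rV[R]_k) (B : 'M[R]_(n, k)) : (forall i, K *m om *m (row i B)^T = 0) ->
    K *m om *m B^T = 0 /\ B *m om *m K^T = 0.
  move=> KB; have E : K *m om *m B^T = 0.
    apply/rowP => j; rewrite [RHS]mxE; have := KB j => /matrixP/(_ ord0 ord0).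
    rewrite [RHS]mxE => <-; rewrite [LHS]mxE [RHS]mxE; apply: eq_bigr => l _.
    by congr (_ * _); rewrite !mxE.
  split=> //; have -> : B *m om *m K^T = - (K *m om *m B^T)^T.
    by rewrite trmx_mul trmxK trmx_mul anti mulNmx mulmxN opprK mulmxA.
  by rewrite E trmx0 oppr0.
move=> [a1 a2 a3 a4] [b1 b2 b3 b4] /Z[z1 z1'] /Z[z2 z2'] /Z[z3 z3'] /Z[z4 z4'].
split; rewrite tr_col_mx mul_col_mx mul_col_row.
- by rewrite a1 b1 z1 z1' block_mx0.
- by rewrite a2 b2 z2 z3' -(@scalar_mx_block _ 1 n).
- by rewrite a3 b3 z3 z2' (@scalar_mx_block _ 1 n) opp_block_mx !oppr0.
- by rewrite a4 b4 z4 z4' block_mx0.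
Qed.

(** The delicate point is to make the transverse vectors orthogonal to the fibre and of pairing 1
    without leaving TL0 and TL1 and without changing the base phase. *)
Lemma fiber_combine (e0 e1 : 'M[R]_(n, k)) (h0 h1 : 'rV[R]_k) (F0 F1 C0 C1 dF dC : R)
    (TL0 TL1 : set 'rV[R]_k) :
  TL0 = rowspace (col_mx h0 e0) -> TL1 = rowspace (col_mx h1 e1) ->
  (forall u w, TL0 u -> TL0 w -> u *m om *m w^T = 0) ->
  (forall u w, TL1 u -> TL1 w -> u *m om *m w^T = 0) ->
  is_degree vert0 om res (rowspace e0) (rowspace e1) F0 F1 dF ->
  is_degree setT (omega_std R 1) (@volf R 1 1) (rowspace (h0 *m D)) (rowspace (h1 *m D)) C0 C1 dC ->
  @is_degree R n.+1 k setT om (volf a) TL0 TL1 (F0 + C0) (F1 + C1) (dF + dC).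
Proof.
move=> T0 T1 iso0 iso1 [B1 [B2 [lF [[TB sB] [eB1 eB2] [lFc lF0] hF ->]]]].
move=> [b1 [b2 [lC [[_ sb] [hb1 hb2] [lCc lC0] hC ->]]]].
have [b11 b12 b21 b22] := sb; have [B11 B12 B21 B22] := sB; have [anti _ _] := com.
have b10 : b1 != 0.
  apply: contra_eq_neq b12 => ->; rewrite !mul0mx; apply/eqP => /matrixP/(_ ord0 ord0).
  by rewrite !mxE eqxx => /eqP; rewrite eq_sym oner_eq0.
have b20 : b2 != 0.
  apply: contra_eq_neq b12 => ->; rewrite trmx0 !mulmx0; apply/eqP => /matrixP/(_ ord0 ord0).
  by rewrite !mxE eqxx => /eqP; rewrite eq_sym oner_eq0.
have vertB u : vert0 u -> exists x y, u = x *m B1 + y *m B2.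
  rewrite TB => /submxP [x ->]; exists (lsubmx x), (rsubmx x).
  by rewrite -{1}[x]hsubmxK mul_row_col.
have BD i : row i B1 *m D = 0 /\ row i B2 *m D = 0.
  have : vert0 (row i B1) /\ vert0 (row i B2).
    rewrite TB; split; apply: (submx_trans (row_sub _ _)); rewrite -addsmxE.
      exact: addsmxSl.
    exact: addsmxSr.
  by [].
have B1D : B1 *m D = 0 by apply/row_matrixP => i; rewrite row_mul row0; exact: (BD i).1.
have B2D : B2 *m D = 0 by apply/row_matrixP => i; rewrite row_mul row0; exact: (BD i).2.
have [g0 [g0D T0']] := rebase_frame eB1 hb1 b10.
have [g1 [g1D T1']] := rebase_frame eB2 hb2 b20.
have iso_frame (TL : set 'rV[R]_k) (g : 'rV[R]_k) (B : 'M[R]_(n, k)) : TL = rowspace (col_mx g B) ->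
    (forall u w, TL u -> TL w -> u *m om *m w^T = 0) -> g *m om *m B^T = 0.
  move=> TE iso; apply/rowP => j; rewrite [RHS]mxE.
  have Tg : TL g.
    by rewrite TE; apply: submx_trans (addsmxSl g B) _; rewrite addsmxE.
  have TBj : TL (row j B).
    by rewrite TE; apply: submx_trans (row_sub _ _) _; apply: submx_trans (addsmxSr g B) _;
        rewrite addsmxE.
  have := iso _ _ Tg TBj => /matrixP/(_ ord0 ord0).
  rewrite [RHS]mxE => <-; rewrite [LHS]mxE [RHS]mxE; apply: eq_bigr => l _.
  by congr (_ * _); rewrite !mxE.
have g0B1 := iso_frame _ _ _ (etrans T0 T0') iso0.
have g1B2 := iso_frame _ _ _ (etrans T1 T1') iso1.
(* Since TL0 is isotropic, g0 already pairs to 0 with B1; the pairing with B2 is removed by adding a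
   combination of B1, so H0 stays in TL0. For H1 the roles are exchanged, and the sign changes
   because B2 pairs with B1 to -1. *)
pose H0 := g0 - (g0 *m om *m B2^T) *m B1.
pose H1 := g1 + (g1 *m om *m B1^T) *m B2.
have H0D : H0 *m D = b1 by rewrite /H0 mulmxBl -(mulmxA _ B1) B1D mulmx0 subr0.
have H1D : H1 *m D = b2 by rewrite /H1 mulmxDl -(mulmxA _ B2) B2D mulmx0 addr0.
have H0B1 : H0 *m om *m B1^T = 0.
  by rewrite /H0 !mulmxBl -!(mulmxA (g0 *m om *m B2^T)) B11 g0B1 mulmx0 subr0.
have H0B2 : H0 *m om *m B2^T = 0.
  by rewrite /H0 !mulmxBl -!(mulmxA (g0 *m om *m B2^T)) B12 mulmx1 subrr.
have H1B1 : H1 *m om *m B1^T = 0.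
  by rewrite /H1 !mulmxDl -!(mulmxA (g1 *m om *m B1^T)) B21 mulmxN mulmx1 subrr.
have H1B2 : H1 *m om *m B2^T = 0.
  by rewrite /H1 !mulmxDl -!(mulmxA (g1 *m om *m B1^T)) B22 g1B2 mulmx0 addr0.
have orth (H : 'rV[R]_k) : H *m om *m B1^T = 0 -> H *m om *m B2^T = 0 ->
    forall w : 'rV[R]_k, w *m D = 0 -> H *m om *m w^T = 0.
  move=> hB1 hB2 w /vertB [x [y ->]]; rewrite linearD /= !trmx_mul mulmxDr.
  by rewrite !(mulmxA (H *m om)) hB1 hB2 !mul0mx addr0.
have o0 := orth _ H0B1 H0B2; have o1 := orth _ H1B1 H1B2.
have := horizontal_pos o0 o1; rewrite H0D H1D => /(_ b12).
set rho := (H0 *m om *m H1^T) ord0 ord0 => rho0.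
(* The factor is split evenly between the two vectors, so dv maps the new pair to a common positive
   multiple of (b1, b2) and the base short path is merely rescaled. *)
pose r := Num.sqrt rho; have r0 : 0 < r by rewrite sqrtr_gt0.
have rV : r^-1 != 0 by rewrite invr_eq0 gt_eqF.
pose K0 := r^-1 *: H0; pose K1 := r^-1 *: H1.
have K0D : K0 *m D = r^-1 *: b1 by rewrite -scalemxAl H0D.
have K1D : K1 *m D = r^-1 *: b2 by rewrite -scalemxAl H1D.
have K01 : K0 *m om *m K1^T = 1%:M.
  rewrite /K0 /K1 linearZ /= -!scalemxAl -scalemxAr scalerA (mx11_scalar (H0 *m om *m H1^T)) -/rho.
  rewrite scale_scalar_mx -invfM -expr2 sqr_sqrtr ?ltW // mulVf ?gt_eqF //.
have sK : symplectic_frame om K0 K1.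
  split => //; [exact: antisym_row | | exact: antisym_row].
  have -> : K1 *m om *m K0^T = - (K0 *m om *m K1^T)^T.
    by rewrite trmx_mul trmxK trmx_mul anti mulNmx mulmxN opprK mulmxA.
  by rewrite K01 trmx1.
have oK0 (w : 'rV[R]_k) : w *m D = 0 -> K0 *m om *m w^T = 0 by move=> wD;
    rewrite /K0 -!scalemxAl o0 ?scaler0.
have oK1 (w : 'rV[R]_k) : w *m D = 0 -> K1 *m om *m w^T = 0 by move=> wD;
    rewrite /K1 -!scalemxAl o1 ?scaler0.
have sf : @symplectic_frame R (1 + n) k om (col_mx K0 B1) (col_mx K1 B2).
  apply: symplectic_frame_col => // i; by [apply: oK0; case: (BD i) | apply: oK1; case: (BD i)].
exists (col_mx K0 B1 : 'M[R]_(1 + n, k)), (col_mx K1 B2 : 'M[R]_(1 + n, k)), (fun t => lF t + lC t).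
split.
- split; last exact: sf.
  have ff : row_free (col_mx (col_mx K0 B1 : 'M[R]_(1 + n, k)) (col_mx K1 B2 : 'M[R]_(1 + n, k))).
    apply: row_free_ker => x;
        rewrite -[x]hsubmxK mul_row_col => /(symplectic_frame_free sf) [-> ->].
    exact: row_mx0.
  apply/seteqP; split => // u _; rewrite /rowspace /=; apply: submx_full.
  by move: ff; rewrite /row_full /row_free.
- split.
    rewrite T0 T0' /K0 /H0 scalerBr scalemxAl -mulNmx; exact: esym (rebase _ _ _ rV).
  rewrite T1 T1' /K1 /H1 scalerDr scalemxAl; exact: esym (rebase _ _ _ rV).
- split; last by rewrite lF0 lC0.
  apply: cont_on_within.
  apply: (@cont_on_comp R (R * R)%type R _ setT (fun t => (lF t, lC t)) (fun u => u.1 + u.2)) => //.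
    by apply: cont_on_pair; exact: within_cont_on.
  by apply: continuous_cont_on => u _; exact: add_continuous.
- move=> t t01; rewrite mulrDr cisD hF // hC //.
  have [PF _] := short_path_lagrangian t sB (trmx1 _ _) (unitmx1 _ _).
  have [Pb _] := short_path_lagrangian t sb (trmx1 _ _) (unitmx1 _ _).
  rewrite mul1mx in PF; rewrite mul1mx in Pb.
  have PD : short_path B1 B2 t *m D = 0.
    by rewrite /short_path mulmxBl -!scalemxAl B1D B2D !scaler0 subr0.
  have KD : short_path K0 K1 t *m D = r^-1 *: short_path b1 b2 t.
    by rewrite /short_path mulmxBl -(scalemxAl _ K0) -(scalemxAl _ K1) K0D K1D scalerBr !scalerA
        !(mulrC r^-1).
  have b0 : short_path b1 b2 t != 0.
    by apply: contraTneq Pb => ->; rewrite /row_free mxrank0.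
  have KD0 : short_path K0 K1 t *m D != 0 by rewrite KD scaler_eq0 (negbTE rV).
  have E : short_path (col_mx K0 B1 : 'M[R]_(1 + n, k)) (col_mx K1 B2 : 'M[R]_(1 + n, k)) t =
    col_mx (short_path K0 K1 t) (short_path B1 B2 t) by exact: short_path_col.
  rewrite (residue_phase rd PD PF) (base_phase b0).
  apply: etrans (esym _) (esym (congr1 (fun M => squared_phase (volf a) (rowspace M)) E)).
  apply: etrans (total_phase rd PD PF KD0) _; congr (_ * _).
  by rewrite KD cmxZ mxE phaseM phase_real ?mul1r.
- ring.
Qed.

End FiberBase.

Lemma continuous_short_path (R : realType) d k (B1 B2 : 'M[R]_(d, k)) i j :
  continuous (fun t => short_path B1 B2 t i j).
Proof.
move=> t; have -> : (fun t => short_path B1 B2 t i j) =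
    (fun t => cos (pi * t / 2) * B1 i j - sin (pi * t / 2) * B2 i j).
  by apply/funext => s; rewrite !mxE.
have ct : {for t, continuous (fun t : R => pi * t / 2)}.
  have c1 : {for t, continuous (fun t : R => pi * t)} by apply: continuous_scale; exact: cvg_id.
  by apply: (continuousM c1); exact: cst_continuous.
have cc : {for t, continuous (fun t : R => cos (pi * t / 2) * B1 i j)}.
  apply: continuousM; last exact: cst_continuous.
  by apply: (@continuous_comp _ _ _ _ cos _ ct); exact: continuous_cos.
have cs : {for t, continuous (fun t : R => sin (pi * t / 2) * B2 i j)}.
  apply: continuousM; last exact: cst_continuous.
  by apply: (@continuous_comp _ _ _ _ sin _ ct); exact: continuous_sin.
exact: (continuousB cc cs).
Qed.

(** * Existence of the fibre and base degrees at a transverse intersection *)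

Section FiberBaseDegrees.
Variables (R : realType) (n : nat).
Local Notation k := (n.+1 + n.+1)%N.
Variables (om : 'M[R]_k) (D : 'M[R]_(k, 1 + 1)) (a : R[i]) (res : 'M[R]_(n, k) -> R[i]).
Hypothesis rd : residue_data om D a res.

Lemma dv_surjective (b : 'rV[R]_(1 + 1)) : exists u : 'rV[R]_k, u *m D = b.
Proof.
have [h hD] := regular_vector rd; have [x [y ->]] := complex_line b hD.
exists (x *: h + y *: (h *m Jmx R n.+1)).
by rewrite mulmxDl -!scalemxAl -[h *m Jmx R n.+1 *m D]mulmxA (rd_holo rd) mulmxA.
Qed.

Variables (e0 e1 : 'M[R]_(n, k)) (h0 h1 : 'rV[R]_k).
Hypotheses (e0D : e0 *m D = 0) (e1D : e1 *m D = 0).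
Hypotheses (f0 : row_free e0) (f1 : row_free e1).
Hypotheses (h0D : h0 *m D != 0) (h1D : h1 *m D != 0).
Hypotheses (iso0 : e0 *m om *m e0^T = 0) (iso1 : e1 *m om *m e1^T = 0).
Hypothesis trans : forall u : 'rV[R]_k, exists u0 u1,
  [/\ rowspace (col_mx h0 e0) u0, rowspace (col_mx h1 e1) u1 & u = u0 + u1].

Let split_vector (u : 'rV[R]_k) : exists (s0 s1 : R) (x y : 'rV[R]_n),
  u = s0 *: h0 + x *m e0 + (s1 *: h1 + y *m e1).
Proof.
have [u0 [u1 [/submxP [x ->] /submxP [y ->] ->]]] := trans u.
exists (lsubmx x ord0 ord0), (lsubmx y ord0 ord0), (rsubmx x), (rsubmx y).
by rewrite -{1}[x]hsubmxK -{1}[y]hsubmxK !mul_row_col -!mul_scalar_mx -!mx11_scalar.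
Qed.

Let split_base (b : 'rV[R]_(1 + 1)) : exists s0 s1 : R, b = s0 *: (h0 *m D) + s1 *: (h1 *m D).
Proof.
have [u <-] := dv_surjective b; have [s0 [s1 [x [y ->]]]] := split_vector u.
exists s0, s1; rewrite !mulmxDl -!scalemxAl -(mulmxA x) -(mulmxA y) e0D e1D !mulmx0.
by rewrite !addr0.
Qed.

(** Transversality and surjectivity of dv make the images of h0 and h1 span the plane, so they are
    independent. *)
Let base_indep (s0 s1 : R) : s0 *: (h0 *m D) + s1 *: (h1 *m D) = 0 -> s0 = 0 /\ s1 = 0.
Proof.
pose M := col_mx (h0 *m D) (h1 *m D).
have fullM : row_full M.
  rewrite -sub1mx; apply/row_subP => i; have [t0 [t1 ->]] := split_base (row i 1%:M).
  by rewrite -!mul_scalar_mx -mul_row_col submxMl.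
have freeM : row_free M by move: fullM; rewrite /row_full /row_free.
move=> s; have := @row_free_inj0 _ _ _ M (row_mx s0%:M s1%:M) freeM.
rewrite /M mul_row_col !mul_scalar_mx => /(_ s) E.
have : row_mx s0%:M s1%:M = row_mx (0 : 'rV[R]_1) (0 : 'rV[R]_1) by rewrite E row_mx0.
move=> /eq_row_mx [/matrixP/(_ ord0 ord0) + /matrixP/(_ ord0 ord0)].
by rewrite !mxE eqxx !mulr1n.
Qed.

(** Decompose a vertical vector along the two tangent spaces: by [base_indep] the coefficients of h0
    and h1 vanish, so e0 and e1 span ker dv, which is transversality inside the fibre. *)
Lemma fiber_degree_exists (F0 F1 : R) : cis (2 * pi * F0) = squared_phase res (rowspace e0) ->
  exists d, is_degree [set u | u *m D = 0] om res (rowspace e0) (rowspace e1) F0 F1 d.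
Proof.
move=> hF0; have com := rd_compatible rd.
have span (u : 'rV[R]_k) : [set u | u *m D = 0] u <-> exists x y, u = x *m e0 + y *m e1.
  split=> [uD|[x [y ->]]]; last by rewrite /= mulmxDl -(mulmxA x) -(mulmxA y) e0D e1D !mulmx0 addr0.
  have [s0 [s1 [x [y uE]]]] := split_vector u.
  have [|s00 s10] := @base_indep s0 s1.
    have : u *m D = 0 by [].
    by rewrite uE !mulmxDl -!scalemxAl -(mulmxA x) -(mulmxA y) e0D e1D !mulmx0 !addr0.
  by exists x, y; rewrite uE s00 s10 !scale0r !add0r.
have [B2 [sf TB eB2]] := symplectic_frame_exists com (@vert_J _ _ _ _ _ _ rd) span f0 iso0 iso1.
have B2D : B2 *m D = 0.
  apply/row_matrixP => i; rewrite row_mul row0.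
  have : rowspace e1 (row i B2) by rewrite -eB2; exact: row_sub.
  by move=> /submxP [x ->]; rewrite -mulmxA e1D mulmx0.
have PD t : short_path e0 B2 t *m D = 0.
  by rewrite /short_path mulmxBl -!scalemxAl e0D B2D !scaler0 subr0.
have PF t : row_free (short_path e0 B2 t) /\ short_path e0 B2 t *m om *m (short_path e0 B2 t)^T = 0.
  by have := short_path_lagrangian t sf (trmx1 _ _) (unitmx1 _ _); rewrite mul1mx.
have [h hD] := regular_vector rd.
(* For this fixed h the residue along the path is a volume value divided by the constant c, which
   gives its continuity. *)
pose c := (-1) ^+ n * cmx (h *m D) ord0 ord0.
have c0 : c != 0 by rewrite mulf_neq0 ?signr_eq0 // cmx11_eq0.
have cres t : ccont t (fun t => res (short_path e0 B2 t)).
  have -> : (fun t => res (short_path e0 B2 t)) =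
      (fun t => c^-1 * volf a (col_mx h (short_path e0 B2 t) : 'M[R]_(1 + n, k))).
    by apply/funext => s; rewrite (rd_residue rd) // mulKf.
  apply: ccontM; first exact: ccont_cst.
  apply: ccont_volf => i j; rewrite -(fintype.splitK (i : 'I_(1 + n))).
  case: (fintype.split _) => l /=.
    have -> : (fun x : R => (col_mx h (short_path e0 B2 x) : 'M[R]_(1 + n, k)) (lshift n l) j) =
      cst (h l j) by apply/funext => x; rewrite col_mxEu.
    exact: cst_continuous.
  have -> : (fun x : R => (col_mx h (short_path e0 B2 x) : 'M[R]_(1 + n, k)) (rshift 1 l) j) =
    (fun x => short_path e0 B2 x l j) by apply/funext => x; rewrite col_mxEd.
  exact: continuous_short_path.
have [||l [lc l0 hl]] := @short_path_lift _ _ _ res e0 B2 (fun t =>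
    res (short_path e0 B2 t)) F0 _ _ cres hF0.
- by move=> t _; apply: (residue_phase rd (PD t)); case: (PF t).
- by move=> t _; have [? ?] := PF t; exact: (residue_neq0 rd).
by exists (F1 - F0 - (l 1 - l 0)), e0, B2, l; split.
Qed.

Lemma base_degree_exists (C0 C1 : R) :
  cis (2 * pi * C0) = squared_phase (@volf R 1 1) (rowspace (h0 *m D)) ->
  exists d, is_degree setT (omega_std R 1) (@volf R 1 1) (rowspace (h0 *m D)) (rowspace (h1 *m
      D)) C0 C1 d.
Proof.
move=> hC0; have com := omega_std_compatible R 1; have [anti _ _] := com.
have span (u : 'rV[R]_(1 + 1)) : [set: 'rV[R]_(1 + 1)] u <->
    exists x y : 'rV[R]_1, u = x *m (h0 *m D) + y *m (h1 *m D).
  split=> // _; have [s0 [s1 ->]] := split_base u.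
  by exists s0%:M, s1%:M; rewrite !mul_scalar_mx.
have fb (b : 'rV[R]_(1 + 1)) : b != 0 -> row_free b.
  by move=> b0; apply: row_free_ker => x; rewrite (mx11_scalar x) mul_scalar_mx => /eqP;
    rewrite scaler_eq0 (negbTE b0) orbF => /eqP ->; rewrite raddf0.
have [b2 [sf TB eb2]] := symplectic_frame_exists com (fun _ _ => Logic.I) span (fb _ h0D)
  (antisym_row _ anti) (antisym_row _ anti).
have b0 t : short_path (h0 *m D) b2 t != 0.
  have [Pb _] := short_path_lagrangian t sf (trmx1 _ _) (unitmx1 _ _).
  by rewrite mul1mx in Pb; apply: contraTneq Pb => ->; rewrite /row_free mxrank0.
have cE (b : 'rV[R]_(1 + 1)) : volf 1 b = cmx b ord0 ord0 by rewrite /volf mul1r det_mx11.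
have [||| l [lc l0 hl]] := @short_path_lift _ _ _ (@volf R 1 1) (h0 *m D) b2
  (fun t => volf 1 (short_path (h0 *m D) b2 t)) C0 _ _ _ hC0.
- by move=> t _; rewrite cE; exact: base_phase.
- by move=> t _; rewrite cE cmx11_eq0.
- move=> t; apply: ccont_volf => i j; exact: continuous_short_path.
by exists (C1 - C0 - (l 1 - l 0)), (h0 *m D), b2, l; split.
Qed.

End FiberBaseDegrees.

Theorem theorem1p13 (R : realType) (n : nat) (Y : charted R (n.+1 + n.+1))
  (om : Y -> 'M[R]_(n.+1 + n.+1)) (Om : Y -> R[i]) (v : Y -> plane R)
  (Y_kahler : kahler om)
  (Om_volume : holo_volume_form Om)
  (v_LG : symplectic_LG om v)
  (L0 L1 : set Y)
  (L0_fib : fibered_lagrangian om v L0)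
  (L1_fib : fibered_lagrangian om v L1)
  (p : Y) (pL0 : L0 p) (pL1 : L1 p)
  (L0L1_transverse : transverse L0 L1 p)
  (aF0 aF1 : Y -> R)
  (aF0_grading : grading (OmF Om v) (L0 `&` fiber v (v p)) aF0)
  (aF1_grading : grading (OmF Om v) (L1 `&` fiber v (v p)) aF1)
  (aC0 aC1 : plane R -> R)
  (aC0_grading : grading (@OmC R) (v @` L0) aC0)
  (aC1_grading : grading (@OmC R) (v @` L1) aC1) :
  exists a0 a1 : Y -> R,
    [/\ grading (OmY Om) L0 a0,
        grading (OmY Om) L1 a1
      & deg_total om Om L0 L1 a0 a1 p
        = deg_fiber om Om v (L0 `&` fiber v (v p)) (L1 `&` fiber v (v p)) aF0 aF1 p
          + deg_base (v @` L0) (v @` L1) aC0 aC1 (v p)].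
Proof.
have [v_holo _ _] := v_LG.
have [a0 [g0 a0p]] := fibered_grading Y_kahler Om_volume v_holo L0_fib pL0 aF0_grading aC0_grading.
have [a1 [g1 a1p]] := fibered_grading Y_kahler Om_volume v_holo L1_fib pL1 aF1_grading aC1_grading.
exists a0, a1; split => //.
have phases (L : set Y) aF aC : L p -> grading (OmF Om v) (L `&` fiber v (v p)) aF ->
    grading (@OmC R) (v @` L) aC ->
    cis (2 * pi * aF p) = squared_phase (OmF Om v p) (tangent (L `&` fiber v (v p)) p) /\
    cis (2 * pi * aC (v p)) = squared_phase (@OmC R (v p)) (tangent (v @` L) (v p)).
  by move=> Lp [_ hF] [_ hC]; split; [apply: hF; split | apply: hC; exists p].
have [pF0 pC0] := phases L0 _ _ pL0 aF0_grading aC0_grading.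
have [pF1 pC1] := phases L1 _ _ pL1 aF1_grading aC1_grading.
(* The gradings exclude the default values of the phases at p, as [fibered_split] requires. *)
have nz (L : set Y) aF aC :
    cis (2 * pi * aF) = squared_phase (OmF Om v p) (tangent (L `&` fiber v (v p)) p) /\
    cis (2 * pi * aC) = squared_phase (@OmC R (v p)) (tangent (v @` L) (v p)) ->
    squared_phase (OmF Om v p) (tangent (L `&` fiber v (v p)) p) != 0 /\
    squared_phase (@OmC R (v p)) (tangent (v @` L) (v p)) != 0.
  by move=> [<- <-]; split; exact: cis_neq0.
have [nF0 nC0] := nz L0 _ _ (conj pF0 pC0); have [nF1 nC1] := nz L1 _ _ (conj pF1 pC1).
have [rd [e0 [h0 [[f0 e0D] h0D TF0 TC0 TL0]]]] :=
    fibered_split Y_kahler Om_volume v_holo L0_fib pL0 nF0 nC0.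
have [_ [e1 [h1 [[f1 e1D] h1D TF1 TC1 TL1]]]] :=
    fibered_split Y_kahler Om_volume v_holo L1_fib pL1 nF1 nC1.
have isoT (L : set Y) : fibered_lagrangian om v L -> L p ->
    forall u w, tangent L p u -> tangent L p w -> u *m om p *m w^T = 0.
  move=> [[_ lag] _] Lp u w Tu Tw; have := lag p Lp u w Tu Tw; rewrite /Defs.form => E.
  by rewrite (mx11_scalar (u *m om p *m w^T)) E raddf0.
have isoE (L : set Y) (h : 'rV[R]_(n.+1 + n.+1)) (e : 'M[R]_(n, n.+1 + n.+1)) :
    tangent L p = rowspace (col_mx h e : 'M[R]_(1 + n, _)) ->
    (forall u w, tangent L p u -> tangent L p w -> u *m om p *m w^T = 0) ->
    e *m om p *m e^T = 0.
  move=> TL iso; have Te i : tangent L p (row i e).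
    rewrite TL; apply: submx_trans (row_sub _ _) _; apply: submx_trans (addsmxSr h e) _.
    by rewrite addsmxE.
  apply/matrixP => i j; rewrite [RHS]mxE.
  have := iso _ _ (Te i) (Te j) => /matrixP/(_ ord0 ord0); rewrite [RHS]mxE => <-.
  rewrite -row_mul tr_row [LHS]mxE [RHS]mxE; apply: eq_bigr => l _.
  by congr (_ * _); apply: esym; [exact: mxE | rewrite [LHS]mxE].
have T0 := isoT L0 L0_fib pL0; have T1 := isoT L1 L1_fib pL1.
have iso0 := isoE L0 h0 e0 TL0 T0; have iso1 := isoE L1 h1 e1 TL1 T1.
have trans (u : 'rV[R]_(n.+1 + n.+1)) : exists u0 u1,
    [/\ rowspace (col_mx h0 e0) u0, rowspace (col_mx h1 e1) u1 & u = u0 + u1].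
  have [u0 [u1 [t0 t1 ->]]] := L0L1_transverse u; exists u0, u1; split => //.
    by rewrite TL0 in t0.
  by rewrite TL1 in t1.
rewrite TF0 in pF0; rewrite TC0 in pC0.
have [d1 dF] := fiber_degree_exists rd e0D e1D f0 iso0 iso1 trans (aF1 p) pF0.
have [d2 dC] := base_degree_exists rd e0D e1D h0D trans (aC1 (v p)) pC0.
(* Existence of some degree is traded for the values selected in the statement, together with their
   adapted bases. *)
have {dF} dF := degreeP dF; have {dC} dC := degreeP dC.
have dT := fiber_combine rd TL0 TL1 T0 T1 dF dC.
rewrite -a0p -a1p in dT.
have dT' := degreeP dT.
(* Both the selected total degree and the sum are degrees for the same data, the gradings at p being
   the sums of the fibre and base gradings. *)
have E := degree_unique (rd_compatible rd) (rd_volume rd) dT' dT.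
rewrite /deg_total /deg_fiber /deg_base TF0 TF1 TC0 TC1.
exact: E.
Qed.
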